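(* Let $k$ be a field, let $S=k[x_1,\dots,x_n]$ be the standard graded polynomial ring, let $I$ be a graded ideal of $S$, and let $s,t\ge 0$ be integers. If $\dim S/I\le 1$ and the characteristic of $k$ is $0$ or bigger than $s+t$, then $$\operatorname{reg}(Z_{s+t}(I))\le \operatorname{reg}(Z_t(I))+\operatorname{reg}(Z_s(I)).$$
   Context: For a graded ideal $I=(f_1,\dots,f_r)$ of $S$ minimally generated by homogeneous elements $f_1,\dots,f_r$ of degrees $d_1,\dots,d_r$, let $K_\bullet(I)=\bigoplus_t K_t(I)$ be the graded Koszul complex associated to the graded $S$-linear map $\bigoplus_{i=1}^r S(-d_i)\to S$, $e_i\mapsto f_i$ (up to isomorphism it does not depend on the chosen minimal homogeneous generators). $Z_t(I)$ denotes the graded module of cycles of $K_\bullet(I)$ in homological position $t$ (so $Z_0(I)=S$). For a finitely generated graded $S$-module $M$, with $\mathfrak m=(x_1,\dots,x_n)$, the Castelnuovo-Mumford regularity is $\operatorname{reg}(M)=\max_i\{a_i(M)+i\}$, where $a_i(M)=\max\{j: H^i_{\mathfrak m}(M)_j\ne 0\}$ is the largest degree in which the $i$-th local cohomology module is nonzero ($-\infty$ if it vanishes); thus $\operatorname{reg}(0)=-\infty$. *)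

(* Defs.v *)
(* mpoly has to be imported before the classical library: in the opposite
   order the two declare incompatible notation levels. *)
From HB Require Import structures.
From mathcomp Require Import all_boot all_order all_algebra.
From mathcomp Require Import mpoly.
From mathcomp Require Import boolp classical_sets constructive_ereal.

Set Implicit Arguments.
Unset Strict Implicit.
Unset Printing Implicit Defensive.

Import Order.TTheory GRing.Theory.
Local Open Scope ring_scope.
Local Open Scope quotient_scope.

Section Localization.
Variables (R : comNzRingType) (M : lmodType R) (f : R).

Lemma scaler_expD a b (m : M) : f ^+ (a + b) *: m = f ^+ a *: (f ^+ b *: m).
Proof. by rewrite exprD scalerA. Qed.

(* The pair (m, a) stands for the fraction m / f ^ a. *)
Definition fraction_eq (u v : M * nat) : bool :=
  `[< exists l, f ^+ (l + v.2) *: u.1 = f ^+ (l + u.2) *: v.1 >].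

Lemma fraction_eq_refl : reflexive fraction_eq.
Proof. by move=> u; apply/asboolP; exists 0%N. Qed.

Lemma fraction_eq_sym : ssrbool.symmetric fraction_eq.
Proof.
by move=> u v; apply/asboolP/asboolP => -[l E]; exists l; rewrite E.
Qed.

Lemma fraction_eq_trans : transitive fraction_eq.
Proof.
move=> v u w /asboolP[l E] /asboolP[l' E']; apply/asboolP.
exists (l + l' + v.2)%N.
have -> : (l + l' + v.2 + w.2 = (l' + w.2) + (l + v.2))%N.
  by rewrite -!addnA; do !nat_congr.
rewrite scaler_expD E -scaler_expD.
have -> : (l' + w.2 + (l + u.2) = (l + u.2) + (l' + w.2))%N by rewrite addnC.
rewrite scaler_expD E' -scaler_expD; congr (f ^+ _ *: _).
by rewrite -!addnA; do !nat_congr.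
Qed.

Canonical fraction_equiv :=
  EquivRel fraction_eq fraction_eq_refl fraction_eq_sym fraction_eq_trans.

Definition localization := {eq_quot fraction_eq}.
HB.instance Definition _ := Choice.on localization.
HB.instance Definition _ := EqQuotient.on localization.

Definition frac (m : M) (a : nat) : localization := \pi_localization (m, a).

Lemma frac_eqP m a m' a' :
  frac m a = frac m' a' <-> exists l, f ^+ (l + a') *: m = f ^+ (l + a) *: m'.
Proof. by split=> [/eqmodP/asboolP|E]; last exact/eqmodP/asboolP. Qed.

Lemma fracW (u : localization) : exists m a, u = frac m a.
Proof. by exists (repr u).1, (repr u).2; rewrite /frac -surjective_pairing reprK. Qed.

Lemma frac_lift b m a : frac (f ^+ b *: m) (b + a) = frac m a.
Proof.
by apply/frac_eqP; exists 0%N; rewrite !add0n scalerA -exprD addnC.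
Qed.

Definition loc_zero : localization := frac 0 0.
Definition loc_opp (u : localization) : localization :=
  frac (- (repr u).1) (repr u).2.
Definition loc_add (u v : localization) : localization :=
  frac (f ^+ (repr v).2 *: (repr u).1 + f ^+ (repr u).2 *: (repr v).1)
       ((repr u).2 + (repr v).2).
Definition loc_scale (c : R) (u : localization) : localization :=
  frac (c *: (repr u).1) (repr u).2.

Lemma repr_frac m a :
  exists l, f ^+ (l + a) *: (repr (frac m a)).1
          = f ^+ (l + (repr (frac m a)).2) *: m.
Proof.
by apply/frac_eqP; rewrite {1}/frac -surjective_pairing reprK.
Qed.

Lemma loc_oppE m a : loc_opp (frac m a) = frac (- m) a.
Proof.
have [l E] := repr_frac m a.
by apply/frac_eqP; exists l; rewrite !scalerN E.
Qed.

Lemma loc_scaleE c m a : loc_scale c (frac m a) = frac (c *: m) a.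
Proof.
have [l E] := repr_frac m a; apply/frac_eqP; exists l.
by rewrite !scalerA ![_ * c]mulrC -!scalerA E.
Qed.

Lemma loc_addE m a m' a' :
  loc_add (frac m a) (frac m' a') = frac (f ^+ a' *: m + f ^+ a *: m') (a + a').
Proof.
have [l E] := repr_frac m a; have [l' E'] := repr_frac m' a'.
rewrite /loc_add.
move: (repr (frac m a)) (repr (frac m' a')) E E' => [p b] [p' b'] /= E E'.
apply/frac_eqP; exists (l + l')%N => /=.
rewrite !scalerDr -!scaler_expD; congr (_ + _).
  have -> : (l + l' + (a + a') + b' = (l' + a' + b') + (l + a))%N.
    by rewrite -!addnA; do !nat_congr.
  have -> : (l + l' + (b + b') + a' = (l' + a' + b') + (l + b))%N.
    by rewrite -!addnA; do !nat_congr.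
  by rewrite scaler_expD E -scaler_expD.
have -> : (l + l' + (a + a') + b = (l + a + b) + (l' + a'))%N.
  by rewrite -!addnA; do !nat_congr.
have -> : (l + l' + (b + b') + a = (l + a + b) + (l' + b'))%N.
  by rewrite -!addnA; do !nat_congr.
by rewrite scaler_expD E' -scaler_expD.
Qed.

Lemma loc_addA : associative loc_add.
Proof.
move=> u v w; have [m [a ->]] := fracW u; have [m' [a' ->]] := fracW v.
have [m2 [a2 ->]] := fracW w; rewrite !loc_addE addnA; congr frac.
rewrite !scalerDr !scalerA -!exprD !addrA (addnC a2 a').
by rewrite (addnC a2 a).
Qed.

Lemma loc_addC : commutative loc_add.
Proof.
move=> u v; have [m [a ->]] := fracW u; have [m' [a' ->]] := fracW v.
by rewrite !loc_addE addrC addnC.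
Qed.

Lemma loc_add0 : left_id loc_zero loc_add.
Proof.
move=> u; have [m [a ->]] := fracW u.
by rewrite loc_addE scaler0 expr0 scale1r add0r.
Qed.

Lemma loc_addN : left_inverse loc_zero loc_opp loc_add.
Proof.
move=> u; have [m [a ->]] := fracW u; rewrite loc_oppE loc_addE.
by apply/frac_eqP; exists 0%N; rewrite scalerN addNr !scaler0.
Qed.

HB.instance Definition _ :=
  GRing.isZmodule.Build localization loc_addA loc_addC loc_add0 loc_addN.

Lemma loc_scaleA a b u : loc_scale a (loc_scale b u) = loc_scale (a * b) u.
Proof.
by have [m [l ->]] := fracW u; rewrite !loc_scaleE scalerA.
Qed.

Lemma loc_scale1 : left_id 1 loc_scale.
Proof. by move=> u; have [m [l ->]] := fracW u; rewrite loc_scaleE scale1r. Qed.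

Lemma loc_scaleDr : right_distributive loc_scale +%R.
Proof.
move=> c u v; have [m [a ->]] := fracW u; have [m' [a' ->]] := fracW v.
change (loc_scale c (loc_add (frac m a) (frac m' a')) =
  loc_add (loc_scale c (frac m a)) (loc_scale c (frac m' a'))).
by rewrite loc_addE !loc_scaleE loc_addE scalerDr !scalerA ![c * _]mulrC.
Qed.

Lemma loc_scaleDl u : {morph loc_scale^~ u : a b / a + b}.
Proof.
move=> c c'; have [m [a ->]] := fracW u.
change (loc_scale (c + c') (frac m a) =
  loc_add (loc_scale c (frac m a)) (loc_scale c' (frac m a))).
rewrite !loc_scaleE loc_addE -scalerDr -scalerDl.
by rewrite frac_lift.
Qed.

HB.instance Definition _ := GRing.Zmodule_isLmodule.Build R localization
  loc_scaleA loc_scale1 loc_scaleDr loc_scaleDl.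

End Localization.

(* For f' = f * g, the canonical map M_f -> M_f', whose value at m / f ^ a is
   g ^ a m / f' ^ a; it is well defined by [loc_mapE]. *)
Definition loc_map (R : comNzRingType) (M : lmodType R) (f g f' : R)
    (u : localization M f) : localization M f' :=
  frac f' (g ^+ (repr u).2 *: (repr u).1) (repr u).2.

Lemma loc_mapE (R : comNzRingType) (M : lmodType R) (f g f' : R) (m : M) a :
  f' = f * g -> loc_map g f' (frac f m a) = frac f' (g ^+ a *: m) a.
Proof.
move=> ->; have [l E] := repr_frac f m a; apply/frac_eqP; exists l.
move: (repr _) E => [p b] /= E; rewrite !exprMn !scalerA.
rewrite -2!mulrA [RHS](_ : _ = (g ^+ (l + b) * g ^+ a) *: (f ^+ (l + b) *: m)).
  rewrite -E scalerA; congr (_ *: _).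
  by rewrite mulrC -!exprD; congr (g ^+ _ * _); rewrite addnAC.
by rewrite scalerA; congr (_ *: _); rewrite mulrC.
Qed.

Section Regularity.
Variables (k : fieldType) (n : nat).
Notation S := {mpoly k[n]}.

(* A graded module is a module M with its homogeneous parts gr j, j : int. *)
Variables (M : lmodType S) (gr : int -> set M).

Definition var_prod (B : {set 'I_n}) : S := \prod_(i in B) 'X_i.

(* An element of the Cech complex of M on x_1, ..., x_n: a family with a
   component in M_{x_B} for every B. The part in position p consists of the
   families supported on the B of cardinality p. *)
Definition cech := forall B : {set 'I_n}, localization M (var_prod B).

Definition cech_diff (c : cech) : cech := fun C =>
  \sum_(i in C) (-1) ^+ #|[set j in C | (j < i)%N]| *:
    loc_map 'X_i (var_prod C) (c (C :\ i)).

(* The homogeneous part of degree j of M_{x_B}, where x_B has degree #|B|. *)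
Definition loc_degree (B : {set 'I_n}) (j : int) :
    set (localization M (var_prod B)) :=
  [set u | exists m a, gr (j + (a * #|B|)%N%:Z) m /\ u = frac (var_prod B) m a].

Definition cech_part (p j : int) : set cech :=
  [set c : cech | forall B : {set 'I_n},
     if #|B|%:Z == p then loc_degree j (c B) else c B = 0].

(* H^i_m(M)_j <> 0, local cohomology being the cohomology of the Cech complex:
   some cocycle of degree j is not a coboundary. *)
Definition local_cohomology_neq0 (i : nat) (j : int) : Prop :=
  exists2 c, cech_part i%:Z j c /\ (forall C, cech_diff c C = 0) &
    ~ exists2 b, cech_part (i%:Z - 1) j b & forall C, c C = cech_diff b C.

(* The maxima are taken as suprema in \bar int, so that they are -oo for the
   zero module; over a finitely generated M they are attained. *)
Definition a_invariant (i : nat) : \bar int :=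
  supremum -oo%E [set j%:E | j in local_cohomology_neq0 i].

Definition regularity : \bar int :=
  supremum -oo%E [set (a_invariant i + i%:Z%:E)%E | i in [set: nat]].

End Regularity.
Arguments regularity {k n} M gr.

Section Koszul.
Variables (k : fieldType) (n r : nat) (d : 'I_r -> nat).
Variable (f : 'I_r -> {mpoly k[n]}).
Notation S := {mpoly k[n]}.

(* The whole complex: c A is the coefficient of e_{i_1} /\ ... /\ e_{i_t},
   where i_1 < ... < i_t are the elements of A. *)
Notation koszul := {ffun {set 'I_r} -> S^o}.

Definition koszul_diff (c : koszul) : koszul :=
  [ffun B : {set 'I_r} => \sum_(i | i \notin B)
     ((-1) ^+ #|[set j in B | (j < i)%N]| * f i) *: c (i |: B)].

Definition koszul_part (t : nat) : {pred koszul} :=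
  fun c => [forall A : {set 'I_r}, (#|A| != t) ==> (c A == 0)].

Definition is_cycle (t : nat) : {pred koszul} :=
  fun c => (c \in koszul_part t) && (koszul_diff c == 0).

Lemma is_cycle_submod t : submod_closed (is_cycle t).
Proof.
split=> [|a u v].
  apply/andP; split; first by apply/forallP=> A; rewrite ffunE eqxx implybT.
  apply/eqP/ffunP=> B; rewrite !ffunE big1 // => i _.
  by rewrite ffunE scaler0.
case/andP=> /forallP Hu /eqP/ffunP Eu /andP[/forallP Hv /eqP/ffunP Ev].
apply/andP; split.
  apply/forallP=> A; apply/implyP=> At; rewrite !ffunE.
  by rewrite (eqP (implyP (Hu A) At)) (eqP (implyP (Hv A) At)) scaler0 addr0.
apply/eqP/ffunP=> B.
transitivity (a *: koszul_diff u B + koszul_diff v B); last first.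
  by rewrite Eu Ev !ffunE scaler0 addr0.
rewrite !ffunE scaler_sumr -big_split.
apply: eq_bigr => i _ /=.
by rewrite !ffunE scalerDr !scalerA [_ * a]mulrC.
Qed.

HB.instance Definition _ t :=
  GRing.isSubmodClosed.Build S koszul (is_cycle t) (is_cycle_submod t).

Record koszul_cycles (t : nat) : Type := KoszulCycle {
  cycle_val :> koszul;
  cycle_valP : cycle_val \in is_cycle t
}.

HB.instance Definition _ t := [isSub for @cycle_val t].
HB.instance Definition _ t := [Choice of koszul_cycles t by <:].
HB.instance Definition _ t := [SubChoice_isSubLmodule of koszul_cycles t by <:].

Definition homog_int (j : int) (p : S) : bool :=
  if j is Posz e then p \is e.-homog else p == 0.

(* e_A has degree \sum_(i in A) d i. *)
Definition cycle_degree (t : nat) (j : int) : set (koszul_cycles t) :=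
  [set z | forall A : {set 'I_r},
             homog_int (j - (\sum_(i in A) d i)%N%:Z) (cycle_val z A)].

End Koszul.
Arguments koszul_cycles {k n r} f t.
Arguments cycle_degree {k n r} d f t.

Definition graded_ideal (k : fieldType) (n : nat) (I : {pred {mpoly k[n]}}) :=
  [/\ 0 \in I,
      {in I &, forall p q, p + q \in I},
      forall a, {in I, forall p, a * p \in I} &
      forall e, {in I, forall p, pihomog mdeg e p \in I}].

Definition generated_by (R : comNzRingType) (r : nat) (P : pred 'I_r)
    (f : 'I_r -> R) : set R :=
  [set p | exists c : 'I_r -> R, p = \sum_(i | P i) c i * f i].

Definition minimal_homogeneous_generators (k : fieldType) (n r : nat)
    (I : {pred {mpoly k[n]}}) (d : 'I_r -> nat) (f : 'I_r -> {mpoly k[n]}) :=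
  [/\ forall i, f i \is (d i).-homog,
      forall p, p \in I <-> generated_by predT f p &
      forall i, ~ generated_by (predC1 i) f (f i)].

(* dim R/I, the primes of R/I being the primes of R that contain I. It is -oo
   for I = R. *)
Definition dim_quotient (R : comNzRingType) (I : {pred R}) : \bar int :=
  supremum -oo%E [set l%:Z%:E | l in [set l : nat |
    exists P : nat -> {pred R},
      [/\ forall i, (i <= l)%N -> idealr_closed (P i) /\ prime_idealr_closed (P i),
          {subset I <= P 0%N} &
          forall i, (i < l)%N ->
            {subset P i <= P i.+1} /\ ~ {subset P i.+1 <= P i}]]].

(* Main.v *)
(* Contracting twice with the same form shows that the comultiplication of the
   exterior algebra maps Z_{s+t} into Z_s(I, Z_t), the elements of K_s (x) K_t
   killed by both differentials; followed by the multiplication of the exterior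
   algebra it is binomial(s+t, s) times the identity, so Z_{s+t} is a graded
   direct summand of Z_s(I, Z_t). Inverting a generator f_i splits the Koszul
   complex, so I kills Z_s(I, Z_t) modulo the image of Z_s (x) Z_t, and, as
   dim S/I <= 1, both have the same local cohomology from H^2 on. The regularity
   of Z_s (x) Z_t is bounded by resolving Z_s by free modules with generators in
   the degrees allowed by its regularity, the modules Tor being again killed by
   powers of I; and H^0, H^1 of Z_{s+t} vanish because it is a second syzygy. *)
Require Import Defs.
From HB Require Import structures.
From mathcomp Require Import all_boot all_order all_algebra.
From mathcomp Require Import mpoly.
From mathcomp Require Import boolp classical_sets constructive_ereal.
From mathcomp Require Import fintype finset zify ring.
Set Implicit Arguments.
Unset Strict Implicit.
Unset Printing Implicit Defensive.
Import Order.TTheory GRing.Theory.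
Local Open Scope ring_scope.

(** * Cech cohomology as a colimit of Koszul cohomology *)

(** No quotient, tensor product or resolution is ever formed. A graded module is a family of
    predicates inside an ambient module, a quotient is a pair of nested families, and only the
    vanishing of cohomology in a given degree is stated; each long exact sequence thus shrinks to
    three consecutive terms. M (x) N is replaced by its image in a free module tensored with the
    ambient module of N; what is lost at each syzygy step is killed by the [f i], hence invisible
    from H^2 on.

    The dimension enters through a homogeneous y of positive degree modulo which, together with I,
    all variables are nilpotent. Since k may be finite, y cannot be taken linear in general.

    Free modules have no H^0 and H^1 only when n >= 2. For n <= 1 the ideal is principal, and
    Z_{s+t} = 0 as soon as s, t > 0. For s = 0 or t = 0 the bound needs no more than reg(Z_0) >= 0.
    The value -oo is a case of its own: a module of regularity -oo must be shown to vanish, by a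
    Nakayama argument, before Z_{s+t} can be given regularity -oo as well. *)

Section Signs.
Variables (R : pzRingType) (r : nat).
Implicit Types (i l : 'I_r) (B C : {set 'I_r}).

Definition sg i C : R := (-1) ^+ #|[set j in C | (j < i)%N]|.

Lemma sgC i C (x : R) : sg i C * x = x * sg i C.
Proof. exact/esym/commr_sign. Qed.

Lemma sgM i C : sg i C * sg i C = 1.
Proof. by rewrite -exprD addnn -muln2 exprM sqrr_sign. Qed.

Lemma sgU1 i l C : l \notin C -> sg i (l |: C) = (-1) ^+ (l < i)%N * sg i C.
Proof.
move=> lC; rewrite /sg -exprD; congr (_ ^+ _).
case: (ltnP l i) => li.
  rewrite (cardsD1 l) !inE eqxx li; congr addn; apply: eq_card => j.
  by rewrite !inE; case: eqP => //= ->; rewrite (negPf lC).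
rewrite add0n; apply: eq_card => j; rewrite !inE.
by case: eqP => //= ->; rewrite (negPf lC) ltnNge li.
Qed.

Lemma sgU1x i C : sg i (i |: C) = sg i C.
Proof.
rewrite /sg; congr (_ ^+ _); apply: eq_card => j; rewrite !inE.
by case: eqP => //= ->; rewrite ltnn andbF.
Qed.

Lemma sgD1x i C : sg i (C :\ i) = sg i C.
Proof.
case: (boolP (i \in C)) => iC; first by rewrite -{2}(setD1K iC) sgU1x.
by rewrite (setDidPl _) // disjoint_sym disjoints1.
Qed.

Lemma sgUD i l C : l != i -> i \notin C -> l \in C ->
  sg i (C :\ l) * sg l C = - (sg i C * sg l (i |: C)).
Proof.
move=> li iC lC; rewrite -{3}(setD1K lC) !sgU1 ?inE ?eqxx //.
case: (ltngtP l i) => lti; rewrite ?expr0 ?expr1 ?mul1r ?mulN1r ?mulNr ?mulrN ?opprK //.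
by move/ord_inj: lti li => ->; rewrite eqxx.
Qed.

Lemma sgDD i l C : i \in C -> l \in C -> i != l ->
  sg i C * sg l (C :\ i) = - (sg l C * sg i (C :\ l)).
Proof.
move=> iC lC il; rewrite -{1}(setD1K lC) -{3}(setD1K iC).
rewrite !sgU1 ?inE ?eqxx //.
case: (ltngtP l i) => lti; rewrite ?expr0 ?expr1 ?mul1r ?mulN1r ?mulNr ?opprK //.
- by rewrite sgC.
- by rewrite sgC.
by move/ord_inj: lti il => ->; rewrite eqxx.
Qed.

End Signs.
Arguments sg {R r}.

(** The reason why all differentials below square to zero. The term at (i, l) is matched with the
    one at (l, i) across the diagonal, which is valid in characteristic 2 as well. *)
Lemma big_antisym (V : zmodType) r (P : pred 'I_r) (t : 'I_r -> 'I_r -> V) :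
  (forall i l, P i -> P l -> i != l -> t i l = - t l i) ->
  \sum_(i | P i) \sum_(l | P l && (l != i)) t i l = 0.
Proof.
move=> H.
have -> : \sum_(i | P i) \sum_(l | P l && (l != i)) t i l =
  \sum_(i | P i) \sum_(l | P l && (l < i)%N) t i l +
  \sum_(i | P i) \sum_(l | P l && (i < l)%N) t i l.
  rewrite -big_split; apply: eq_bigr => i Pi /=.
  rewrite (bigID (fun l : 'I_r => (l < i)%N)) /=; congr (_ + _).
    apply: eq_bigl => l; rewrite -andbA; congr andb.
    by rewrite -val_eqE /=; case: ltngtP.
  apply: eq_bigl => l; rewrite -andbA; congr andb.
  by rewrite -val_eqE /=; case: ltngtP.
rewrite [X in _ + X](exchange_big_dep P) /=; last by move=> i j _ /andP[].
rewrite -big_split big1 // => i Pi /=.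
rewrite [X in _ + X](eq_bigl (fun l => P l && (l < i)%N)); last first.
  by move=> l; rewrite Pi.
rewrite -big_split big1 //= => l /andP[Pl li].
by rewrite (H l i) ?subrr // -?val_eqE ?ltn_eqF // addrN.
Qed.

Section Cochains.
Variables (k : fieldType) (n : nat).
Notation S := {mpoly k[n]}.
Variable E : lmodType S.
Notation cochain := {ffun {set 'I_n} -> E}.
Implicit Types (m b : cochain) (B C : {set 'I_n}) (a l : nat).

Lemma var_prodD1 C i : i \in C -> var_prod k C = 'X_i * var_prod k (C :\ i).
Proof.
move=> iC; rewrite /var_prod (bigD1 i) //=; congr (_ * _).
by apply: eq_bigl => j; rewrite !inE andbC.
Qed.

(** With m standing for numerators over [var_prod k B ^+ a], this is the Cech differential:
    enlarging C \ i to C multiplies the numerator by x_i^a. Then [craise l] rewrites the same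
    fractions over the exponent a + l. *)
Definition cdiff a m : cochain := [ffun C : {set 'I_n} =>
  \sum_(i in C) (sg i C * 'X_i ^+ a) *: m (C :\ i)].

Definition craise l m : cochain := [ffun C : {set 'I_n} => var_prod k C ^+ l *: m C].

Lemma cdiffD a : {morph cdiff a : m b / m + b}.
Proof.
move=> m b; apply/ffunP => C; rewrite !ffunE -big_split.
by apply: eq_bigr => i _; rewrite ffunE scalerDr.
Qed.

Lemma cdiffZ a c m : cdiff a (c *: m) = c *: cdiff a m.
Proof.
apply/ffunP => C; rewrite !ffunE scaler_sumr; apply: eq_bigr => i _.
by rewrite ffunE !scalerA mulrC.
Qed.

Lemma cdiffN a m : cdiff a (- m) = - cdiff a m.
Proof. by rewrite -scaleN1r cdiffZ scaleN1r. Qed.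

Lemma cdiffB a m b : cdiff a (m - b) = cdiff a m - cdiff a b.
Proof. by rewrite cdiffD cdiffN. Qed.

Lemma cdiff0 a : cdiff a 0 = 0.
Proof. by have := cdiffB a 0 0; rewrite !subrr. Qed.

Lemma craiseB l m b : craise l (m - b) = craise l m - craise l b.
Proof. by apply/ffunP => C; rewrite !ffunE scalerBr. Qed.

Lemma craise0 l : craise l 0 = 0.
Proof. by apply/ffunP => C; rewrite !ffunE scaler0. Qed.

Lemma craise_craise l l' m : craise l (craise l' m) = craise (l' + l) m.
Proof. by apply/ffunP => C; rewrite !ffunE scalerA -exprD addnC. Qed.

Lemma cdiff_craise a l m : cdiff (a + l) (craise l m) = craise l (cdiff a m).
Proof.
apply/ffunP => C; rewrite !ffunE scaler_sumr; apply: eq_bigr => i iC.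
rewrite ffunE !scalerA; congr (_ *: _).
by rewrite (var_prodD1 iC) exprMn exprD; ring.
Qed.

Lemma cdiff_cdiff a m : cdiff a (cdiff a m) = 0.
Proof.
apply/ffunP => C; rewrite !ffunE.
transitivity (\sum_(i in C) \sum_(l | (l \in C) && (l != i))
   (sg i C * sg l (C :\ i) * 'X_i ^+ a * 'X_l ^+ a) *: m (C :\ i :\ l)).
  apply: eq_bigr => i iC; rewrite ffunE scaler_sumr.
  apply: eq_big => [l|l _]; first by rewrite !inE andbC.
  by rewrite scalerA; congr (_ *: _); ring.
apply: big_antisym => i l iC lC il.
rewrite setDDl setUC -setDDl -scaleNr; congr (_ *: _).
rewrite -2!mulNr mulrAC; congr (_ * _ * _); exact: sgDD.
Qed.

(* The pieces of a graded module, all inside E: A j is the part of degree j. *)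
Definition gsub (A : int -> E -> Prop) : Prop :=
  [/\ forall j, A j 0, forall j x y, A j x -> A j y -> A j (x + y),
      forall j (c : k) x, A j x -> A j (c%:MP *: x) &
      forall j i x, A j x -> A (j + 1) ('X_i *: x)].

(** Here e is the degree of the numerators: a family of degree j at level a in position p has e = j
    + a p. *)
Definition coch (A : int -> E -> Prop) (p : int) (e : int) m : Prop :=
  forall B : {set 'I_n}, if #|B|%:Z == p then A e (m B) else m B = 0.

End Cochains.

Section GradedSubmodules.
Variables (k : fieldType) (n : nat).
Notation S := {mpoly k[n]}.

Lemma hom_natP e (p : S) : homog_int e%:Z p = (p \is e.-homog).
Proof. by []. Qed.

Lemma hom0 j : homog_int j (0 : S).
Proof. by case: j => e //=; rewrite rpred0. Qed.

Lemma homD j (p q : S) : homog_int j p -> homog_int j q -> homog_int j (p + q).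
Proof. by case: j => e /=; [apply: rpredD|move=> /eqP-> /eqP->; rewrite addr0]. Qed.

Lemma homM i j (p q : S) :
  homog_int i p -> homog_int j q -> homog_int (i + j) (p * q).
Proof.
case: i j => [a|a] [b|b]; rewrite ?hom_natP => hp hq.
- exact: dhomogM.
- by rewrite (eqP hq) mulr0 hom0.
- by rewrite (eqP hp) mul0r hom0.
- by rewrite (eqP hp) mul0r hom0.
Qed.

Lemma homX i a : homog_int a%:Z ('X_i ^+ a : S).
Proof. by rewrite hom_natP mpolyXn dhomogX /= mdegMn mdeg1 mul1n. Qed.

Lemma homC (c : k) : homog_int 0 (c%:MP : S).
Proof. by rewrite (hom_natP 0) -alg_mpolyC rpredZ ?dhomog1. Qed.


Variable E : lmodType S.
Notation cochain := {ffun {set 'I_n} -> E}.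
Implicit Types (m b : cochain) (A B : int -> E -> Prop).

Lemma gsub_zero : gsub (fun _ (x : E) => x = 0).
Proof.
by split=> // [j x y -> ->|j c x ->|j i x ->]; rewrite ?addr0 ?scaler0.
Qed.

Lemma gsub_eq A i j x : i = j -> A i x -> A j x.
Proof. by move->. Qed.

Section Closure.
Variables (A : int -> E -> Prop).
Hypothesis gA : gsub A.

Lemma gsub0 j : A j 0.
Proof. by case: gA. Qed.

Lemma gsubD j x y : A j x -> A j y -> A j (x + y).
Proof. by case: gA => _ H _ _; apply: H. Qed.

Lemma gsubC j (c : k) x : A j x -> A j (c%:MP *: x).
Proof. by case: gA => _ _ H _; apply: H. Qed.

Lemma gsubN j x : A j x -> A j (- x).
Proof. by move/(gsubC (-1)); rewrite mpolyCN mpolyC1 scaleN1r. Qed.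

Lemma gsubB j x y : A j x -> A j y -> A j (x - y).
Proof. by move=> Ax /gsubN; apply: gsubD. Qed.

Lemma gsub_sum j (I : finType) (P : pred I) (F : I -> E) :
  (forall i, P i -> A j (F i)) -> A j (\sum_(i | P i) F i).
Proof. by move=> H; elim/big_ind: _ => //; [apply: gsub0|apply: gsubD]. Qed.

Lemma gsub_mnm j (u : 'X_{1..n}) x : A j x -> A (j + (mdeg u)%:Z) ('X_[u] *: x).
Proof.
move: u; suff H d : forall u : 'X_{1..n}, mdeg u = d -> A j x ->
    A (j + d%:Z) ('X_[u] *: x).
  by move=> u; apply: (H _ u).
elim: d => [|d IH] u.
  by move/eqP; rewrite mdeg_eq0 => /eqP->; rewrite mpolyX0 scale1r addr0.
move=> du Ax.
have [i ui] : exists i, u i != 0%N.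
  apply/existsP; apply: contraTT isT => /existsPn H; suff u0 : u = 0%MM.
    by move: du; rewrite u0 mdeg0.
  by apply/mnmP => i; rewrite mnm0E; apply/eqP; rewrite -[_ == _]negbK.
have le : (U_(i) <= u)%MM by rewrite lep1mP.
rewrite -(submK le) addmC mpolyXD -scalerA.
have -> : j + d.+1%:Z = j + d%:Z + 1 by rewrite -addn1 PoszD addrA.
case: gA => _ _ _; apply; apply: IH Ax.
by have := mdegD (u - U_(i))%MM U_(i)%MM; rewrite submK // du mdeg1; lia.
Qed.

Lemma gsub_hom j e p x : homog_int e p -> A j x -> A (j + e) (p *: x).
Proof.
case: e => e; last by move=> /eqP-> _; rewrite scale0r; apply: gsub0.
move=> /dhomogP hp Ax; rewrite [p]mpolyE scaler_suml big_seq.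
elim/big_ind: _ => [||u up]; [exact: gsub0|by move=> *; exact: gsubD|].
rewrite -mul_mpolyC -scalerA; apply: gsubC.
by rewrite -(hp u up); apply: gsub_mnm.
Qed.

Lemma gsub_sg j t (i : 'I_t) (C : {set 'I_t}) x : A j x -> A j (sg i C *: x).
Proof.
rewrite /sg -signr_odd; case: odd => Ax; rewrite ?expr0 ?expr1 ?scale1r //.
by rewrite scaleN1r; apply: gsubN.
Qed.

Lemma gsubX j i a x : A j x -> A (j + a%:Z) ('X_i ^+ a *: x).
Proof. by apply: gsub_hom; apply: homX. Qed.

Lemma hom_var_prod (C : {set 'I_n}) l : homog_int (l * #|C|)%N%:Z (var_prod k C ^+ l).
Proof.
rewrite hom_natP mulnC; apply: dhomogMn; rewrite /var_prod mprodXE dhomogX.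
by rewrite /= mdeg_sum (eq_bigr (fun=> 1%N)) ?sum1_card // => i _; rewrite mdeg1.
Qed.

Lemma coch0 p e : coch A p e 0.
Proof. by move=> B; rewrite ffunE; case: ifP => // _; apply: gsub0. Qed.

Lemma cochD p e m b : coch A p e m -> coch A p e b -> coch A p e (m + b).
Proof.
move=> Hm Hb B; move: (Hm B) (Hb B); rewrite ffunE.
by case: ifP => _; [apply: gsubD|move=> -> ->; rewrite addr0].
Qed.

Lemma cochN p e m : coch A p e m -> coch A p e (- m).
Proof.
move=> Hm B; move: (Hm B); rewrite ffunE.
by case: ifP => _; [apply: gsubN|move=> ->; rewrite oppr0].
Qed.

Lemma cochB p e m b : coch A p e m -> coch A p e b -> coch A p e (m - b).
Proof. by move=> Hm /cochN; apply: cochD. Qed.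

Lemma coch_hom p e j c m : homog_int j c -> coch A p e m -> coch A p (e + j) (c *: m).
Proof.
move=> hc Hm B; move: (Hm B); rewrite ffunE.
by case: ifP => _; [apply: gsub_hom|move=> ->; rewrite scaler0].
Qed.

Lemma coch_sum p e (I : finType) (P : pred I) (F : I -> cochain) :
  (forall i, P i -> coch A p e (F i)) -> coch A p e (\sum_(i | P i) F i).
Proof. by move=> H; elim/big_ind: _ => //; [apply: coch0|apply: cochD]. Qed.

Lemma coch_cdiff p e a m : coch A p e m -> coch A (p + 1) (e + a%:Z) (cdiff a m).
Proof.
move=> Hm B; rewrite ffunE; case: ifP => cB.
  apply: gsub_sum => i iB; rewrite -scalerA; apply/gsub_sg/gsubX.
  move: (Hm (B :\ i)); rewrite (_ : _ == p) //.
  by move: cB; rewrite (cardsD1 i B) iB; lia.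
apply: big1 => i iB; move: (Hm (B :\ i)); rewrite (_ : (_ == p) = false).
  by move=> ->; rewrite scaler0.
by move: cB; rewrite (cardsD1 i B) iB; lia.
Qed.

Lemma coch_craise p e l m :
  coch A p e m -> coch A p (e + l%:Z * p) (craise l m).
Proof.
move=> Hm B; move: (Hm B); rewrite ffunE; case: ifP => [/eqP <-|_ ->].
  by rewrite -PoszM; apply: gsub_hom; apply: hom_var_prod.
by rewrite scaler0.
Qed.

End Closure.

Lemma coch_mono A B p e m : (forall x, A e x -> B e x) -> coch A p e m -> coch B p e m.
Proof. by move=> AB Hm C; move: (Hm C); case: ifP => // _; apply: AB. Qed.

Lemma coch_eq A p e p' e' m : coch A p e m -> p = p' -> e = e' -> coch A p' e' m.
Proof. by move=> H <- <-. Qed.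

Lemma coch_zero p e m : coch (fun _ x => x = 0) p e m -> m = 0.
Proof. by move=> H; apply/ffunP => B; move: (H B); rewrite ffunE; case: ifP. Qed.

Lemma coch_out A p e m : (p < 0) || (n%:Z < p) -> coch A p e m -> m = 0.
Proof.
move=> hp H; apply/ffunP => B; move: (H B); rewrite ffunE ifF //.
have : (#|B| <= n)%N by rewrite -[X in (_ <= X)%N]card_ord max_card.
by move=> le; apply/eqP => Bp; move: hp; rewrite -Bp; lia.
Qed.

(* H^p(A)_j = 0: Cech cohomology is the colimit over a of the cohomology of
   the Koszul complexes of x_1^a, ..., x_n^a, a cochain m of level a standing
   for the family m_B / x_B^a. *)
Definition cohom0 A (p j : int) : Prop :=
  forall a m, coch A p (j + a%:Z * p) m -> cdiff a m = 0 ->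
  exists l b, coch A (p - 1) (j + (a + l)%N%:Z * (p - 1)) b /\
              craise l m = cdiff (a + l) b.

(** H^p(A/B)_j = 0 without the quotient: cocycles and coboundaries are taken modulo B. *)
Definition cohom0_quot A B (p j : int) : Prop :=
  forall a m, coch A p (j + a%:Z * p) m ->
  coch B (p + 1) (j + a%:Z * (p + 1)) (cdiff a m) ->
  exists l b, coch A (p - 1) (j + (a + l)%N%:Z * (p - 1)) b /\
              coch B p (j + (a + l)%N%:Z * p) (craise l m - cdiff (a + l) b).

Definition regular_at A (r : int) : Prop :=
  forall p j : int, p + j > r -> cohom0 A p j.

Lemma cohom0_out A p j : gsub A -> (p < 0) || (n%:Z < p) -> cohom0 A p j.
Proof.
move=> gA hp a m /(coch_out hp) -> _; exists 0%N, 0; split; first exact: coch0.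
by rewrite craise0 cdiff0.
Qed.

(** Exactness of H^p(B) -> H^p(A) -> H^p(A/B) in the middle. *)
Lemma cohom0_ext A B p j : gsub A -> gsub B -> (forall e x, B e x -> A e x) ->
  cohom0_quot A B p j -> cohom0 B p j -> cohom0 A p j.
Proof.
move=> gA gB BA HQ HB a m Hm dm.
have [] := HQ a m Hm; first by rewrite dm; apply: coch0.
move=> l [b [Hb Hm1]].
have [] := HB _ _ Hm1.
  by rewrite cdiffB cdiff_craise dm craise0 cdiff_cdiff subr0.
move=> l' [b' [Hb' E']]; exists (l + l')%N, (craise l' b + b'); split.
  apply: cochD => //.
    by apply: (coch_eq (coch_craise gA l' Hb)) => //; lia.
  by apply: (coch_mono (BA _)); apply: (coch_eq Hb') => //; lia.
rewrite addnA cdiffD -E' cdiff_craise craiseB craise_craise.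
by rewrite addrC subrK.
Qed.

End GradedSubmodules.

(** * Long exact sequences, products and retracts *)

Section Maps.
Variables (k : fieldType) (n : nat).
Notation S := {mpoly k[n]}.
Variables (E F : lmodType S) (phi : E -> F).
Hypothesis lin : linear phi.
Implicit Types (A : int -> E -> Prop) (B : int -> F -> Prop).

Let phiD : {morph phi : x y / x + y}.
Proof. by move=> x y; rewrite -[x]scale1r lin !scale1r. Qed.

Let phi0 : phi 0 = 0.
Proof. by apply: (addrI (phi 0)); rewrite -phiD !addr0. Qed.

Let phiZ c x : phi (c *: x) = c *: phi x.
Proof. by rewrite -[c *: x]addr0 lin phi0 addr0. Qed.

Definition cmap (m : {ffun {set 'I_n} -> E}) : {ffun {set 'I_n} -> F} :=
  [ffun C : {set 'I_n} => phi (m C)].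

Lemma cmap0 : cmap 0 = 0.
Proof. by apply/ffunP => C; rewrite !ffunE phi0. Qed.

Lemma cmap_cdiff a m : cmap (cdiff a m) = cdiff a (cmap m).
Proof.
apply/ffunP => C; rewrite !ffunE (big_morph phi phiD phi0).
by apply: eq_bigr => i _; rewrite phiZ ffunE.
Qed.

Lemma cmap_craise l m : cmap (craise l m) = craise l (cmap m).
Proof. by apply/ffunP => C; rewrite !ffunE phiZ. Qed.

Lemma cmapB m b : cmap (m - b) = cmap m - cmap b.
Proof.
by apply/ffunP => C; rewrite !ffunE phiD -scaleN1r phiZ scaleN1r.
Qed.

Lemma coch_cmap A B p e m : (forall x, A e x -> B e (phi x)) ->
  coch A p e m -> coch B p e (cmap m).
Proof.
by move=> AB Hm C; move: (Hm C); rewrite ffunE; case: ifP => [_ /AB|_ ->].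
Qed.

Lemma coch_lift A B p e b : (forall y, B e y -> exists x, A e x /\ phi x = y) ->
  coch B p e b -> exists m, coch A p e m /\ cmap m = b.
Proof.
move=> BA Hb.
have : forall C, exists x,
    (if #|C : {set 'I_n}|%:Z == p then A e x else x = 0) /\ phi x = b C.
  move=> C; move: (Hb C); case: ifP => [_ /BA //|_ ->].
  by exists 0; rewrite phi0.
move/choice => [m Hm]; exists [ffun C => m C].
split=> [C|]; first by rewrite ffunE; case: (Hm C).
by apply/ffunP => C; rewrite !ffunE; case: (Hm C).
Qed.

Definition gker A (e : int) (x : E) : Prop := A e x /\ phi x = 0.

Lemma gsub_gker A : gsub A -> gsub (gker A).
Proof.
move=> gA; split.
- by move=> j; split; [apply: gsub0|].
- by move=> j x y [Ax x0] [Ay y0]; split; [apply: gsubD|rewrite phiD x0 y0 addr0].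
- by move=> j c x [Ax x0]; split; [apply: gsubC|rewrite phiZ x0 scaler0].
- move=> j i x [Ax x0]; split; last by rewrite phiZ x0 scaler0.
  by case: gA => _ _ _; apply.
Qed.

Lemma coch_gker A p e m : coch A p e m -> cmap m = 0 -> coch (gker A) p e m.
Proof.
move=> Hm /ffunP m0 C; move: (Hm C) (m0 C).
by rewrite !ffunE; case: ifP.
Qed.

Lemma cmap_gker A p e m : coch (gker A) p e m -> cmap m = 0.
Proof.
move=> Hm; apply/ffunP => C; move: (Hm C).
by rewrite !ffunE; case: ifP => [_ []|_ ->].
Qed.

(** Exactness of H^{p-1}(B) -> H^p(ker) -> H^p(A): a primitive b of m in A maps to a cocycle of B,
    and lifting a primitive of that cocycle corrects b into the kernel. *)
Lemma cohom0_ker A B p j : gsub A ->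
  (forall e x, A e x -> B e (phi x)) ->
  (forall e y, B e y -> exists x, A e x /\ phi x = y) ->
  cohom0 A p j -> cohom0 B (p - 1) j -> cohom0 (gker A) p j.
Proof.
move=> gA AB BA HA HB a m Hm dm.
have HmA : coch A p (j + a%:Z * p) m by apply: coch_mono Hm => x [].
have [l [b [Hb Eb]]] := HA a m HmA dm.
have db0 : cdiff (a + l) (cmap b) = 0.
  by rewrite -cmap_cdiff -Eb cmap_craise (cmap_gker Hm) craise0.
have [l' [b1 [Hb1 E1]]] := HB _ _ (coch_cmap (AB _) Hb) db0.
have [c [Hc Ec]] := coch_lift (BA _) Hb1.
exists (l + l')%N, (craise l' b - cdiff (a + l + l') c); split.
  apply: coch_gker.
    apply: cochB => //.
      by apply: (coch_eq (coch_craise gA l' Hb)) => //; lia.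
    by apply: (coch_eq (coch_cdiff gA (a + l + l') Hc)) => //; lia.
  by rewrite cmapB cmap_craise cmap_cdiff E1 Ec subrr.
by rewrite addnA cdiffB cdiff_cdiff subr0 cdiff_craise -Eb craise_craise.
Qed.

(** Exactness of H^p(A) -> H^p(B) -> H^{p+1}(ker); the coboundary of a lift of the cocycle is the
    connecting class. *)
Lemma cohom0_im A B p j : gsub A ->
  (forall e x, A e x -> B e (phi x)) ->
  (forall e y, B e y -> exists x, A e x /\ phi x = y) ->
  cohom0 A p j -> cohom0 (gker A) (p + 1) j -> cohom0 B p j.
Proof.
move=> gA AB BA HA HK a m' Hm' dm'.
have [m [Hm Em]] := coch_lift (BA _) Hm'.
have [] := HK a (cdiff a m).
- apply: coch_gker; last by rewrite cmap_cdiff Em.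
  by apply: (coch_eq (coch_cdiff gA a Hm)) => //; lia.
- exact: cdiff_cdiff.
move=> l [b [Hb Eb]].
have [] := HA (a + l)%N (craise l m - b).
- apply: cochB => //; first by apply: (coch_eq (coch_craise gA l Hm)) => //; lia.
  by apply: (@coch_mono _ _ _ _ A) (coch_eq Hb _ _) => [x []||] //; lia.
- by rewrite cdiffB cdiff_craise Eb subrr.
move=> l' [c [Hc Ec]]; exists (l + l')%N, (cmap c); split.
  by rewrite addnA; apply: coch_cmap Hc => x; apply: AB.
rewrite addnA -cmap_cdiff -Ec cmap_craise cmapB (cmap_gker Hb) subr0.
by rewrite cmap_craise Em craise_craise.
Qed.

Lemma cmap_inj : injective phi -> injective cmap.
Proof.
move=> inj m b /ffunP E12; apply/ffunP => C.
by apply: inj; move: (E12 C); rewrite !ffunE.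
Qed.

Lemma cohom0_inj A B p j : injective phi ->
  (forall e x, A e x -> B e (phi x)) ->
  (forall e y, B e y -> exists x, A e x /\ phi x = y) ->
  cohom0 A p j <-> cohom0 B p j.
Proof.
move=> inj AB BA; have cinj := cmap_inj inj; split=> H a m Hm dm.
  have [m1 [Hm1 Em1]] := coch_lift (BA _) Hm.
  have [|l [b [Hb Eb]]] := H a m1 Hm1.
    by apply: cinj; rewrite cmap_cdiff Em1 cmap0.
  exists l, (cmap b); split; first by apply: coch_cmap Hb => x; apply: AB.
  by rewrite -cmap_cdiff -Eb cmap_craise Em1.
have [||l [b [Hb Eb]]] := H a (cmap m).
- by apply: coch_cmap Hm => x; apply: AB.
- by rewrite -cmap_cdiff dm cmap0.
have [b1 [Hb1 Eb1]] := coch_lift (BA _) Hb.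
exists l, b1; split=> //.
by apply: cinj; rewrite cmap_craise cmap_cdiff Eb1.
Qed.

End Maps.

Section Products.
Variables (k : fieldType) (n : nat).
Notation S := {mpoly k[n]}.

Lemma cohom0_retract (E F : lmodType S) (phi : E -> F) (psi : F -> E)
    (A : int -> E -> Prop) (B : int -> F -> Prop) p j :
  linear phi -> linear psi ->
  (forall e x, A e x -> B e (phi x)) -> (forall e y, B e y -> A e (psi y)) ->
  (forall e x, A e x -> psi (phi x) = x) ->
  cohom0 B p j -> cohom0 A p j.
Proof.
move=> lphi lpsi AB BA phiK H a m Hm dm.
have mK : cmap psi (cmap phi m) = m.
  apply/ffunP => C; move: (Hm C); rewrite !ffunE.
  case: ifP => [_ /phiK //|_ ->]; have := cmap0 lphi; have := cmap0 lpsi.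
  by move=> /ffunP/(_ C) + /ffunP/(_ C); rewrite !ffunE => + ->.
have [||l [b [Hb Eb]]] := H a (cmap phi m).
- by apply: (coch_cmap lphi _ Hm) => x; apply: AB.
- by rewrite -cmap_cdiff // dm cmap0.
exists l, (cmap psi b); split; first by apply: (coch_cmap lpsi _ Hb) => x; apply: BA.
by rewrite -cmap_cdiff // -Eb cmap_craise // mK.
Qed.

Variable E : lmodType S.

(** A finite family of cocycles admits one common level: the largest exponent needed, to which all
    primitives are raised. *)
Lemma cohom0_fam (T : finType) (A : T -> int -> E -> Prop) (j : T -> int) (p : int) :
  (forall t, gsub (A t)) -> (forall t, cohom0 (A t) p (j t)) ->
  forall a (m : T -> {ffun {set 'I_n} -> E}),
  (forall t, coch (A t) p (j t + a%:Z * p) (m t)) ->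
  (forall t, cdiff a (m t) = 0) ->
  exists l (b : T -> {ffun {set 'I_n} -> E}), forall t,
    coch (A t) (p - 1) (j t + (a + l)%N%:Z * (p - 1)) (b t) /\
    craise l (m t) = cdiff (a + l) (b t).
Proof.
move=> gA HA a m Hm dm.
have /choice[l /choice[b Hb]] := fun t => HA t a (m t) (Hm t) (dm t).
pose L := \max_t l t; exists L, (fun t => craise (L - l t) (b t)) => t.
have lL : (l t <= L)%N by apply: leq_bigmax.
case: (Hb t) => Hbt Ebt; split.
  apply: (coch_eq (coch_craise (gA t) (L - l t) Hbt)) => //.
  by rewrite -{2}(subnKC lL); lia.
by rewrite -{2}(subnKC lL) addnA cdiff_craise -Ebt craise_craise subnKC.
Qed.

Definition gprod (T : finType) (A : T -> int -> E -> Prop) (e : T -> int)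
    (j : int) (x : {ffun T -> E}) : Prop :=
  forall t, A t (j - e t) (x t).

Lemma gsub_gprod (T : finType) (A : T -> int -> E -> Prop) (e : T -> int) :
  (forall t, gsub (A t)) -> gsub (gprod A e).
Proof.
move=> gA; split.
- by move=> j t; rewrite ffunE; apply: gsub0 (gA t) _.
- by move=> j x y Ax Ay t; rewrite ffunE; apply: gsubD (gA t) _ _ _ (Ax t) (Ay t).
- by move=> j c x Ax t; rewrite ffunE; apply: gsubC (gA t) _ _ _ (Ax t).
- move=> j i x Ax t; rewrite ffunE addrAC.
  by case: (gA t) => _ _ _; apply; apply: Ax.
Qed.

Lemma cohom0_prod (T : finType) (A : T -> int -> E -> Prop) (e : T -> int) p j :
  (forall t, gsub (A t)) -> (forall t, cohom0 (A t) p (j - e t)) ->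
  cohom0 (gprod A e) p j.
Proof.
move=> gA HA a m Hm dm.
pose m' t : {ffun {set 'I_n} -> E} := [ffun C => m C t].
have [||l [b Hb]] := cohom0_fam gA HA (a := a) (m := m').
- move=> t C; move: (Hm C); rewrite ffunE; case: ifP => [_ /(_ t)|_ ->].
    by rewrite addrAC.
  by rewrite ffunE.
- move=> t; apply/ffunP => C; move/ffunP/(_ C)/ffunP/(_ t): dm.
  rewrite !ffunE sum_ffunE => {2}<-; apply: eq_bigr => i _.
  by rewrite !ffunE.
exists l, [ffun C => [ffun t => b t C]]; split.
  move=> C; rewrite ffunE; case: ifP => cC.
    move=> t; rewrite ffunE addrAC; have [/(_ C)] := Hb t.
    by rewrite cC.
  apply/ffunP => t; rewrite !ffunE; have [/(_ C)] := Hb t.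
  by rewrite cC.
apply/ffunP => C; apply/ffunP => t; have [_ /ffunP/(_ C)] := Hb t.
rewrite !ffunE sum_ffunE => ->; apply: eq_bigr => i _.
by rewrite !ffunE.
Qed.

End Products.

(** * Free modules *)

Section Contraction.
Variables (k : fieldType) (n : nat).
Notation S := {mpoly k[n]}.
Variables (E : lmodType S) (i : 'I_n) (a : nat) (tau : E -> E).
Hypothesis tauD : {morph tau : x y / x + y}.
Hypothesis tauX : forall l x, l != i -> tau ('X_l ^+ a *: x) = 'X_l ^+ a *: tau x.
Notation cochain := {ffun {set 'I_n} -> E}.

Definition ccontract (m : cochain) : cochain := [ffun B : {set 'I_n} =>
  if i \in B then 0 else sg i B *: tau (m (i |: B))].

Let tau0 : tau 0 = 0.
Proof. by apply: (addrI (tau 0)); rewrite -tauD !addr0. Qed.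

Let tau_sg l (C : {set 'I_n}) x : tau (sg l C *: x) = sg l C *: tau x.
Proof.
rewrite /sg -signr_odd; case: odd; rewrite ?expr0 ?scale1r // expr1 !scaleN1r.
by apply: (addrI (tau x)); rewrite -tauD !subrr tau0.
Qed.

(** Two uses. With [tau] the identity, multiplication by x_i^a is null-homotopic. With [tau] the
    division by x_i^a, the homotopy is the identity on components avoiding i and leaves a remainder
    modulo x_i^a on the others; division does not commute with x_i, hence the restriction to l !=
    i. *)
Lemma ccontract_homotopy m C :
  (cdiff a (ccontract m) + ccontract (cdiff a m)) C =
  if i \in C then 'X_i ^+ a *: tau (m C) else tau ('X_i ^+ a *: m C).
Proof.
rewrite !ffunE; case: ifP => iC.
  rewrite (bigD1 i) //= big1 ?addr0 => [|l /andP[lC li]]; last first.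
    by rewrite ffunE !inE eq_sym li iC scaler0.
  rewrite ffunE !inE eqxx /= setD1K // sgD1x scalerA mulrAC sgM mul1r.
  by [].
rewrite big_setU1 ?iC //= setU1K ?iC // tauD scalerDr -!scalerA tau_sg.
rewrite sgU1x scalerA sgM scale1r addrC -addrA -[RHS]addr0; congr (_ + _).
rewrite (big_morph tau tauD tau0) scaler_sumr -big_split big1 //= => l lC.
have li : l != i by apply: contraTneq lC => ->; rewrite iC.
rewrite ffunE !inE iC andbF -scalerA tau_sg tauX // ![_ *: (_ *: _)]scalerA -?scalerDl.
have -> : (i |: C) :\ l = i |: (C :\ l).
  by apply/setP => x; rewrite !inE; case: (eqVneq x i) => // ->; rewrite eq_sym li.
rewrite -scalerDl [X in X *: _](_ : _ = 0) ?scale0r //.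
rewrite [X in _ + X](_ : _ = (sg i (C :\ l) * sg l C) * 'X_l ^+ a); last by ring.
by rewrite sgUD // ?iC //; ring.
Qed.

End Contraction.

Section Division.
Variables (k : fieldType) (n : nat).
Notation S := {mpoly k[n]}.
Implicit Types (p q : S) (u : 'X_{1..n}).

(** The quotient in the division by x_i^a; the bound [msize p] only makes the sum finite. *)
Definition mquo (i : 'I_n) a p : S :=
  \sum_(u : 'X_{1..n < msize p}) p@_(u + U_(i) *+ a)%MM *: 'X_[u].

Lemma mcoeff_mquo i a p u : (mquo i a p)@_u = p@_(u + U_(i) *+ a)%MM.
Proof.
have [lt|le] := ltnP (mdeg u) (msize p).
  by rewrite (mcoeff_mpoly (fun v => p@_(v + U_(i) *+ a)%MM)).
rewrite [RHS]memN_msupp_eq0; last first.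
  by apply: msize_mdeg_ge; rewrite mdegD (leq_trans le) ?leq_addr.
rewrite raddf_sum big1 //= => v _; rewrite mcoeffZ mcoeffX.
case: eqP => [E|]; last by rewrite mulr0.
by have := bmdeg v; rewrite E ltnNge le.
Qed.

Lemma mcoeffXnM i a p u : ('X_i ^+ a * p)@_u =
  if (a <= u i)%N then p@_(u - U_(i) *+ a)%MM else 0.
Proof.
have aE : ((U_(i) *+ a)%MM <= u)%MM = (a <= u i)%N.
  apply/mnm_lepP/idP => [/(_ i)|le j]; first by rewrite mulmnE mnm1E eqxx mul1n.
  by rewrite mulmnE mnm1E; case: eqP => [<-|]; rewrite ?mul1n ?mul0n.
rewrite mpolyXn -commr_mpolyX; case: ifP => le.
  by rewrite -{1}(submK (m:=(U_(i) *+ a)%MM) (m':=u)) ?aE // addmC mcoeffMX.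
apply/eqP; rewrite mcoeff_eq0 (perm_mem (msuppMX _ _)); apply/mapP => -[v _ E].
by move: le; rewrite -aE E lem_addr.
Qed.

Lemma mquoD i a : {morph mquo i a : p q / p + q}.
Proof. by move=> p q; apply/mpolyP => u; rewrite mcoeffD !mcoeff_mquo mcoeffD. Qed.

Lemma mquoK i a p : mquo i a ('X_i ^+ a * p) = p.
Proof.
apply/mpolyP => u; rewrite mcoeff_mquo mcoeffXnM mnmDE mulmnE mnm1E eqxx mul1n.
by rewrite leq_addl addmK.
Qed.

Lemma mquoX i a l b p : l != i ->
  mquo i a ('X_l ^+ b * p) = 'X_l ^+ b * mquo i a p.
Proof.
move=> li; apply/mpolyP => u; rewrite mcoeff_mquo !mcoeffXnM mcoeff_mquo.
rewrite mnmDE mulmnE mnm1E eq_sym (negPf li) mul0n addn0; case: ifP => // le.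
congr (_ @_ _); apply/mnmP => j; rewrite !(mnmDE, mnmBE, mulmnE, mnm1E).
by case: (eqVneq l j) => [lj|]; case: (eqVneq i j) => [ij|] /=; subst; 
  rewrite ?eqxx ?mul0n ?mul1n // in li *; lia.
Qed.

Lemma mcoeff_mrem i a p u :
  (p - 'X_i ^+ a * mquo i a p)@_u = if (a <= u i)%N then 0 else p@_u.
Proof.
rewrite mcoeffB mcoeffXnM; case: ifP => le; last by rewrite subr0.
rewrite mcoeff_mquo submK ?subrr //; apply/mnm_lepP => j.
by rewrite mulmnE mnm1E; case: eqP => [<-|]; rewrite ?mul1n ?mul0n.
Qed.

Lemma hom_coeff j p :
  homog_int j p <-> forall u, p@_u != 0 -> (mdeg u)%:Z = j.
Proof.
case: j => e; split.
- by move=> /dhomogP H u; rewrite -mcoeff_msupp => /H <-.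
- by move=> H; apply/dhomogP => u; rewrite mcoeff_msupp => /H [].
- by move=> /eqP -> u; rewrite mcoeff0 eqxx.
- move=> H; apply/eqP/mpolyP => u; rewrite mcoeff0.
  by apply/eqP; apply: contraT => /H.
Qed.

Lemma hom_mquo i a j p : homog_int j p -> homog_int (j - a%:Z) (mquo i a p).
Proof.
move=> /hom_coeff H; apply/hom_coeff => u; rewrite mcoeff_mquo => /H.
by rewrite mdegD mdegMn mdeg1; lia.
Qed.

End Division.

Lemma coch_ccontract (k : fieldType) n (E : lmodType {mpoly k[n]})
    (A : int -> E -> Prop) i tau (p e s : int) (m : {ffun {set 'I_n} -> E}) :
  gsub A -> (forall x, A e x -> A (e + s) (tau x)) -> tau 0 = 0 ->
  coch A p e m -> coch A (p - 1) (e + s) (ccontract i tau m).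
Proof.
move=> gA At tau0 Hm B; rewrite ffunE; move: (Hm (i |: B)).
case: (boolP (i \in B)) => iB; first by move=> _; case: ifP => // _; apply: gsub0.
rewrite cardsU1 iB add1n (_ : (_.+1%:Z == p) = (#|B|%:Z == p - 1)); last by lia.
by case: ifP => _; [move/At; apply: gsub_sg|move=> ->; rewrite tau0 scaler0].
Qed.

Section FreeModules.
Variables (k : fieldType) (n : nat).
Notation S := {mpoly k[n]}.

Definition hom_part (j : int) (p : S^o) : Prop := homog_int j (p : S).

Lemma gsub_hom_part : gsub hom_part.
Proof.
rewrite /hom_part; split=> [j|j x y|j c x|j i x].
- exact: hom0.
- exact: homD.
- by move=> hx; rewrite -[j]add0r; apply: homM => //; apply: homC.
- by move=> hx; rewrite addrC; apply: homM => //; apply: (@homX k n i 1).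
Qed.

(** One variable at a time, the coboundary of the contraction by division is subtracted. Each
    component becomes zero or its own remainder modulo x_i^a, so what was achieved for earlier
    variables persists. *)
Lemma cocycle_reduce (T : seq 'I_n) a p j (m : {ffun {set 'I_n} -> S^o}) :
  coch hom_part p (j + a%:Z * p) m -> cdiff a m = 0 ->
  exists (m' b : {ffun {set 'I_n} -> S^o}),
   [/\ coch hom_part p (j + a%:Z * p) m' /\ cdiff a m' = 0,
       coch hom_part (p - 1) (j + a%:Z * (p - 1)) b, m = m' + cdiff a b &
       forall (C : {set 'I_n}) i, i \in T ->
         (i \notin C -> m' C = 0) /\ forall u : 'X_{1..n}, (a <= u i)%N -> (m' C : S)@_u = 0].
Proof.
have g := gsub_hom_part.
elim: T => [|i T IH] Hm dm.
  by exists m, 0; split; rewrite ?cdiff0 ?addr0 //; apply: coch0.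
have [m' [b [[Hm' dm'] Hb Em H]]] := IH Hm dm.
have mquo0 : mquo i a (0 : S) = 0.
  by apply: (addrI (mquo i a 0)); rewrite -mquoD !addr0.
pose tau : S^o -> S^o := mquo i a; have tau0 : tau 0 = 0 := mquo0.
pose h : {ffun {set 'I_n} -> S^o} := ccontract i tau m'.
have Hh : coch hom_part (p - 1) (j + a%:Z * (p - 1)) h.
  apply: (@coch_eq _ _ _ _ (p - 1) (j + a%:Z * p + - a%:Z)) => //; last by lia.
  by apply: coch_ccontract Hm' => // x; apply: hom_mquo.
have hE C : (m' - cdiff a h) C =
    if i \in C then (m' C : S) - 'X_i ^+ a * mquo i a (m' C) else 0.
  have := @ccontract_homotopy _ _ S^o i a tau (@mquoD _ _ i a) _ m' C.
  rewrite dm' => /(_ (fun l x li => mquoX _ _ _ li)).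
  rewrite [in ccontract _ _ 0]/ccontract [in LHS]ffunE [X in _ + X]ffunE.
  have -> : (if i \in C then 0 else
     sg i C *: tau ((0 : {ffun {set 'I_n} -> S^o}) (i |: C))) = 0.
    by case: ifP => // _; rewrite ffunE tau0 scaler0.
  rewrite addr0 !ffunE => ->; case: ifP => // _.
  by rewrite /tau [mquo _ _ _]mquoK subrr.
exists (m' - cdiff a h), (b + h); split.
- split; last by rewrite cdiffB cdiff_cdiff subr0.
  apply: cochB => //; apply: (coch_eq (coch_cdiff g a Hh)) => //; lia.
- exact: cochD.
- by rewrite cdiffD Em [in RHS](addrC (cdiff a b)) addrA subrK.
- move=> C l; rewrite inE hE => /orP[/eqP ->|lT].
    split; first by move=> /negPf ->.
    by move=> u; case: ifP => _ au; rewrite ?mcoeff0 // mcoeff_mrem au.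
  have [H1 H2] := H C l lT; split.
    by move=> /H1 ->; rewrite mquo0 mulr0 subr0; case: ifP.
  move=> u au; case: ifP => _; rewrite ?mcoeff0 // mcoeff_mrem H2 //.
  by case: ifP.
Qed.

(** After reduction in all variables only the component of the full set survives, and its monomials
    have exponents below a, hence degree at most n a - n, while its degree is j + n a. No raising of
    the level is needed. *)
Lemma cohom0_hom_part (p j : int) :
  p != n%:Z \/ 0 < n%:Z + j -> cohom0 hom_part p j.
Proof.
move=> pj a m Hm dm; exists 0%N.
have [m' [b [[Hm' dm'] Hb -> H]]] := cocycle_reduce (enum 'I_n) Hm dm.
exists b; rewrite addn0; split=> //.
suff -> : m' = 0 by apply/ffunP => C; rewrite add0r !ffunE scale1r.
apply/ffunP => C; rewrite ffunE.
have [CT|] := eqVneq C [set: 'I_n]; last first.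
  rewrite -subTset => /subsetPn [i _ iC].
  by have [->] := H C i (mem_enum _ i).
move: (Hm' C); case: eqP => [pE hC|//].
have pn : p = n%:Z by rewrite -pE CT cardsT card_ord.
have {}pj : 0 < n%:Z + j by case: pj => //; rewrite pn eqxx.
apply/mpolyP => u; rewrite mcoeff0; apply/eqP; apply: contraT => nz.
have ua i : (u i < a)%N.
  rewrite ltnNge; apply: contra nz => au.
  by have [_ ->] := H C i (mem_enum _ i).
have := proj1 (hom_coeff _ _) hC u nz; rewrite mdegE pn.
suff : (\sum_i u i + n <= a * n)%N by lia.
rewrite -[n in (_ + n)%N]card_ord -sum1_card -big_split /=.
rewrite -[n in (_ * n)%N]card_ord mulnC -sum_nat_const.
by apply: leq_sum => i _; rewrite addn1.
Qed.

Definition free_part (T : finType) (e : T -> int) := gprod (fun _ : T => hom_part) e.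

Lemma gsub_free_part (T : finType) (e : T -> int) : gsub (free_part e).
Proof. by apply: gsub_gprod => _; apply: gsub_hom_part. Qed.

Lemma regular_free (T : finType) (e : T -> int) r :
  (forall t, e t <= r) -> regular_at (free_part e) r.
Proof.
move=> er p j pj; apply: cohom0_prod => t; first exact: gsub_hom_part.
apply: cohom0_hom_part; have [pn|pn] := eqVneq p n%:Z; [right|by left].
by have := er t; lia.
Qed.

Lemma cohom0_free (T : finType) (e : T -> int) (p j : int) :
  p != n%:Z -> cohom0 (free_part e) p j.
Proof.
move=> pn; apply: cohom0_prod => t; first exact: gsub_hom_part.
by apply: cohom0_hom_part; left.
Qed.

End FreeModules.

(** * Generators of modules of bounded regularity *)

Section KoszulModule.
Variables (R : comNzRingType) (r : nat) (f : 'I_r -> R).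

Definition kos (E : lmodType R) (c : {ffun {set 'I_r} -> E}) : {ffun {set 'I_r} -> E} :=
  [ffun B : {set 'I_r} => \sum_(i | i \notin B) (sg i B * f i) *: c (i |: B)].

Definition wedge (E : lmodType R) (i : 'I_r) (c : {ffun {set 'I_r} -> E}) :
    {ffun {set 'I_r} -> E} :=
  [ffun A : {set 'I_r} => if i \in A then sg i A *: c (A :\ i) else 0].

Variable E : lmodType R.
Implicit Types (c : {ffun {set 'I_r} -> E}) (A B : {set 'I_r}).

Lemma kos_linear : linear (@kos E).
Proof.
move=> a c c'; apply/ffunP => B; rewrite !ffunE scaler_sumr -big_split.
by apply: eq_bigr => i _; rewrite !ffunE scalerDr !scalerA [_ * a]mulrC.
Qed.

Lemma wedge_linear i : linear (@wedge E i).
Proof.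
move=> a c c'; apply/ffunP => B; rewrite !ffunE; case: ifP => _.
  by rewrite ?ffunE scalerDr !scalerA [_ * a]mulrC.
by rewrite scaler0 addr0.
Qed.

Lemma kosB c c' : kos (c - c') = kos c - kos c'.
Proof. by rewrite addrC -scaleN1r kos_linear scaleN1r addrC. Qed.

Lemma kos0 : kos (0 : {ffun {set 'I_r} -> E}) = 0.
Proof. by have := kosB 0 0; rewrite !subrr. Qed.

Lemma kos_kos c : kos (kos c) = 0.
Proof.
apply/ffunP => B; rewrite !ffunE.
transitivity (\sum_(i | i \notin B) \sum_(l | (l \notin B) && (l != i))
   (sg i B * sg l (i |: B) * f i * f l) *: c (l |: (i |: B))).
  apply: eq_bigr => i iB; rewrite ffunE scaler_sumr.
  apply: eq_big => [l|l _]; first by rewrite !inE negb_or andbC.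
  by rewrite scalerA; congr (_ *: _); ring.
apply: (@big_antisym _ _ (fun i => i \notin B)) => i l iB lB il.
rewrite setUA [l |: [set i]]setUC -setUA -scaleNr; congr (_ *: _).
rewrite -2!mulNr mulrAC; congr (_ * _ * _).
have lD : l \notin i |: B by rewrite !inE negb_or eq_sym il.
have iD : i \notin l |: B by rewrite !inE negb_or il.
have DE : (l |: (i |: B)) :\ i = l |: B by rewrite setUCA setU1K.
have := @sgDD R r l i (l |: (i |: B)).
rewrite (setU1K lD) DE !inE !eqxx orbT eq_sym il.
move=> /(_ isT isT isT); rewrite sgU1x [l |: (i |: B)]setUCA !sgU1x.
by rewrite sgC => ->; rewrite sgC.
Qed.

(** Contraction with f is an antiderivation. On cycles the formula reads
    [kos f (wedge i c) = f i *: c], which splits the complex wherever [f i] is invertible. *)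
Lemma kos_homotopy i c : kos (wedge i c) + wedge i (kos c) = f i *: c.
Proof.
apply/ffunP => B; rewrite !ffunE; case: ifP => iB.
  rewrite [X in _ + _ *: X](bigD1 i) /= ?inE ?eqxx // scalerDr addrCA setD1K //.
  rewrite sgD1x scalerA mulrA sgM mul1r -[RHS]addr0; congr (_ + _).
  rewrite [X in _ + _ *: X](eq_bigl (fun l => l \notin B)) /=; last first.
    move=> l; rewrite !inE; case: (eqVneq l i) => //= [->|]; last by rewrite andbT.
    by rewrite iB.
  rewrite scaler_sumr -big_split big1 //= => l lB.
  rewrite ?ffunE !inE iB orbT !scalerA.
  have li : i != l by apply: contraNneq lB => <-.
  have -> : (l |: B) :\ i = l |: (B :\ i).
    by apply/setP => x; rewrite !inE; case: (eqVneq x l) => //= ->; rewrite eq_sym li.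
  rewrite -scalerDl [X in X *: _](_ : _ = 0) ?scale0r //.
  rewrite [X in _ + X](_ : _ = (sg l (B :\ i) * sg i B) * f l); last by ring.
  by rewrite sgUD //; ring.
rewrite addr0 (bigD1 i) ?iB //= big1 ?addr0 => [|l /andP[lB li]]; last first.
  by rewrite ?ffunE !inE eq_sym (negPf li) iB scaler0.
rewrite ?ffunE !inE eqxx /= setU1K ?iB // scalerA sgU1x.
by rewrite mulrAC sgM mul1r.
Qed.

Lemma kos_map (F : lmodType R) (g : E -> F) c : linear g ->
  kos [ffun A => g (c A)] = [ffun A => g (kos c A)].
Proof.
move=> lin.
have gD : {morph g : x y / x + y} by move=> x y; rewrite -[x]scale1r lin !scale1r.
have g0 : g 0 = 0 by apply: (addrI (g 0)); rewrite -gD !addr0.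
have gZ a x : g (a *: x) = a *: g x by rewrite -[a *: x]addr0 lin g0 addr0.
apply/ffunP => B; rewrite !ffunE (big_morph g gD g0).
by apply: eq_bigr => i _; rewrite gZ ffunE.
Qed.

End KoszulModule.

Section Castelnuovo.
Variables (k : fieldType) (n : nat).
Notation S := {mpoly k[n]}.
Variables (E : lmodType S) (A : int -> E -> Prop) (r : int).
Hypotheses (gA : gsub A) (regA : regular_at A r).
Variables (e : int) (mu : E).
Hypotheses (re : r < e) (Amu : A e mu).
Notation cochain := {ffun {set 'I_n} -> E}.
Notation x := (fun i : 'I_n => 'X_i : S).

Definition diag_cochain (q : nat) : {ffun {set 'I_n} -> cochain} :=
  [ffun D : {set 'I_n} => [ffun B => if (D == B) && (#|D| == q) then mu else 0]].

(** At level 1 the Cech differential multiplies by x_i, exactly as the Koszul differential of the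
    variables does, and the signs agree because [sg i] ignores i itself. *)
Lemma cdiff_diag_cochain q D :
  cdiff 1 (diag_cochain q D) = kos x (diag_cochain q.+1) D.
Proof.
apply/ffunP => B; rewrite !ffunE sum_ffunE big_mkcond [RHS]big_mkcond /=.
apply: eq_bigr => i _; rewrite !ffunE expr1.
have [DB|nDB] := boolP ((i \in B) && (D == B :\ i)).
  case/andP: DB => iB /eqP ->.
  rewrite iB !inE eqxx /= setD1K // !eqxx sgD1x /=.
  by have := cardsD1 i B; rewrite iB add1n => ->; rewrite eqSS.
have -> : (if i \in B then (sg i B * 'X_i) *:
   (if (D == B :\ i) && (#|D| == q) then mu else 0) else 0) = 0.
  by case: ifP nDB => //= _ /negPf ->; rewrite scaler0.
case: ifP => // iD; case: eqP => [E0|_]; last by rewrite scaler0.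
by move: nDB; rewrite -E0 setU1K ?iD // setU11 eqxx.
Qed.

Lemma coch_diag_cochain q D : coch A q%:Z e (diag_cochain q D).
Proof.
move=> B; rewrite !ffunE eqz_nat; have [->|_] := eqVneq D B => /=.
  by case: ifP => ->.
by case: ifP => // _; apply: gsub0.
Qed.

Lemma diag_cochain0 q (D : {set 'I_n}) : #|D| != q -> diag_cochain q D = 0.
Proof. by move/negPf => Dq; apply/ffunP => B; rewrite !ffunE Dq andbF. Qed.

(* The total complex of (Cech complex of A) (x) K(x): the class of mu is moved
   along the diagonal, where the cochain of level 1 with components mu e_B
   represents sum_B (mu / x_B) e_B, and then brought back by the vanishing
   of the cohomology of A. *)
Lemma castelnuovo_step q : (q <= n)%N -> exists l (c : {ffun {set 'I_n} -> cochain}),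
  (forall D : {set 'I_n}, if #|D| == q.+1
     then coch A q%:Z (e - q.+1%:Z + l.+1%:Z * q%:Z) (c D) else c D = 0) /\
  (forall D, cdiff l.+1 (craise l (diag_cochain q D) - kos x c D) = 0).
Proof.
(* Descending induction on q; at q = n the coboundary would lie in position n + 1, where there are
   no cochains. *)
move=> /subnKC; move: (n - q)%N => d; elim: d q => [|d IH] q qdn.
  exists 0%N, 0; split=> D; first by rewrite ffunE; case: ifP => // _; apply: coch0.
  rewrite kos0 [X in _ - X]ffunE subr0.
  have Hd : coch A q%:Z (e + 0%:Z * q%:Z) (craise 0 (diag_cochain q D)).
    by apply: coch_craise => //; apply: coch_diag_cochain.
  by apply: (coch_out _ (coch_cdiff gA 1 Hd)); lia.
have [|l [c [Hc dc]]] := IH q.+1; first by lia.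
pose th D := craise l (diag_cochain q.+1 D) - kos x c D.
have Hk D : coch A q.+1%:Z (e - q.+1%:Z + l.+1%:Z * q.+1%:Z) (kos x c D).
  rewrite ffunE; apply: coch_sum => // i iD.
  have [cD|cD] := eqVneq #|i |: D| q.+2; last first.
    by move: (Hc (i |: D)); rewrite (negPf cD) => ->; rewrite scaler0; apply: coch0.
  move: (Hc (i |: D)); rewrite cD eqxx => Hi.
  rewrite -scalerA.
  have -> : e - q.+1%:Z + l.+1%:Z * q.+1%:Z = e - q.+2%:Z + l.+1%:Z * q.+1%:Z + 1 + 0.
    by lia.
  apply: coch_hom => //.
    by rewrite /sg -signr_odd; case: odd; rewrite ?expr0 ?expr1 -?mpolyC1 -?mpolyCN; apply: homC.
  by apply: coch_hom => //; apply: (@homX k n i 1).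
have Hth D : coch A q.+1%:Z (e - q.+1%:Z + l.+1%:Z * q.+1%:Z) (th D).
  apply: cochB => //.
  apply: (coch_eq (coch_craise gA l (coch_diag_cochain q.+1 D))) => //; lia.
have th0 (D : {set 'I_n}) : #|D| != q.+1 -> th D = 0.
  move=> Dq; rewrite /th diag_cochain0 // craise0 ffunE big1 ?subr0 // => i iD.
  move: (Hc (i |: D)); rewrite cardsU1 iD add1n eqSS (negPf Dq) => ->.
  by rewrite scaler0.
have [|l' [b Hb]] := @cohom0_fam _ _ _ {set 'I_n} (fun=> A) (fun=> e - q.+1%:Z)
  q.+1%:Z (fun=> gA) _ l.+1 th Hth dc.
  (* Position q + 1 and degree e - (q + 1) add up to e, which exceeds r. *)
  by move=> _; apply: regA; lia.
pose c' : {ffun {set 'I_n} -> cochain} :=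
  [ffun D : {set 'I_n} => if #|D| == q.+1 then b D else 0].
have Ec' D : craise l' (th D) = cdiff (l + l').+1 (c' D).
  rewrite ffunE; have [Dq|Dq] := eqVneq #|D| q.+1; first by have [_ ->] := Hb D.
  by rewrite th0 // craise0 cdiff0.
exists (l + l')%N, c'; split=> D.
  rewrite ffunE; case: ifP => Dq; rewrite Dq //; have [Hbd _] := Hb D.
  by apply: (coch_eq Hbd) => //; lia.
rewrite cdiffB -[(l + l').+1]add1n cdiff_craise cdiff_diag_cochain.
have lin_d a : linear (@cdiff k n E a) by move=> z u v; rewrite cdiffD cdiffZ.
have lin_r a : linear (@craise k n E a).
  by move=> z u v; apply/ffunP => C; rewrite !ffunE scalerDr !scalerA [_ * z]mulrC.
have /ffunP/(_ D) := kos_map x c' (lin_d (1 + (l + l'))%N).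
have -> : [ffun D => cdiff (1 + (l + l')) (c' D)] =
   [ffun D => craise l' ([ffun D => th D] D)] :> {ffun {set 'I_n} -> cochain}.
  by apply/ffunP => C; rewrite [LHS]ffunE [RHS]ffunE [X in craise _ X]ffunE Ec'.
rewrite (kos_map x _ (lin_r l')) [RHS]ffunE [LHS]ffunE => <-.
have -> : [ffun D => th D] = [ffun D => craise l (diag_cochain q.+1 D)] - kos x c.
  apply/ffunP => C; rewrite [LHS]ffunE [RHS]ffunE [X in X + _]ffunE.
  by rewrite [X in _ + X]ffunE.
rewrite kosB kos_kos subr0 (kos_map x _ (lin_r l)) [X in craise l' X]ffunE.
by rewrite craise_craise subrr.
Qed.

(** Position 0 of the previous lemma: there are no cochains in position -1, so the cocycle vanishes
    after raising. Its component at the empty set, where the product of variables is 1, expresses mu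
    through the variables. *)
Lemma castelnuovo : exists nu : 'I_n -> E,
  (forall i, A (e - 1) (nu i)) /\ mu = \sum_i 'X_i *: nu i.
Proof.
have [l [c [Hc /(_ set0) dc]]] := castelnuovo_step (leq0n n).
have ci i : coch A 0 (e - 1) (c (i |: set0)).
  move: (Hc (i |: set0)); rewrite setU0 cards1 eqxx => H.
  by apply: (coch_eq H) => //; lia.
have Hth : coch A 0 (e + l.+1%:Z * 0) (craise l (diag_cochain 0 set0) - kos x c set0).
  apply: cochB => //.
    by apply: (coch_eq (coch_craise gA l (coch_diag_cochain 0 set0))) => //; lia.
  rewrite ffunE; apply: coch_sum => // i _; rewrite -scalerA.
  have -> : e + l.+1%:Z * 0 = e - 1 + 1 + 0 by lia.
  apply: coch_hom => //.
    by rewrite /sg -signr_odd; case: odd; rewrite ?expr0 ?expr1 -?mpolyC1 -?mpolyCN; apply: homC.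
  by apply: coch_hom => //; apply: (@homX k n i 1).
have [|l' [b [Hb Eb]]] := regA _ Hth dc; first by lia.
move/ffunP/(_ set0): Eb; rewrite (coch_out _ Hb) // cdiff0.
rewrite 2!ffunE [X in _ *: (_ + X) = _]ffunE /var_prod big_set0 expr1n scale1r.
rewrite !ffunE cards0 !eqxx /= /var_prod big_set0 expr1n scale1r sum_ffunE.
move/eqP; rewrite subr_eq0 => /eqP ->.
exists (fun i => sg i (set0 : {set 'I_n}) *: c (i |: set0) set0); split.
  by move=> i; apply: gsub_sg => //; move: (ci i set0); rewrite cards0.
by apply: eq_big => [i|i _]; rewrite ?inE // ffunE scalerA mulrC.
Qed.

End Castelnuovo.

(** * Ideals of the polynomial ring *)

(** Beyond every index f attains a minimum; the subsequence repeatedly picks such a minimum and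
    restarts right after it. *)
Lemma nondecreasing_subseq (f : nat -> nat) :
  exists g : nat -> nat, (forall i j, (i < j)%N -> (g i < g j)%N) /\
    (forall i j, (i <= j)%N -> (f (g i) <= f (g j))%N).
Proof.
have /choice[h Hh] : forall N, exists i, (N <= i)%N /\ forall j, (N <= j)%N -> (f i <= f j)%N.
  move=> N; have ex : exists v, `[< exists i, (N <= i)%N /\ f i = v >].
    by exists (f N); apply/asboolP; exists N.
  case: (ex_minnP ex) => v /asboolP[i [Ni <-]] vmin.
  by exists i; split=> // j Nj; apply: vmin; apply/asboolP; exists j.
pose N := fix N i := if i is i'.+1 then (h (N i')).+1 else 0%N.
have NS i : (N i < N i.+1)%N by rewrite /= ltnS; case: (Hh (N i)).
have Nlt i j : (i < j)%N -> (N i < N j)%N.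
  elim: j => // j IH; rewrite ltnS leq_eqVlt => /orP[/eqP -> //|/IH lt].
  exact: ltn_trans lt (NS j).
have Nle i j : (i <= j)%N -> (N i <= N j)%N.
  by rewrite leq_eqVlt => /orP[/eqP -> //|/Nlt/ltnW].
exists (fun i => h (N i)); split=> i j ij.
  have [le _] := Hh (N j); apply: leq_trans le; exact: (Nle i.+1).
have [_ ->] // := Hh (N i); have [le _] := Hh (N j).
exact: leq_trans (Nle _ _ ij) le.
Qed.

Lemma dickson n (u : nat -> 'X_{1..n}) :
  exists i j, (i < j)%N /\ (u i <= u j)%MM.
Proof.
suff [g [glt gle]] : exists g : nat -> nat,
    (forall i j, (i < j)%N -> (g i < g j)%N) /\
    forall t, t \in enum 'I_n -> forall i j, (i <= j)%N -> (u (g i) t <= u (g j) t)%N.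
  exists (g 0%N), (g 1%N); split; first exact: glt.
  by apply/mnm_lepP => t; apply: gle; rewrite ?mem_enum.
elim: (enum 'I_n) => [|t T [g [glt gle]]]; first by exists id; split.
have [h [hlt hle]] := nondecreasing_subseq (fun i => u (g i) t).
have hmono i j : (i <= j)%N -> (h i <= h j)%N.
  by rewrite leq_eqVlt => /orP[/eqP -> //|/hlt/ltnW].
exists (fun i => g (h i)); split=> [i j /hlt /glt //|l].
by rewrite inE => /orP[/eqP -> //|lT] i j /hmono; apply: gle.
Qed.

Section Ideals.
Variables (k : fieldType) (n : nat).
Notation S := {mpoly k[n]}.
Implicit Types (J P T : S -> Prop) (p q : S).

Definition is_ideal (J : S -> Prop) : Prop :=
  [/\ J 0, forall p q, J p -> J q -> J (p + q) & forall a p, J p -> J (a * p)].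

Definition is_prime J : Prop :=
  [/\ is_ideal J, ~ J 1 & forall p q, J (p * q) -> J p \/ J q].

Section IdealTheory.
Variables (J : S -> Prop) (iJ : is_ideal J).

Lemma ideal0 : J 0. Proof. by case: iJ. Qed.
Lemma idealD p q : J p -> J q -> J (p + q). Proof. by case: iJ => _ H _; apply: H. Qed.
Lemma ideal_mull a p : J p -> J (a * p). Proof. by case: iJ => _ _; apply. Qed.
Lemma ideal_mulr a p : J p -> J (p * a). Proof. by rewrite mulrC; apply: ideal_mull. Qed.
Lemma idealN p : J p -> J (- p). Proof. by rewrite -mulN1r; apply: ideal_mull. Qed.
Lemma idealB p q : J p -> J q -> J (p - q).
Proof. by move=> Jp /idealN; apply: idealD. Qed.
Lemma ideal_sum (I : eqType) (s : seq I) (Q : pred I) (F : I -> S) :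
  (forall i, Q i -> J (F i)) -> J (\sum_(i <- s | Q i) F i).
Proof. by move=> H; elim/big_ind: _ => //; [apply: ideal0|apply: idealD]. Qed.
End IdealTheory.

Lemma minimal_mlead J : (exists p, J p) ->
  exists p, J p /\ forall q, J q -> (mlead p <= mlead q)%O.
Proof.
move=> [p Jp]; move eu : (mlead p) => u.
elim/(well_founded_induction (@ltom_wf n)): u p Jp eu => u IH p Jp eu.
have [[q [Jq lt]]|H] := pselect (exists q, J q /\ (mlead q < u)%O).
  exact: IH lt q Jq erefl.
exists p; split=> // q Jq; rewrite eu leNgt; apply/negP => lt.
by apply: H; exists q.
Qed.

(* Noetherianity, by Dickson's lemma applied to the leading monomials of
   elements of least leading monomial in the gaps of an ascending chain. *)
Lemma exists_maximal_ideal (Fam : (S -> Prop) -> Prop) :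
  (exists J, Fam J) -> (forall J, Fam J -> is_ideal J) ->
  exists J, Fam J /\
    forall J', Fam J' -> (forall p, J p -> J' p) -> forall p, J' p -> J p.
Proof.
move=> [J0 F0] Fid; apply: contrapT => nmax.
have step (J : {J | Fam J}) : exists x : {J | Fam J} * S,
    [/\ forall p, sval J p -> sval x.1 p, sval x.1 x.2, ~ sval J x.2 &
     forall q, sval x.1 q -> ~ sval J q -> (mlead x.2 <= mlead q)%O].
  case: J => J FJ /=; apply: contrapT => H; apply: nmax; exists J; split=> //.
  move=> J' FJ' JJ' p J'p; apply: contrapT => nJp; apply: H.
  have [|q [[J'q nJq] qmin]] := @minimal_mlead (fun q => J' q /\ ~ J q).
    by exists p.
  by exists (exist _ J' FJ', q); split=> // q' J'q' nJq'; apply: qmin.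
have /choice[nx Hnx] := step.
pose Js i := iter i (fun X => (nx X).1) (exist _ J0 F0).
pose p i := (nx (Js i)).2.
have Jmono i j q : (i <= j)%N -> sval (Js i) q -> sval (Js j) q.
  elim: j => [|j IH]; first by rewrite leqn0 => /eqP ->.
  rewrite leq_eqVlt => /orP[/eqP -> //|/IH H /H].
  by have [H1 _ _ _] := Hnx (Js j); apply: H1.
have [i [j [ij le]]] := dickson (fun i => mlead (p i)).
have [_ pi _ _] := Hnx (Js i); have [_ pj npj pmin] := Hnx (Js j).
have iJ l := Fid _ (svalP (Js l)).
set w := (mlead (p j) - mlead (p i))%MM.
(* Cancelling the leading term of [p j] against a multiple of [p i] gives an element of the same gap
   of the chain with a smaller leading monomial, contrary to the choice of [p j]. *)
pose q := p j - ((p j)@_(mlead (p j)) / (p i)@_(mlead (p i))) *: (p i * 'X_[w]).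
have pi_j : sval (Js j) (p i) by apply: (Jmono i.+1 j).
have wE : (w + mlead (p i))%MM = mlead (p j) by rewrite submK.
have pi0 : p i != 0.
  have [_ _ npi _] := Hnx (Js i).
  by apply/eqP => E; apply: npi; rewrite -/(p i) E; apply: ideal0.
have Jq : sval (Js j.+1) q.
  apply: idealB => //; rewrite -mul_mpolyC; apply: ideal_mull => //.
  by apply: ideal_mulr => //; apply: (Jmono j).
have nJq : ~ sval (Js j) q.
  move=> Hq; apply: npj; rewrite -[X in sval _ X]/(p j).
  rewrite (_ : p j = q + ((p j)@_(mlead (p j)) / (p i)@_(mlead (p i)))%:MP * (p i * 'X_[w])).
    by apply: idealD => //; apply: ideal_mull => //; apply: ideal_mulr.
  by rewrite mul_mpolyC /q subrK.
have q0 : q@_(mlead (p j)) = 0.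
  rewrite mcoeffB mcoeffZ -{3}wE mcoeffMX divfK ?subrr //.
  by rewrite mleadc_eq0.
have := pmin q Jq nJq; rewrite le_eqVlt => /orP[/eqP E|lt].
  apply: nJq; suff -> : q = 0 by apply: ideal0.
  by apply/eqP; rewrite -mleadc_eq0 -E q0.
have : (mlead q <= mlead (p j))%O.
  apply: le_trans (mleadB_le _ _) _; rewrite leUx lexx /=.
  rewrite -mul_mpolyC; apply: le_trans (mleadM_le _ _) _.
  rewrite mleadC add0m; apply: le_trans (mleadM_le _ _) _.
  by rewrite mleadXm addmC wE.
by rewrite leNgt lt.
Qed.

Definition adjoin J a : S -> Prop := fun p => exists q c, J q /\ p = q + c * a.

Lemma is_ideal_adjoin J a : is_ideal J -> is_ideal (adjoin J a).
Proof.
move=> iJ; split.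
- by exists 0, 0; rewrite mul0r addr0; split=> //; apply: ideal0.
- move=> _ _ [q [c [Jq ->]]] [q' [c' [Jq' ->]]]; exists (q + q'), (c + c').
  by split; [apply: idealD|ring].
- move=> b _ [q [c [Jq ->]]]; exists (b * q), (b * c).
  by split; [apply: ideal_mull|ring].
Qed.

Lemma adjoin_sub J a p : J p -> adjoin J a p.
Proof. by move=> Jp; exists p, 0; rewrite mul0r addr0. Qed.

Lemma adjoin_gen J a : is_ideal J -> adjoin J a a.
Proof. by move=> iJ; exists 0, 1; rewrite mul1r add0r; split=> //; apply: ideal0. Qed.

Lemma exists_prime_avoiding J T : is_ideal J -> T 1 ->
  (forall p q, T p -> T q -> T (p * q)) -> (forall p, J p -> ~ T p) ->
  exists P, [/\ is_prime P, forall p, J p -> P p & forall p, P p -> ~ T p].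
Proof.
move=> iJ T1 TM JT.
pose Fam P := [/\ is_ideal P, forall p, J p -> P p & forall p, P p -> ~ T p].
have [|P []|P [[iP JP PT] Pmax]] := @exists_maximal_ideal Fam.
- by exists J.
- by [].
exists P; split=> //; split=> //; first by move=> /PT.
move=> a b Pab; apply: contrapT => /not_orP[nPa nPb].
have meet c : ~ P c -> exists q d, P q /\ T (q + d * c).
  move=> nPc; apply: contrapT => H; apply: nPc.
  apply: (Pmax (adjoin P c)); last exact: adjoin_gen.
    split; first exact: is_ideal_adjoin.
      by move=> p /JP; apply: adjoin_sub.
    by move=> _ [q [d [Pq ->]]] Tq; apply: H; exists q, d.
  by move=> p; apply: adjoin_sub.
have [q [d [Pq Tq]]] := meet a nPa; have [q' [d' [Pq' Tq']]] := meet b nPb.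
apply: (PT _ _ (TM _ _ Tq Tq')).
rewrite (_ : _ * _ = q * (q' + d' * b) + ((d * a) * q' + (d * d') * (a * b))); last by ring.
apply: (idealD iP); first exact: ideal_mulr.
by apply: (idealD iP); apply: ideal_mull.
Qed.

Lemma primeX P p l : is_prime P -> P (p ^+ l) -> P p.
Proof.
move=> [_ P1 Pm]; elim: l => [|l IH]; first by rewrite expr0.
by rewrite exprS => /Pm[].
Qed.

Lemma ideal_powD J a b l l' : is_ideal J ->
  J (a ^+ l) -> J (b ^+ l') -> J ((a + b) ^+ (l + l')).
Proof.
move=> iJ Ja Jb; rewrite exprDn; apply: ideal_sum => // i _.
rewrite -mulr_natr; apply: ideal_mulr => //.
have [le|lt] := leqP l' i.
  by apply: ideal_mull => //; rewrite -(subnK le) exprD; apply: ideal_mull.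
apply: ideal_mulr => //; rewrite -(@subnK l (l + l' - i)) ?exprD; last by lia.
exact: ideal_mull.
Qed.

End Ideals.

(** * A homogeneous parameter modulo I *)

Section HomogeneousComponents.
Variables (k : fieldType) (n : nat).
Notation S := {mpoly k[n]}.
Implicit Types (p q y : S).

Lemma pihomogM e D p y : y \is D.-homog ->
  pihomog mdeg e (p * y) = if (D <= e)%N then pihomog mdeg (e - D) p * y else 0.
Proof.
move=> hy; rewrite {1}(pihomog_partitionE (leqnn (msize p))) mulr_suml raddf_sum /=.
have hM d : pihomog mdeg d p * y \is (d + D).-homog by apply: dhomogM => //; apply: pihomogP.
have zero d : (d + D != e)%N -> pihomog mdeg e (pihomog mdeg d p * y) = 0.
  by move=> ne; apply: pihomog_ne0 (hM d).
case: ifP => De; last first.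
  by rewrite big1 // => d _; apply: zero; apply: contraFneq De => <-; apply: leq_addl.
have [lt|le] := ltnP (e - D) (msize p).
  rewrite (bigD1 (Ordinal lt)) //= big1 ?addr0 => [|d /negP dE]; last first.
    by apply: zero; apply/eqP => E0; apply: dE; apply/eqP/val_inj => /=; lia.
  by apply: pihomog_dE; have := hM (e - D)%N; rewrite subnK.
rewrite big1 => [|d _]; last by apply: zero; have := ltn_ord d; lia.
rewrite pihomogE big_seq_cond big1 ?mul0r // => u /andP[/msize_mdeg_lt].
by move=> lt /eqP E0; move: lt; rewrite /= in E0 *; lia.
Qed.

Lemma pihomog0E p : pihomog mdeg 0 p = (p@_0%MM)%:MP.
Proof.
have /msize1_polyC -> : (msize (pihomog mdeg 0 p) <= 1)%N.
  rewrite msizeE; apply/bigmax_leqP_seq => u up _.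
  by rewrite ltnS leqn0 (dhomogP _ _ _ (pihomogP mdeg 0 p) u up).
congr (_%:MP); rewrite pihomogE [in RHS](mpolyE p) !raddf_sum /= [LHS]big_mkcond.
apply: eq_bigr => u _ /=; rewrite mcoeffZ mcoeffX.
have [->|u0] := eqVneq u 0%MM; first by rewrite mdeg0.
by rewrite mdeg_eq0 (negPf u0) mulr0.
Qed.

End HomogeneousComponents.

Section OneDimensional.
Variables (k : fieldType) (n : nat).
Notation S := {mpoly k[n]}.
Variable I : S -> Prop.
Hypotheses (iI : is_ideal I) (grI : forall p e, I p -> I (pihomog mdeg e p)).
Hypothesis dimI : forall P0 P1 P2 : S -> Prop,
  is_prime P0 -> is_prime P1 -> is_prime P2 ->
  (forall p, I p -> P0 p) -> (forall p, P0 p -> P1 p) -> (forall p, P1 p -> P2 p) ->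
  (forall p, P1 p -> P0 p) \/ (forall p, P2 p -> P1 p).

Lemma is_prime_irrelevant : is_prime (fun p : S => p@_0%MM = 0).
Proof.
have M (p q : S) : (p * q)@_0%MM = p@_0%MM * q@_0%MM by rewrite rmorphM.
split=> [||p q]; first split=> [|p q|a p].
- exact: mcoeff0.
- by rewrite mcoeffD => -> ->; rewrite addr0.
- by rewrite M => ->; rewrite mulr0.
- by rewrite mcoeff1 eqxx => /eqP; rewrite oner_eq0.
- by rewrite M => /eqP; rewrite mulf_eq0 => /orP[] /eqP; [left|right].
Qed.

(* If some x_i is not nilpotent modulo (I, y), a prime P containing (I, y) but
   not x_i lies strictly inside the irrelevant ideal, so it is minimal over I
   and y is nilpotent in the localization of S / I at P. *)
Lemma annihilated_power D y i : y \is D.-homog ->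
  (forall l, ~ adjoin I y ('X_i ^+ l)) ->
  exists P e z l, [/\ is_prime P, forall p, adjoin I y p -> P p,
    z \is e.-homog, ~ P (z * 'X_i) & I (z * y ^+ l)].
Proof.
move=> hy nX; have iIy := is_ideal_adjoin y iI.
(* A prime avoiding these products misses x_i and every polynomial with nonzero constant term, so it
   lies in the irrelevant ideal. *)
pose T p := exists (u : S) l, u@_0%MM != 0 /\ p = u * 'X_i ^+ l.
have [||p Ip [u [l [u0 E0]]]|P [pP IP PT]] := exists_prime_avoiding (T := T) iIy.
- by exists 1, 0%N; rewrite mcoeff1 eqxx oner_neq0 mulr1.
- move=> _ _ [u [l [u0 ->]]] [v [l' [v0 ->]]]; exists (u * v), (l + l')%N.
  rewrite (rmorphM (mcoeff 0%MM)) mulf_neq0 // exprD; split=> //; ring.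
(* The component of degree l of u x_i^l is u(0) x_i^l, and the ideal (I, y) is graded; so x_i^l
   would lie in it. *)
- apply: (nX l); move: Ip; rewrite E0 => -[q [c [Iq E1]]].
  have hX : ('X_i ^+ l : S) \is l.-homog by have := homX k i l; rewrite hom_natP.
  have := congr1 (pihomog mdeg l) E1.
  rewrite raddfD /= !(pihomogM _ _ hX) leqnn subnn pihomog0E mul_mpolyC => E2.
  rewrite -[_ ^+ l](scalerK u0) E2 -mul_mpolyC.
  apply: (ideal_mull iIy); rewrite (pihomogM _ _ hy).
  exists (pihomog mdeg l q), (if (D <= l)%N then pihomog mdeg (l - D) c else 0).
  by split; [apply: grI|case: ifP; rewrite ?mul0r].
have [iP P1 PM] := pP.
have nPX : ~ P 'X_i.
  by move=> /PT; apply; exists 1, 1%N; rewrite mcoeff1 eqxx oner_neq0 mul1r.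
have Pm p : P p -> p@_0%MM = 0.
  move=> Pp; apply/eqP; apply/negP => p0; apply: (PT p Pp).
  by exists p, 0%N; rewrite mulr1; split=> //; apply/negP.
(* If I missed all z y^l, a prime over I avoiding them would lie in P without containing y. Below P
   and the irrelevant ideal it would complete a strict chain of three primes over I. *)
pose T2 p := exists z l, ~ P z /\ p = z * y ^+ l.
have [z [l [nPz Izy]]] : exists z l, ~ P z /\ I (z * y ^+ l).
  apply: contrapT => H.
  have [||p Ip [z [l [nPz E0]]]|P' [pP' IP' P'T]] := exists_prime_avoiding (T := T2) iI.
  - by exists 1, 0%N; rewrite mulr1.
  - move=> _ _ [u [l [u0 ->]]] [v [l' [v0 ->]]]; exists (u * v), (l + l')%N.
    by split; [move=> /PM[]|rewrite exprD; ring].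
  - by apply: H; exists z, l; rewrite -E0.
  have P'P p : P' p -> P p.
    move=> P'p; apply: contrapT => nPp; apply: (P'T p P'p).
    by exists p, 0%N; rewrite mulr1.
  have [PP'|mP] := dimI pP' pP is_prime_irrelevant IP' P'P Pm.
    apply: (P'T y); first by apply/PP'/IP/adjoin_gen.
    by exists 1, 1%N; rewrite mul1r.
  apply: nPX; apply: mP; rewrite mcoeffX; case: eqP => // /(congr1 (fun u : 'X_{1..n} => u i)).
  by rewrite mnm1E eqxx mnm0E.
have [e nPe] : exists e, ~ P (pihomog mdeg e z).
  apply: contrapT => H; apply: nPz; rewrite (pihomog_partitionE (leqnn (msize z))).
  apply: (ideal_sum iP) => d _; apply: contrapT => nPd; apply: H.
  by exists (val d).
exists P, e, (pihomog mdeg e z), l; split=> //.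
- exact: pihomogP.
- by move=> /PM[].
- have := grI (e + D * l) Izy.
  by rewrite (pihomogM _ _ (dhomogMn l hy)) leq_addl addnK.
Qed.

(** Noetherian induction in place of prime avoidance. J is maximal among the ideals whose elements
    are nilpotent modulo (I, y) for some homogeneous y. If x_i is not nilpotent, y is traded for y'
    = y^(e+1) + w, where w y^l is in I: then y and w are both nilpotent modulo (I, y'), so J can be
    enlarged by w. Maximality puts w in J, a power of w in P, and finally z x_i in P, a
    contradiction. *)
Lemma exists_parameter : exists D (y : S), [/\ (0 < D)%N, y \is D.-homog &
  forall i : 'I_n, exists l, adjoin I y ('X_i ^+ l)].
Proof.
pose Fam (J : S -> Prop) := is_ideal J /\ exists D (y : S),
  [/\ (0 < D)%N, y \is D.-homog & forall g, J g -> exists l, adjoin I y (g ^+ l)].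
have [|J []|J [[iJ [D [y [D0 hy Jy]]]] Jmax]] := @exists_maximal_ideal k n Fam.
- exists I; split=> //; exists 1%N, 0; split; rewrite ?rpred0 // => g Ig.
  by exists 1%N; rewrite expr1; apply: adjoin_sub.
- by [].
exists D, y; split=> // i; apply: contrapT => nX.
have [|P [e [z [l [pP IP hz nPz Izy]]]]] := @annihilated_power D y i hy.
  by move=> l Il; apply: nX; exists l.
have [iP P1 PM] := pP.
(* The exponents make both summands homogeneous of degree D (e + 1), as z x_i has degree e + 1. *)
pose w := (z * 'X_i) ^+ D; pose y' := y ^+ e.+1 + w.
have hX : ('X_i : S) \is 1.-homog by have := homX k i 1; rewrite hom_natP.
have hy' : y' \is (D * e.+1).-homog.
  apply: rpredD; first exact: dhomogMn.
  by rewrite mulnC -addn1; apply: dhomogMn; apply: dhomogM.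
have Iwy : I (w * y ^+ l).
  rewrite /w -(prednK D0) exprS (_ : _ * _ = (z * 'X_i) ^+ D.-1 * 'X_i * (z * y ^+ l)).
    exact: ideal_mull.
  by ring.
have iIy' := is_ideal_adjoin y' iI.
have yI : adjoin I y' (y ^+ (e.+1 + l)).
  exists (- (w * y ^+ l)), (y ^+ l); split; first exact: idealN.
  by rewrite /y' exprD; ring.
have wI : adjoin I y' (w ^+ (1 + (e.+1 + l))).
  rewrite (_ : w = y' + - y ^+ e.+1); last by rewrite /y' addrC addKr.
  apply: ideal_powD => //; first by rewrite expr1; apply: adjoin_gen.
  rewrite exprNn; apply: ideal_mull => //; rewrite -exprM mulnC exprM [_ ^+ e.+1]exprS.
  exact: ideal_mulr.
have JwP : forall g, adjoin J w g -> J g.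
  apply: Jmax; last by move=> p; apply: adjoin_sub.
  split; first exact: is_ideal_adjoin.
  exists (D * e.+1)%N, y'; split=> //; first by rewrite muln_gt0 D0.
  move=> _ [q [c [Jq ->]]]; have [a [s [c' [Is Ea]]]] := Jy q Jq.
  exists (a * (1 + (e.+1 + l)) + (1 + (e.+1 + l)))%N.
  apply: ideal_powD => //; last by rewrite exprMn; apply: ideal_mull.
  rewrite exprM Ea; apply: ideal_powD => //; first by rewrite expr1; apply: adjoin_sub.
  by rewrite exprMn; apply: ideal_mull.
have [a /IP Pwa] := Jy _ (JwP _ (adjoin_gen w iJ)).
by apply: nPz; apply: (primeX pP (l := D)); apply: (primeX pP Pwa).
Qed.

Lemma exists_parameter_eqn : exists D N (y : S) (g : 'I_n -> S),
  [/\ (0 < D)%N, (D <= N)%N, y \is D.-homog, forall i, g i \is (N - D).-homog &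
      forall i, I ('X_i ^+ N - g i * y)].
Proof.
have [D [y [D0 hy /choice[l Hl]]]] := exists_parameter.
pose N := (D + \max_i l i)%N.
have iIy := is_ideal_adjoin y iI.
have DN : (D <= N)%N by apply: leq_addr.
have : forall i, exists g : S, g \is (N - D).-homog /\ I ('X_i ^+ N - g * y).
  move=> i; have lN : (l i <= N)%N.
    by apply: leq_trans (leq_addl D _); apply: (leq_bigmax i).
  have : adjoin I y ('X_i ^+ N).
    by rewrite -(subnK lN) exprD; apply: ideal_mull.
  move=> [q [c [Iq E0]]]; exists (pihomog mdeg (N - D) c); split; first exact: pihomogP.
  have hX : ('X_i ^+ N : S) \is N.-homog by have := homX k i N; rewrite hom_natP.
  have := congr1 (pihomog mdeg N) E0.
  rewrite (pihomog_dE hX) raddfD /= (pihomogM _ _ hy) DN => ->.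
  by rewrite addrK; apply: grI.
by move=> /choice[g Hg]; exists D, N, y, g; split=> // i; case: (Hg i).
Qed.

End OneDimensional.

(** * Modules annihilated by I *)

Section Torsion.
Variables (k : fieldType) (n : nat).
Notation S := {mpoly k[n]}.

(** Pigeonhole: after successive division by the x_i^a only monomials with all exponents at most a
    could remain, and these have degree at most n a. *)
Lemma hom_combination a e (q : S) : (n * a < e)%N -> q \is e.-homog ->
  exists h : 'I_n -> S, (forall i, homog_int (e%:Z - a%:Z) (h i)) /\
    q = \sum_i h i * 'X_i ^+ a.
Proof.
move=> nae hq.
have [h [q' [hh hq' E0 Hq']]] : exists (h : 'I_n -> S) (q' : S),
    [/\ forall i, homog_int (e%:Z - a%:Z) (h i), homog_int e%:Z q',
        q = \sum_i h i * 'X_i ^+ a + q' &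
        forall i, i \in enum 'I_n -> forall u : 'X_{1..n}, (a <= u i)%N -> q'@_u = 0].
  elim: (enum 'I_n) => [|i T [h [q' [hh hq' -> Hq']]]].
    exists (fun=> 0), q; split=> // [i|]; first exact: hom0.
    by rewrite big1 ?add0r // => i _; rewrite mul0r.
  exists (fun l => h l + (if l == i then mquo i a q' else 0)), (q' - 'X_i ^+ a * mquo i a q').
  split.
  - move=> l; apply: homD => //; case: ifP => _; last exact: hom0.
    exact: hom_mquo.
  - apply: homD => //; rewrite -mulN1r.
    have -> : e%:Z = 0 + (a%:Z + (e%:Z - a%:Z)) by lia.
    apply: homM; first by rewrite -mpolyC1 -mpolyCN; apply: homC.
    by apply: homM; [apply: homX|apply: hom_mquo].
  - under [in RHS]eq_bigr do rewrite mulrDl.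
    rewrite big_split -addrA; congr (_ + _) => /=.
    rewrite (bigD1 i) //= eqxx big1 ?addr0 => [|l /negPf ->]; last by rewrite mul0r.
    by rewrite mulrC addrC subrK.
  - move=> l; rewrite inE => /orP[/eqP ->|lT] u au; rewrite mcoeff_mrem ?au //.
    by case: ifP => // _; apply: Hq' lT _ au.
exists h; split=> //; rewrite E0 [q'](_ : _ = 0) ?addr0 //.
apply/mpolyP => u; rewrite mcoeff0; apply/eqP; apply: contraT => nz.
have ua i : (u i <= a)%N.
  by rewrite leqNgt; apply: contra nz => /ltnW au; rewrite (Hq' i) ?mem_enum.
have /eqP := proj1 (hom_coeff _ _) hq' u nz; rewrite eqz_nat mdegE => /eqP E1.
suff : (\sum_i u i <= n * a)%N by rewrite E1 leqNgt nae.
rewrite -[n in (n * _)%N]card_ord -sum_nat_const.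
by apply: leq_sum.
Qed.

Variable I : S -> Prop.
Hypothesis iI : is_ideal I.

Lemma ideal_congrX a b l : I (a - b) -> I (a ^+ l - b ^+ l).
Proof. by move=> Iab; rewrite subrXX; apply: ideal_mulr. Qed.

Lemma ideal_congr_prod (T : finType) (C : {set T}) (u v : T -> S) :
  (forall i, I (u i - v i)) -> I (\prod_(i in C) u i - \prod_(i in C) v i).
Proof.
move=> H; elim/big_rec2: _ => [|i p q _ Ipq]; first by rewrite subrr; apply: ideal0.
rewrite (_ : _ - _ = u i * (q - p) + (u i - v i) * p); last by ring.
by apply: idealD => //; [apply: ideal_mull|apply: ideal_mulr].
Qed.

Variables (D N : nat) (y : S) (g : 'I_n -> S).
Hypotheses (D0 : (0 < D)%N) (DN : (D <= N)%N) (hy : y \is D.-homog).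
Hypotheses (hg : forall i, g i \is (N - D).-homog).
Hypothesis Ig : forall i, I ('X_i ^+ N - g i * y).

Variables (E : lmodType S) (A B : int -> E -> Prop).
Hypotheses (gA : gsub A) (gB : gsub B).
Hypothesis IAB : forall e h j x, homog_int e h -> I h -> A j x -> B (j + e) (h *: x).
Hypothesis BA : forall e x, B e x -> A e x.

Lemma hom_sign t (i : 'I_t) (C : {set 'I_t}) : homog_int 0 (sg i C : S).
Proof.
by rewrite /sg -signr_odd; case: odd; rewrite ?expr0 ?expr1 -?mpolyC1 -?mpolyCN;
  apply: homC.
Qed.

Lemma dhomog_prod_in d (C : {set 'I_n}) (u : 'I_n -> S) :
  (forall i, u i \is d.-homog) -> \prod_(i in C) u i \is (d * #|C|).-homog.
Proof.
move=> hu; rewrite cardE -big_enum; elim: (enum _) => [|i s IH].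
  by rewrite big_nil muln0; apply: dhomog1.
by rewrite big_cons /= mulnS; apply: dhomogM.
Qed.

(* With y^K = sum_i h_i x_i^a, a cocycle m of level a satisfies
   y^K m = cdiff eta modulo B, and dividing by the powers of y, invertible
   wherever some x_i is, makes m a coboundary. *)
Lemma cohom0_torsion (q : nat) (j : int) : cohom0_quot A B q.+2%:Z j.
Proof.
move=> a m Hm dm.
(* Since D > 0, y^K has degree D K > n a, as the pigeonhole argument requires. *)
pose K := (n * a).+1.
have [h [hh yE]] := @hom_combination a (D * K) (y ^+ K)
  (leq_trans (ltnSn _) (leq_pmull _ D0)) (dhomogMn K hy).
pose ct (i : 'I_n) := @ccontract k n E i id.
pose eta := \sum_i h i *: ct i m.
pose zeta := \sum_i h i *: ct i (cdiff a m).
have yK : y ^+ K *: m = cdiff a eta + zeta.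
  rewrite yE scaler_suml /eta (big_morph (@cdiff k n E a) (@cdiffD k n E a) (@cdiff0 k n E a)).
  rewrite -big_split; apply: eq_bigr => i _ /=.
  rewrite cdiffZ -scalerDr -scalerA; congr (_ *: _); apply/ffunP => C.
  rewrite (@ccontract_homotopy k n E i a id) // ffunE.
  by case: ifP.
have Heta : coch A (q.+2%:Z - 1) (j + a%:Z * q.+2%:Z + 0 + ((D * K)%N%:Z - a%:Z)) eta.
  apply: coch_sum => // i _; apply: coch_hom => //.
  by apply: coch_ccontract Hm => // x; rewrite addr0.
have Hzeta : coch B q.+2%:Z (j + a%:Z * (q.+2%:Z + 1) + 0 + ((D * K)%N%:Z - a%:Z)) zeta.
  apply: coch_sum => // i _; apply: coch_hom => //.
  apply: (@coch_eq _ _ _ _ (q.+2%:Z + 1 - 1)); [|by lia|by []].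
  by apply: coch_ccontract dm => // x; rewrite addr0.
(* Modulo I, x_i^l is g_i^K y^K, hence x_C^l is G_C y^(K |C|): the fraction G_C / x_C^l plays the
   part of y^(-K |C|). *)
pose G (C : {set 'I_n}) := \prod_(i in C) g i ^+ K.
pose l := (N * K)%N.
have hG (C : {set 'I_n}) : homog_int ((N - D) * K * #|C|)%N%:Z (G C).
  by rewrite hom_natP; apply: dhomog_prod_in => i; apply: dhomogMn.
have IX i : I ('X_i ^+ l - g i ^+ K * y ^+ K).
  by rewrite /l exprM -exprMn; apply: ideal_congrX.
have IG (C : {set 'I_n}) : I (var_prod k C ^+ l - G C * y ^+ (K * #|C|)).
  rewrite exprM -prodr_const -big_split /var_prod -prodrXl.
  exact: ideal_congr_prod.
have hX i : homog_int l%:Z ('X_i ^+ l - g i ^+ K * y ^+ K).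
  rewrite hom_natP; apply: rpredB; first by have := homX k i l; rewrite hom_natP.
  rewrite /l -exprMn; apply: dhomogMn.
  by rewrite -(subnK DN); apply: dhomogM.
have hV (C : {set 'I_n}) :
    homog_int (l * #|C|)%N%:Z (var_prod k C ^+ l - G C * y ^+ (K * #|C|)).
  rewrite hom_natP; apply: rpredB; first by have := hom_var_prod k C l; rewrite hom_natP.
  rewrite exprM -prodr_const -big_split /=; apply: dhomog_prod_in => i.
  rewrite /l -exprMn; apply: dhomogMn.
  by rewrite -(subnK DN); apply: dhomogM.
have hy' e : homog_int (D * e)%N%:Z (y ^+ e) by rewrite hom_natP; apply: dhomogMn.
(* On sets of q + 1 elements the factor G_C y^(K q) over x_C^l amounts to y^(-K), so b stands for
   [eta] divided by y^K. At least one variable is inverted there; for a cocycle in position 1, [eta]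
   would sit on the empty set and the division would fail. *)
pose b : {ffun {set 'I_n} -> E} := [ffun C : {set 'I_n} => (G C * y ^+ (K * q)) *: eta C].
have Hb : coch A (q.+2%:Z - 1) (j + (a + l)%N%:Z * (q.+2%:Z - 1)) b.
  move=> C; move: (Heta C); rewrite ffunE; case: ifP => [/eqP cC|_ ->]; last by rewrite scaler0.
  move/(gsub_hom gA (homM (hG C) (hy' (K * q)%N))); apply: gsub_eq.
  have -> : #|C| = q.+1 by lia.
  by rewrite /l; move: (subnK DN) => <-; rewrite addnK; lia.
exists l, b; split=> //.
have Hdiff : coch A q.+2%:Z (j + (a + l)%N%:Z * q.+2%:Z) (craise l m - cdiff (a + l) b).
  apply: cochB => //.
    by apply: (coch_eq (coch_craise gA l Hm)) => //; lia.
  by apply: (coch_eq (coch_cdiff gA (a + l) Hb)) => //; lia.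
move=> C; case: ifP => cC; last by move: (Hdiff C); rewrite cC.
have {}cC : #|C| = q.+2 by lia.
rewrite !ffunE.
(* All three groups lie in B: the first and the last have coefficients in I, the middle one is a
   multiple of [zeta]. *)
have -> : var_prod k C ^+ l *: m C - \sum_(i in C) (sg i C * 'X_i ^+ (a + l)) *: b (C :\ i) =
   (var_prod k C ^+ l - G C * y ^+ (K * #|C|)) *: m C +
   ((G C * y ^+ (K * q.+1)) *: zeta C -
    \sum_(i in C) ((sg i C * 'X_i ^+ a) * (G (C :\ i) * y ^+ (K * q))) *:
       (('X_i ^+ l - g i ^+ K * y ^+ K) *: eta (C :\ i))).
  rewrite scalerBl -addrA; congr (_ + _).
  have -> : (G C * y ^+ (K * #|C|)) *: m C =
      (G C * y ^+ (K * q.+1)) *: (y ^+ K *: m) C.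
    by rewrite ffunE scalerA -mulrA -exprD cC; congr ((_ * _ ^+ _) *: _); lia.
  rewrite yK [X in _ = - (_ *: X) + _]ffunE scalerDr opprD -addrA [- _ + (_ - _)]addrA addNr add0r.
  rewrite ffunE scaler_sumr -!sumrN -big_split; apply: eq_bigr => i iC /=.
  rewrite ffunE !scalerA -!scaleNr -scalerDl; congr (_ *: _).
  have -> : G C = g i ^+ K * G (C :\ i).
    by rewrite /G (bigD1 i) //=; congr (_ * _); apply: eq_bigl => x; rewrite !inE andbC.
  by rewrite mulnS !exprD; ring.
have Bm : B (j + (a + l)%N%:Z * q.+2%:Z) ((var_prod k C ^+ l - G C * y ^+ (K * #|C|)) *: m C).
  move: (Hm C); rewrite cC eqxx -cC => /(IAB (hV C) (IG C)).
  by apply: gsub_eq; rewrite cC; lia.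
apply: gsubD => //; apply: gsubB => //.
  move: (Hzeta C); rewrite cC eqxx.
  move/(gsub_hom gB (homM (hG C) (hy' (K * q.+1)%N))); apply: gsub_eq.
  by rewrite cC /l; move: (subnK DN) => <-; rewrite addnK; lia.
apply: gsub_sum => // i iC.
have cCi : #|C :\ i| = q.+1 by have := cardsD1 i C; rewrite iC cC; lia.
move: (Heta (C :\ i)); rewrite cCi ifT; last by lia.
move/(IAB (hX i) (IX i)).
move/(gsub_hom gB (homM (homM (hom_sign i C) (homX k i a)) (homM (hG (C :\ i)) (hy' (K * q)%N)))).
by apply: gsub_eq; rewrite cCi /l; move: (subnK DN) => <-; rewrite addnK; lia.
Qed.

End Torsion.

(** * Regularity of tensor products *)

Section Combinations.
Variables (k : fieldType) (n : nat).
Notation S := {mpoly k[n]}.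

(** The map E^W -> E^T with the matrix of columns [g w]. The one formula serves for a presentation F
    -> M (with E = S) and for the induced map on F (x) N. *)
Definition comb (T W : finType) (E : lmodType S) (g : W -> {ffun T -> S^o})
    (y : {ffun W -> E}) : {ffun T -> E} :=
  [ffun t => \sum_w (g w t : S) *: y w].

Definition tensv (T : finType) (E : lmodType S) (u : {ffun T -> S^o}) (x : E) :
    {ffun T -> E} := [ffun t => (u t : S) *: x].

Section CombTheory.
Variables (T W : finType) (E : lmodType S).
Implicit Types (g : W -> {ffun T -> S^o}).

Lemma comb_linear g : linear (@comb T W E g).
Proof.
move=> a x y; apply/ffunP => t; rewrite !ffunE scaler_sumr -big_split.
by apply: eq_bigr => w _; rewrite !ffunE scalerDr !scalerA [_ * a]mulrC.
Qed.

Lemma comb0 g : comb g (0 : {ffun W -> E}) = 0.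
Proof. by apply/ffunP => t; rewrite !ffunE big1 // => w _; rewrite ffunE scaler0. Qed.

Lemma combZ g a (y : {ffun W -> E}) : comb g (a *: y) = a *: comb g y.
Proof. by rewrite -[a *: y]addr0 comb_linear comb0 addr0. Qed.

Lemma combD g : {morph @comb T W E g : x y / x + y}.
Proof. by move=> x y; rewrite -[x]scale1r comb_linear !scale1r. Qed.

Lemma combB g (x y : {ffun W -> E}) : comb g (x - y) = comb g x - comb g y.
Proof. by rewrite addrC -scaleN1r comb_linear scaleN1r addrC. Qed.

Lemma comb_tensv g (u : {ffun W -> S^o}) (x : E) :
  comb g (tensv u x) = tensv (comb g u) x.
Proof.
apply/ffunP => t; rewrite !ffunE scaler_suml.
by apply: eq_bigr => w _; rewrite ffunE scalerA.
Qed.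

Lemma combE g (y : {ffun W -> E}) : comb g y = \sum_w tensv (g w) (y w).
Proof.
apply/ffunP => t; rewrite sum_ffunE ffunE.
by apply: eq_bigr => w _; rewrite ffunE.
Qed.

End CombTheory.

Lemma comb_comb (T W V : finType) (E : lmodType S) (g : W -> {ffun T -> S^o})
    (s : V -> {ffun W -> S^o}) (y : {ffun V -> E}) :
  comb g (comb s y) = comb (fun v => comb g (s v)) y.
Proof.
apply/ffunP => t; rewrite !ffunE.
under eq_bigr do rewrite ffunE scaler_sumr.
rewrite exchange_big; apply: eq_bigr => v _ /=.
by rewrite ffunE scaler_suml; apply: eq_bigr => w _; rewrite scalerA.
Qed.

Definition unitv (W : finType) (w : W) : {ffun W -> S^o} := [ffun v => (v == w)%:R].

Lemma comb_unitv (W : finType) (E : lmodType S) (a : S) (g : W -> {ffun W -> S^o})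
    (y : {ffun W -> E}) :
  comb (fun w => a *: unitv w - g w) y = a *: y - comb g y.
Proof.
apply/ffunP => t; rewrite !ffunE.
under eq_bigr do rewrite !ffunE scalerBl.
rewrite sumrB; congr (_ - _); rewrite (bigD1 t) //= big1 ?addr0 => [|w wt].
  by rewrite eqxx /= [_ *: (1 : S^o)]mulr1.
by rewrite eq_sym (negPf wt) scaler0 scale0r.
Qed.

Section Tensor.
Variables (T : finType) (E : lmodType S).
Variables (M : int -> {ffun T -> S^o} -> Prop) (N : int -> E -> Prop).

(* The image of M (x) N in S^T (x) E. *)
Inductive tens (j : int) : {ffun T -> E} -> Prop :=
| tens0 : tens j 0
| tens_add i u x w : M i u -> N (j - i) x -> tens j w -> tens j (tensv u x + w).

Hypothesis gN : gsub N.

Lemma tensD j x y : tens j x -> tens j y -> tens j (x + y).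
Proof.
move=> Hx Hy; elim: Hx => [|i u z w Mu Nz _ IH]; first by rewrite add0r.
by rewrite -addrA; exact: (tens_add Mu Nz IH).
Qed.

Lemma gsub_tens : gsub tens.
Proof.
split.
- exact: tens0.
- exact: tensD.
- move=> j c x; elim=> [|i u z w Mu Nz _ IH]; first by rewrite scaler0; apply: tens0.
  rewrite scalerDr (_ : _ *: tensv u z = tensv u (c%:MP *: z)).
    by apply: (tens_add Mu _ IH); apply: gsubC.
  by apply/ffunP => t; rewrite !ffunE !scalerA mulrC.
- move=> j l x; elim=> [|i u z w Mu Nz _ IH]; first by rewrite scaler0; apply: tens0.
  rewrite scalerDr (_ : _ *: tensv u z = tensv u ('X_l *: z)).
    by apply: (tens_add Mu _ IH); rewrite addrAC; case: gN => _ _ _; apply.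
  by apply/ffunP => t; rewrite !ffunE !scalerA mulrC.
Qed.

Lemma tens_sum (W : finType) (j : int) (e : W -> int) (g : W -> {ffun T -> S^o})
    (y : {ffun W -> E}) :
  (forall w, M (e w) (g w)) -> (forall w, N (j - e w) (y w)) -> tens j (comb g y).
Proof.
move=> Mg Ny; rewrite combE; apply: gsub_sum => [|w _]; first exact: gsub_tens.
rewrite -[tensv _ _]addr0; apply: tens_add; [exact: Mg|exact: Ny|exact: tens0].
Qed.

End Tensor.

(* Over S localized at h, the submodule M of S^T is a direct summand. *)
Definition splits_at (T : finType) (e : T -> int) (M : int -> {ffun T -> S^o} -> Prop)
    (dh : int) (h : S) : Prop :=
  exists pi : T -> {ffun T -> S^o}, (forall t, M (e t + dh) (pi t)) /\
    forall j u, M j u -> comb pi u = h *: u.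

End Combinations.

Section FiniteDimension.
Variables (k : fieldType) (n : nat).
Notation S := {mpoly k[n]}.

(** Elimination on the number of spanning vectors: one x0 in U with nonzero first coordinate,
    together with the elements of U in the span of the remaining vectors, suffices. *)
Lemma subspace_span (V : lmodType S) (q : nat) (v : 'I_q -> V) (U : V -> Prop) :
  (forall x y, U x -> U y -> U (x + y)) -> (forall (c : k) x, U x -> U (c%:MP *: x)) ->
  (forall x, U x -> exists c : 'I_q -> k, x = \sum_i (c i)%:MP *: v i) ->
  exists p (g : 'I_p -> V), (forall i, U (g i)) /\
    forall x, U x -> exists c : 'I_p -> k, x = \sum_i (c i)%:MP *: g i.
Proof.
elim: q v U => [|q IH] v U UD UZ Uv.
  exists 0%N, (fun=> 0); split=> [[]//|x Ux]; exists (fun=> 0).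
  by have [c ->] := Uv x Ux; rewrite !big_ord0.
pose v' i := v (lift ord0 i).
pose U' x := U x /\ exists c : 'I_q -> k, x = \sum_i (c i)%:MP *: v' i.
have [||x []//|p [g [Ug gU]]] := IH v' U'.
- move=> x y [Ux [c xE]] [Uy [c' yE]]; split; first exact: UD.
  exists (fun i => c i + c' i); rewrite xE yE -big_split.
  by apply: eq_bigr => i _; rewrite mpolyCD scalerDl.
- move=> a x [Ux [c xE]]; split; first exact: UZ.
  exists (fun i => a * c i); rewrite xE scaler_sumr.
  by apply: eq_bigr => i _; rewrite mpolyCM scalerA.
have [UU'|] := pselect (forall x, U x -> U' x).
  by exists p, g; split=> [i|x /UU' /gU //]; case: (Ug i).
move=> /existsNP[x0 /not_implyP[Ux0 nU'x0]].
have [c0 x0E] := Uv x0 Ux0; rewrite big_ord_recl in x0E.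
have c00 : c0 ord0 != 0.
  apply/eqP => z0; apply: nU'x0; split=> //; exists (fun i => c0 (lift ord0 i)).
  by rewrite x0E z0 mpolyC0 scale0r add0r.
exists p.+1, (fun i => if unlift ord0 i is Some l then g l else x0); split.
  by move=> i; case: unliftP => [l _|_] //; case: (Ug l).
move=> x Ux; have [c xE] := Uv x Ux; rewrite big_ord_recl in xE.
pose a := c ord0 / c0 ord0.
have [|b bE] := gU (x - a%:MP *: x0).
  split; first by rewrite -scaleN1r -mpolyC1 -mpolyCN; apply: UD => //; apply/UZ/UZ.
  exists (fun i => c (lift ord0 i) - a * c0 (lift ord0 i)).
  rewrite xE x0E scalerDr scalerA -mpolyCM divfK // opprD addrACA subrr add0r.
  rewrite scaler_sumr -sumrB; apply: eq_bigr => i _.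
  by rewrite mpolyCB scalerBl scalerA -mpolyCM.
exists (fun i => if unlift ord0 i is Some l then b l else a).
rewrite big_ord_recl unlift_none addrC -[LHS](subrK (a%:MP *: x0)) bE.
by congr (_ + _); apply: eq_bigr => i _; rewrite !liftK.
Qed.

Variable T : finType.

Lemma free_part_span (e : T -> int) (j : int) : exists q (v : 'I_q -> {ffun T -> S^o}),
  forall u : {ffun T -> S^o}, free_part e j u ->
    exists c : 'I_q -> k, u = \sum_i (c i)%:MP *: v i.
Proof.
pose b := (\sum_t `|j - e t|).+1%N.
pose v0 (w : T * 'X_{1..n < b}) : {ffun T -> S^o} := 'X_[w.2] *: unitv k n w.1.
exists #|{: T * 'X_{1..n < b}}|, (fun i => v0 (enum_val i)) => u Hu.
pose cc (w : T * 'X_{1..n < b}) : k := (u w.1 : S)@_w.2.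
exists (fun i => cc (enum_val i)).
transitivity (\sum_(w : T * 'X_{1..n < b}) (cc w)%:MP *: v0 w); last first.
  rewrite (reindex (@enum_val _ {: T * 'X_{1..n < b}})) //.
  exact: onW_bij (enum_val_bij _).
apply/ffunP => t; rewrite sum_ffunE.
rewrite (eq_bigr (fun w => ((cc (w.1, w.2))%:MP *: v0 (w.1, w.2)) t)) => [|[] //].
rewrite -(pair_bigA _ (fun t' (m : 'X_{1..n < b}) => ((cc (t', m))%:MP *: v0 (t', m)) t)) /=.
rewrite (bigD1 t) //= [X in _ + X]big1 ?addr0 => [|w wt]; last first.
  by rewrite big1 // => m _; rewrite !ffunE eq_sym (negPf wt) !scaler0.
have le : (msize (u t : S) <= b)%N.
  rewrite msizeE; apply/bigmax_leqP_seq => m; rewrite mcoeff_msupp => mu _.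
  have := proj1 (hom_coeff _ _) (Hu t) m mu; rewrite ltnS => E0.
  by rewrite (bigD1 t) //= -E0 leq_addr.
rewrite {1}(mpolywE le); apply: eq_bigr => m _.
by rewrite !ffunE eqxx -mul_mpolyC; congr (_ * _); rewrite [RHS]mulr1.
Qed.

Variables (e : T -> int) (M : int -> {ffun T -> S^o} -> Prop).
Hypotheses (gM : gsub M) (Mfree : forall j u, M j u -> free_part e j u).

Lemma part_span (j : int) : exists q (g : 'I_q -> {ffun T -> S^o}),
  (forall i, M j (g i)) /\
  forall u, M j u -> exists c : 'I_q -> k, u = \sum_i (c i)%:MP *: g i.
Proof.
have [q [v Hv]] := free_part_span e j.
apply: (@subspace_span _ q v (M j)) => [x y|c x|x /Mfree /Hv //].
- exact: gsubD.
- exact: gsubC.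
Qed.

Lemma part_bounded : exists e0 : int, forall j u, j < e0 -> M j u -> u = 0.
Proof.
exists (- (\sum_t `|e t|)%N%:Z) => j u je /Mfree Hu; apply/ffunP => t; rewrite ffunE.
move: (Hu t); rewrite /hom_part; case E0: (j - e t) => [a|a]; last by move/eqP.
have : (`|e t| <= \sum_t `|e t|)%N by rewrite (bigD1 t) //= leq_addr.
by move: E0 je; lia.
Qed.

(** M vanishes below some degree e0. From e0 to r a finite spanning set of each homogeneous part is
    taken; above r every element is a combination of the variables with coefficients one degree
    lower, by [castelnuovo]. The generators need not be minimal. *)
Lemma regular_generators (r : int) : regular_at M r ->
  exists (W : finType) (e' : W -> int) (g : W -> {ffun T -> S^o}),
    [/\ forall w, e' w <= r, forall w, M (e' w) (g w) &
        forall j u, M j u -> exists y : {ffun W -> S^o}, free_part e' j y /\ comb g y = u].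
Proof.
move=> regM; have [e0 He0] := part_bounded.
have [W [e' [g [er Mg Hg]]]] : exists (W : finType) (e' : W -> int) (g : W -> {ffun T -> S^o}),
    [/\ forall w, e' w <= r, forall w, M (e' w) (g w) &
     forall j u, j < e0 + (`|r - e0|.+1)%N%:Z -> j <= r -> M j u ->
       exists y : {ffun W -> S^o}, free_part e' j y /\ comb g y = u].
  (* Counting |r - e0| + 1 degrees upwards from e0 passes r. *)
  elim: (`|r - e0|.+1)%N => [|b [W [e' [g [er Mg Hg]]]]].
    exists void, (fun=> 0), (fun=> 0); split=> // j u; rewrite addr0 => je _ Mu.
    exists 0; split; first by move=> w; rewrite ffunE; apply: hom0.
    by rewrite comb0 (He0 _ _ je Mu).
  have [br|rb] := leP (e0 + b%:Z) r; last first.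
    by exists W, e', g; split=> // j u _ jr; apply: Hg => //; lia.
  have [q [v [Mv Hv]]] := part_span (e0 + b%:Z).
  exists (W + 'I_q)%type, (fun w => match w with inl w => e' w | inr _ => e0 + b%:Z end),
    (fun w => match w with inl w => g w | inr i => v i end); split=> [[]//|[]//|j u jb jr Mu].
  have [jlt|jge] := ltP j (e0 + b%:Z).
    have [y [Hy <-]] := Hg j u jlt jr Mu.
    exists [ffun w => match w with inl w => y w | inr _ => 0 end]; split.
      by move=> [w|i]; rewrite ffunE; [apply: Hy|apply: hom0].
    apply/ffunP => t; rewrite !ffunE big_sumType /= [X in _ + X]big1 ?addr0.
      by apply: eq_bigr => w _; rewrite ffunE.
    by move=> i _; rewrite ffunE scaler0.
  have jE : j = e0 + b%:Z by lia.
  have [c uE] : exists c : 'I_q -> k, u = \sum_i (c i)%:MP *: v i by apply: Hv; rewrite -jE.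
  exists [ffun w => match w with inl _ => 0 | inr i => (c i)%:MP end]; split.
    move=> [w|i]; rewrite ffunE; first exact: hom0.
    by rewrite jE subrr; apply: homC.
  apply/ffunP => t; rewrite !ffunE big_sumType /= [X in X + _]big1 ?add0r.
    rewrite uE sum_ffunE; apply: eq_bigr => i _; rewrite !ffunE.
    exact: mulrC.
  by move=> i _; rewrite ffunE scaler0.
exists W, e', g; split=> //.
suff H (b : nat) : forall j u, j <= r + b%:Z -> M j u ->
    exists y : {ffun W -> S^o}, free_part e' j y /\ comb g y = u.
  by move=> j u; apply: (H `|j - r|%N); lia.
elim: b => [|b IH] j u jb Mu; first by apply: Hg => //; lia.
have [jr|rj] := leP j r; first by apply: Hg => //; lia.
have [nu [Mnu ->]] := castelnuovo gM regM rj Mu.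
have /choice[y Hy] : forall i, exists y : {ffun W -> S^o},
    free_part e' (j - 1) y /\ comb g y = nu i.
  by move=> i; apply: IH => //; lia.
exists (\sum_i 'X_i *: y i); split.
  apply: gsub_sum => [|i _]; first exact: gsub_free_part.
  have -> : j = j - 1 + 1 by lia.
  by have [_ _ _] := gsub_free_part k n e'; apply; case: (Hy i).
rewrite (big_morph _ (@combD _ _ _ _ _ g) (comb0 _ g)).
by apply: eq_bigr => i _; rewrite combZ; case: (Hy i) => _ ->.
Qed.

End FiniteDimension.

Section TensorRegularity.
Variables (k : fieldType) (n r : nat).
Notation S := {mpoly k[n]}.
Variables (d : 'I_r -> nat) (f : 'I_r -> S).
Hypothesis hf : forall i, f i \is (d i).-homog.

(** The only form in which dim S/I <= 1 is used: a quotient A/B killed by the [f i] has no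
    cohomology from position 2 on. *)
Definition torsion_acyclic : Prop :=
  forall (E : lmodType S) (A B : int -> E -> Prop),
  gsub A -> gsub B -> (forall e x, B e x -> A e x) ->
  (forall i e x, A e x -> B (e + (d i)%:Z) (f i *: x)) ->
  forall (q : nat) (j : int), cohom0_quot A B q.+2%:Z j.

Hypothesis tors : torsion_acyclic.

Variables (E : lmodType S) (N : int -> E -> Prop) (b : int).
Hypotheses (gN : gsub N) (regN : regular_at N b).

(* The induction replaces M by the kernel M' of a map F -> M from a free module
   on generators of degree <= a; M' has regularity at most a + 1, and the kernel
   L of F (x) N -> M (x) N differs from the image of M' (x) N by a module killed
   by the f i. *)
Lemma tens_regular_aux (c : nat) : forall (q : nat), (q + c = n.+1)%N -> (0 < q)%N ->
  forall (T : finType) (e : T -> int) (M : int -> {ffun T -> S^o} -> Prop) (a : int),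
  gsub M -> (forall j u, M j u -> free_part e j u) ->
  (forall i, splits_at e M (d i)%:Z (f i)) -> regular_at M a ->
  forall j, q%:Z + j > a + b -> cohom0 (tens M N) q%:Z j.
Proof.
(* Descending induction on the position q, from q = n + 1, where there are no cochains. *)
elim: c => [|c IH] q qc q0 T e M a gM Mfree Msplit regM j qj.
  by apply: cohom0_out; [apply: gsub_tens|lia].
have [W [e' [g [ea Mg gen]]]] := regular_generators gM Mfree regM.
pose F := free_part (k := k) (n := n) e'.
have gF : gsub F := gsub_free_part k n e'.
have FM i u : F i u -> M i (comb g u).
  move=> Fu; have -> : comb g u = \sum_w (u w : S) *: g w.
    by apply/ffunP => t; rewrite ffunE sum_ffunE; apply: eq_bigr => w _; rewrite ffunE; apply: mulrC.
  apply: gsub_sum => // w _; have -> : i = e' w + (i - e' w) by lia.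
  by apply: gsub_hom => //; apply: Fu.
have MF i u : M i u -> exists y, F i y /\ comb g y = u by apply: gen.
have lin E' := @comb_linear k n T W E' g.
pose M' := gker (comb g) F.
have gM' : gsub M' by apply: gsub_gker => //; apply: lin.
have regF : regular_at F a by apply: regular_free.
have regM' : regular_at M' (a + 1).
  move=> p i pi; apply: (cohom0_ker (lin _) gF FM MF).
    by apply: regF; lia.
  by apply: regM; lia.
(* Lifting the splitting of M to s : S^T -> F makes f_i - s g an endomorphism of F with values in
   M', equal to f_i on the kernel of g. It is used twice: f_i L lies in the image of M' (x) N, and
   M' again splits at f_i. *)
have Msplit' i : exists s : T -> {ffun W -> S^o},
    (forall w, M' (e' w + (d i)%:Z) (f i *: unitv k n w - comb s (g w))) /\
    forall t, F (e t + (d i)%:Z) (s t).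
  have [pi [Mpi piE]] := Msplit i.
  have /choice[s Hs] := fun t => MF _ _ (Mpi t).
  exists s; split=> [w|t]; last by case: (Hs t).
  split; last first.
    rewrite combB combZ comb_comb.
    have -> : comb g (unitv k n w) = g w.
      apply/ffunP => t; rewrite ffunE (bigD1 w) //= big1 ?addr0 => [|v /negPf vw].
        by rewrite ffunE eqxx /= [_ *: _]mulr1.
      by rewrite ffunE vw scaler0.
    have -> : (fun t => comb g (s t)) = pi by apply/funext => t; case: (Hs t).
    by rewrite (piE _ _ (Mg w)) subrr.
  apply: (gsubB gF) => v; rewrite !ffunE.
    have [->|vw] := eqVneq v w; last by rewrite scaler0; apply: hom0.
    rewrite [_ *: _]mulr1 (_ : _ - _ = (d i)%:Z); [exact: hf|by lia].
  apply: (gsub_sum (gsub_hom_part k n)) => t _.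
  have -> : e' w + (d i)%:Z - e' v = (e t + (d i)%:Z - e' v) + (e' w - e t) by lia.
  apply: homM; first by have [Fs _] := Hs t; exact: (Fs v).
  exact: (Mfree _ _ (Mg w)).
pose L := gker (comb g) (gprod (fun=> N) e').
have gP : gsub (gprod (fun _ : W => N) e') by apply: gsub_gprod => _.
have gL : gsub L by apply: gsub_gker => //; apply: lin.
have tensF i u x : F i u -> forall l, N (l - i) x -> gprod (fun=> N) e' l (tensv u x).
  move=> Fu l Nx w; rewrite ffunE.
  have -> : l - e' w = l - i + (i - e' w) by lia.
  by apply: gsub_hom => //; apply: Fu.
have PM i x : gprod (fun=> N) e' i x -> tens M N i (comb g x).
  by move=> Nx; apply: (tens_sum gN Mg).
have MP i w : tens M N i w -> exists x, gprod (fun=> N) e' i x /\ comb g x = w.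
  elim=> [|l u x v Mu Nx _ [y [Hy <-]]].
    by exists 0; split; [apply: gsub0|rewrite comb0].
  have [z [Fz <-]] := MF _ _ Mu.
  exists (tensv z x + y); split; last by rewrite combD comb_tensv.
  by apply: (gsubD gP) => //; apply: tensF Fz _ Nx.
apply: (cohom0_im (lin _) gP PM MP).
  apply: cohom0_prod => [//|w]; apply: regN; have := ea w; lia.
have -> : q%:Z + 1 = q.+1%:Z by lia.
apply: (@cohom0_ext _ _ _ _ (tens M' N)) => //.
- exact: gsub_tens.
- move=> i w; elim=> [|l u x v [Fu u0] Nx _ Lv]; first exact: gsub0.
  apply: (gsubD gL _ Lv); split; first exact: tensF Fu _ Nx.
  by rewrite comb_tensv u0; apply/ffunP => t; rewrite !ffunE scale0r.
(* As q > 0, the kernel L is considered in position at least 2, where torsion is invisible. *)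
- case: (q) q0 => // q' _; apply: tors => //; first exact: gsub_tens.
    move=> i w; elim=> [|l u x v [Fu u0] Nx _ Lv]; first exact: gsub0.
    apply: (gsubD gL _ Lv); split; first exact: tensF Fu _ Nx.
    by rewrite comb_tensv u0; apply/ffunP => t; rewrite !ffunE scale0r.
  move=> i l y [Hy y0]; have [s [Ms _]] := Msplit' i.
  have := comb_unitv (f i) (fun w => comb s (g w)) y.
  rewrite -comb_comb y0 comb0 subr0 => <-.
  apply: (tens_sum gN Ms) => w.
  by have -> : l + (d i)%:Z - (e' w + (d i)%:Z) = l - e' w by lia.
(* The position and the regularity bound both grow by 1, so the inequality on q + j is unchanged. *)
- apply: (IH q.+1 _ _ W e' M' (a + 1)) => //; first by lia.
  + by move=> i u [].
  + move=> i; have [s [Ms _]] := Msplit' i.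
    exists (fun w => f i *: unitv k n w - comb s (g w)); split=> // l u [_ u0].
    by rewrite (comb_unitv (f i) (fun w => comb s (g w)) u) -comb_comb u0 comb0 subr0.
  + by lia.
Qed.

Lemma tens_regular (T : finType) (e : T -> int) (M : int -> {ffun T -> S^o} -> Prop)
    (a p j : int) :
  gsub M -> (forall j u, M j u -> free_part e j u) ->
  (forall i, splits_at e M (d i)%:Z (f i)) -> regular_at M a ->
  0 < p -> p + j > a + b -> cohom0 (tens M N) p j.
Proof.
case: p => // p gM Mfree Msplit regM p0 pj.
have [pn|np] := leqP p n; last by apply: cohom0_out; [apply: gsub_tens|lia].
by apply: (@tens_regular_aux (n.+1 - p) p _ _ T e M a) => //; lia.
Qed.

End TensorRegularity.

(** * Koszul cycles *)

Section KoszulCycles.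
Variables (k : fieldType) (n r : nat).
Notation S := {mpoly k[n]}.
Variables (d : 'I_r -> nat) (f : 'I_r -> S).
Hypothesis hf : forall i, f i \is (d i).-homog.

Definition weight (A : {set 'I_r}) : int := (\sum_(i in A) d i)%N%:Z.

Lemma weightU1 i (A : {set 'I_r}) : i \notin A -> weight (i |: A) = (d i)%:Z + weight A.
Proof. by move=> iA; rewrite /weight big_setU1. Qed.

Lemma weightD1 i (A : {set 'I_r}) : i \in A -> weight A = (d i)%:Z + weight (A :\ i).
Proof. by move=> iA; rewrite -weightU1 ?setD1K // !inE eqxx. Qed.

Definition supported (E : lmodType S) (s : nat) (c : {ffun {set 'I_r} -> E}) : Prop :=
  forall A : {set 'I_r}, #|A| != s -> c A = 0.

(* For N = cycles of position t this is Z_s(I, Z_t(I)), the families in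
   K_s (x) K_t killed by both differentials. *)
Definition cycles (E : lmodType S) (N : int -> E -> Prop) (s : nat) (j : int)
    (c : {ffun {set 'I_r} -> E}) : Prop :=
  [/\ supported s c, kos f c = 0 & gprod (fun=> N) weight j c].

Section Coefficients.
Variables (E : lmodType S) (N : int -> E -> Prop).
Hypothesis gN : gsub N.
Implicit Types c : {ffun {set 'I_r} -> E}.

Let gP : gsub (gprod (fun _ : {set 'I_r} => N) weight).
Proof. by apply: gsub_gprod. Qed.

Lemma kosD c c' : kos f (c + c') = kos f c + kos f c'.
Proof. by rewrite -[c]scale1r kos_linear !scale1r. Qed.

Lemma kosZ a c : kos f (a *: c) = a *: kos f c.
Proof. by rewrite -[a *: c]addr0 kos_linear kos0 addr0. Qed.

Lemma gsub_cycles s : gsub (cycles N s).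
Proof.
split=> [j|j x y [sx kx Nx] [sy ky Ny]|j a x [sx kx Nx]|j i x [sx kx Nx]].
- by split; [move=> A _; rewrite ffunE|exact: kos0|exact: (gsub0 gP)].
- split; last exact: (gsubD gP).
    by move=> A As; rewrite ffunE sx ?sy ?addr0.
  by rewrite kosD kx ky addr0.
- split; last exact: (gsubC gP).
    by move=> A As; rewrite ffunE sx ?scaler0.
  by rewrite kosZ kx scaler0.
- split; last by case: gP => _ _ _; apply.
    by move=> A As; rewrite ffunE sx ?scaler0.
  by rewrite kosZ kx scaler0.
Qed.

Lemma gprod_kos j c : gprod (fun=> N) weight j c -> gprod (fun=> N) weight j (kos f c).
Proof.
move=> Nc B; rewrite ffunE; apply: gsub_sum => // i iB.
rewrite (_ : j - weight B = j - weight (i |: B) + (0 + (d i)%:Z)).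
  by apply: gsub_hom => //; apply: homM; [apply: hom_sign|rewrite hom_natP].
by rewrite weightU1 //; lia.
Qed.

Lemma gprod_wedge i j c :
  gprod (fun=> N) weight j c -> gprod (fun=> N) weight (j + (d i)%:Z) (wedge i c).
Proof.
move=> Nc A; rewrite ffunE; case: ifP => iA; last exact: gsub0.
rewrite (_ : _ - weight A = j - weight (A :\ i)); last first.
  by rewrite (weightD1 iA) opprD addrA addrK.
exact: gsub_sg.
Qed.

Lemma supported_kos s c : supported s.+1 c -> supported s (kos f c).
Proof.
move=> sc B Bs; rewrite ffunE big1 // => i iB; rewrite sc ?scaler0 //.
by rewrite cardsU1 iB.
Qed.

Lemma supported_wedge s i c : supported s c -> supported s.+1 (wedge i c).
Proof.
move=> sc A As; rewrite ffunE; case: ifP => // iA; rewrite sc ?scaler0 //.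
by move: As; rewrite (cardsD1 i A) iA.
Qed.

Lemma kos_tensv (u : {ffun {set 'I_r} -> S^o}) (x : E) :
  kos f (tensv u x) = tensv (kos f u) x.
Proof.
apply/ffunP => B; rewrite !ffunE scaler_suml.
by apply: eq_bigr => i _; rewrite ffunE scalerA.
Qed.

Lemma wedge_tensv i (u : {ffun {set 'I_r} -> S^o}) (x : E) :
  wedge i (tensv u x) = tensv (wedge i u) x.
Proof.
apply/ffunP => B; rewrite !ffunE; case: ifP => _; last by rewrite scale0r.
by rewrite ?ffunE scalerA.
Qed.

(** The columns of the operator c -> d(e_i wedge c) on K_s. The test on the cardinality keeps every
    column inside Z_s. *)
Definition splitting (s : nat) i (A : {set 'I_r}) : {ffun {set 'I_r} -> S^o} :=
  if #|A| == s then kos f (wedge i (unitv k n A)) else 0.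

Lemma comb_splitting s i c : supported s c ->
  comb (splitting s i) c = kos f (wedge i c).
Proof.
move=> sc; rewrite combE.
have kwD : {morph (fun c => kos f (wedge i c)) : x y / x + y}.
  move=> x y; rewrite -kosD; congr kos.
  by rewrite -[x in LHS]scale1r wedge_linear scale1r.
have kw0 : kos f (wedge i (0 : {ffun {set 'I_r} -> E})) = 0.
  by rewrite (_ : wedge i 0 = 0) ?kos0 //; apply/ffunP => A; rewrite !ffunE;
    case: ifP => // _; rewrite ?ffunE scaler0.
have {2}-> : c = \sum_A tensv (unitv k n A) (c A).
  apply/ffunP => A; rewrite sum_ffunE (bigD1 A) //= big1 => [|B BA].
    by rewrite !ffunE eqxx scale1r addr0.
  by rewrite !ffunE eq_sym (negPf BA) scale0r.
rewrite (big_morph _ kwD kw0); apply: eq_bigr => A _.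
rewrite /splitting; case: eqP => [_|/eqP As]; first by rewrite wedge_tensv kos_tensv.
have -> : tensv (unitv k n A) (c A) = 0.
  by apply/ffunP => B; rewrite !ffunE sc ?scaler0.
by rewrite kw0; apply/ffunP => B; rewrite !ffunE scale0r.
Qed.

Lemma comb_splitting_cycles s i j c : cycles N s j c ->
  comb (splitting s i) c = f i *: c.
Proof.
move=> [sc kc _]; rewrite comb_splitting // -kos_homotopy kc.
rewrite -[LHS]addr0; congr (_ + _); apply/ffunP => A.
by rewrite !ffunE; case: ifP => // _; rewrite ?ffunE scaler0.
Qed.

End Coefficients.

Notation hompart := (@hom_part k n).

Lemma cycles_splitting s i A : cycles hompart s (weight A + (d i)%:Z) (splitting s i A).
Proof.
have gh := gsub_hom_part k n.
rewrite /splitting; case: eqP => [As|_]; last exact: (gsub0 (gsub_cycles gh s)).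
split; last 1 first.
- apply: (gprod_kos gh); apply: (gprod_wedge gh) => B; rewrite ffunE.
  case: eqP => [->|_]; last exact: hom0.
  by rewrite subrr /= -[1]mpolyC1; apply: homC.
- apply: supported_kos; apply: supported_wedge => B Bs; rewrite ffunE.
  by case: (B =P A) Bs => // ->; rewrite As eqxx.
- exact: kos_kos.
Qed.

Lemma splits_at_cycles s i : splits_at weight (cycles hompart s) (d i)%:Z (f i).
Proof.
exists (splitting s i); split=> [A|j u]; first exact: cycles_splitting.
exact: comb_splitting_cycles.
Qed.

(** On a cycle c with coefficients in N, f_i c is the sum over A of the column d(e_i wedge e_A) in
    Z_s tensored with c_A. So each f_i maps the cycles into the image of Z_s (x) N, and the quotient
    is torsion. *)
Lemma cohom0_cycles_tens (E : lmodType S) (N : int -> E -> Prop) s (q : nat) j :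
  torsion_acyclic d f -> gsub N ->
  cohom0 (tens (cycles hompart s) N) q.+2%:Z j -> cohom0 (cycles N s) q.+2%:Z j.
Proof.
move=> tors gN; have gC := gsub_cycles gN s; have gh := gsub_hom_part k n.
have TC e x : tens (cycles hompart s) N e x -> cycles N s e x.
  elim=> [|i u y w [su ku hu] Ny _ Cw]; first exact: (gsub0 gC).
  apply: (gsubD gC _ Cw); split.
  - by move=> A As; rewrite ffunE su ?scale0r.
  - by rewrite kos_tensv ku; apply/ffunP => A; rewrite !ffunE scale0r.
  - move=> A; rewrite ffunE (_ : e - weight A = e - i + (i - weight A)); last by lia.
    by apply: (gsub_hom gN) => //; apply: hu.
apply: cohom0_ext => //; first exact: gsub_tens.
apply: tors => // [|i e x Cx]; first exact: gsub_tens.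
rewrite -(comb_splitting_cycles i Cx); apply: (tens_sum gN (cycles_splitting s i)) => A.
have [_ _ Nx] := Cx.
by rewrite (_ : _ - _ = e - weight A); [apply: Nx|lia].
Qed.

End KoszulCycles.

(** * The exterior algebra: comultiplication and shuffle product *)

Section ShuffleSign.
Variables (R : comPzRingType) (r : nat).
Implicit Types (i : 'I_r) (A B C : {set 'I_r}).

Lemma sgE i A : sg i A = \prod_(a in A) (-1) ^+ (a < i)%N :> R.
Proof.
rewrite prodrXr /sg; congr (_ ^+ _).
rewrite -sum1_card big_mkcond [RHS]big_mkcond; apply: eq_bigr => a _.
by rewrite inE; case: (a \in A) => //=; case: ltnP.
Qed.

(** For disjoint A and B, the sign in e_A wedge e_B = +- e_{A u B}. *)
Definition ssg A B : R := \prod_(a in A) sg a B.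

Lemma ssgM A B : ssg A B * ssg A B = 1.
Proof. by rewrite -big_split big1 //= => a _; apply: sgM. Qed.

Lemma ssgU1l i A B : i \notin A -> ssg (i |: A) B = sg i B * ssg A B.
Proof. by move=> iA; rewrite /ssg big_setU1. Qed.

(** The new inversions are the a in A above i: all of A except those counted by [sg i A]. *)
Lemma ssgU1r i A B : i \notin A -> i \notin B ->
  ssg A (i |: B) = (-1) ^+ #|A| * sg i A * ssg A B.
Proof.
move=> iA iB; rewrite sgE -prodr_const -!big_split; apply: eq_bigr => a aA /=.
rewrite sgU1 //; congr (_ * _).
have ai : a != i by apply: contraTneq aA => ->.
case: (ltngtP i a) => [||E]; rewrite ?expr0 ?expr1 ?mulr1 ?mulrNN ?mulr1 //.
by rewrite (ord_inj E) eqxx in ai.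
Qed.

Lemma sgID i A C : sg i C = sg i (C :&: A) * sg i (C :\: A) :> R.
Proof. by rewrite !sgE (big_setID A). Qed.

Lemma sgUdisjoint i A B : [disjoint A & B] -> sg i (A :|: B) = sg i A * sg i B :> R.
Proof.
move=> AB; rewrite (sgID i A) setUK setDUl setDv set0U.
by rewrite (setDidPl _) // disjoint_sym.
Qed.

End ShuffleSign.

Lemma big_subset_mem (V : nmodType) r (i : 'I_r) (D : {set 'I_r}) (F : {set 'I_r} -> V) :
  i \notin D ->
  \sum_(A : {set 'I_r} | (A \subset i |: D) && (i \in A)) F A =
  \sum_(A : {set 'I_r} | A \subset D) F (i |: A).
Proof.
move=> iD; rewrite (reindex_onto (fun A => i |: A) (fun A => A :\ i)) /=; last first.
  by move=> A /andP[_ iA]; rewrite setD1K.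
apply: eq_bigl => A; rewrite setU11 andbT.
have [AD|AD] := boolP (A \subset D).
  have iA : i \notin A by apply: contra iD; apply: (subsetP AD).
  by rewrite setUS // setU1K ?eqxx.
apply/negP => /andP[sA /eqP AE]; case/negP: AD; apply/subsetP => x xA.
have xi : x != i by move: xA; rewrite -AE !inE => /andP[].
by have := subsetP sA x; rewrite !inE xA orbT (negPf xi) /=; apply.
Qed.

Lemma big_subset_U1 (V : nmodType) r (i : 'I_r) (C : {set 'I_r}) (F : {set 'I_r} -> V) :
  i \notin C ->
  \sum_(A : {set 'I_r} | A \subset i |: C) F A =
  \sum_(A : {set 'I_r} | A \subset C) F (i |: A) + \sum_(A : {set 'I_r} | A \subset C) F A.
Proof.
move=> iC; rewrite (bigID (fun A : {set 'I_r} => i \in A)) /= big_subset_mem //; congr (_ + _).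
apply: eq_bigl => A; apply/andP/idP => [[sA iA]|sAC].
  apply/subsetP => x xA; have := subsetP sA x xA; rewrite !inE => /orP[/eqP xi|//].
  by rewrite -xi xA in iA.
split; first exact: subset_trans sAC (subsetUr _ _).
by apply: contra iC; apply: (subsetP sAC).
Qed.

Section Shuffle.
Variables (k : fieldType) (n r : nat).
Notation S := {mpoly k[n]}.
Variables (d : 'I_r -> nat) (f : 'I_r -> S) (E : lmodType S).
Notation K := {ffun {set 'I_r} -> E}.
Notation KK := {ffun {set 'I_r} -> {ffun {set 'I_r} -> E}}.
Implicit Types (A B C : {set 'I_r}) (z : K) (w : KK).

Definition comul (s t : nat) z : KK := [ffun A : {set 'I_r} => [ffun B : {set 'I_r} =>
  if [&& #|A| == s, #|B| == t & [disjoint A & B]] then ssg S A B *: z (A :|: B) else 0]].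

Definition shuffle w : K := [ffun C : {set 'I_r} =>
  \sum_(A : {set 'I_r} | A \subset C) ssg S A (C :\: A) *: w A (C :\: A)].

Lemma comul_linear s t : linear (comul s t).
Proof.
move=> a x y; apply/ffunP => A; apply/ffunP => B; rewrite !ffunE.
case: ifP => _; last by rewrite scaler0 addr0.
by rewrite scalerDr !scalerA [_ * a]mulrC.
Qed.

Lemma shuffle_linear : linear shuffle.
Proof.
move=> a x y; apply/ffunP => C; rewrite !ffunE scaler_sumr -big_split.
by apply: eq_bigr => A _; rewrite !ffunE scalerDr !scalerA [_ * a]mulrC.
Qed.

(** Comultiplication commutes with contraction in either factor: the coefficient at (A, B) is, up to
    a sign depending only on A and B, that of [kos f z] at the union of A and B. *)
Lemma kos_comulr s t z A : kos f z = 0 -> kos f (comul s t z A) = 0.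
Proof.
move=> /ffunP kz; apply/ffunP => B; rewrite !ffunE.
have [/and3P[As /eqP Bt AB]|nAB] := boolP [&& #|A| == s, #|B|.+1 == t & [disjoint A & B]]; last first.
  rewrite big1 // => i iB; rewrite ffunE ifF ?scaler0 //.
  apply: contraNF nAB => /and3P[-> /eqP <- dA]; rewrite cardsU1 iB eqxx /=.
  by apply: disjointWr dA; apply: subsetUr.
have := kz (A :|: B); rewrite !ffunE.
move=> /(congr1 (fun x => ((-1) ^+ #|A| * ssg S A B) *: x)); rewrite scaler0; apply: etrans.
rewrite scaler_sumr big_mkcond [RHS]big_mkcond; apply: eq_bigr => i _ /=.
rewrite !inE negb_or andbC; case: (boolP (i \in B)) => //= iB.
rewrite ffunE As cardsU1 iB add1n Bt eqxx /=.
have -> : [disjoint A & i |: B] = (i \notin A).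
  apply/idP/idP => [dA|iA].
    by have := disjointFl dA (setU11 i B) => ->.
  by rewrite -setI_eq0 setIUr setU_eq0 !setI_eq0 AB andbT disjoint_sym disjoints1.
case: ifP => iA; last by rewrite scaler0.
rewrite setUCA !scalerA; congr (_ *: _).
rewrite ssgU1r // sgUdisjoint //.
ring.
Qed.

Lemma kos_comull s t z : kos f z = 0 -> kos f (comul s t z) = 0.
Proof.
move=> /ffunP kz; apply/ffunP => A; apply/ffunP => B; rewrite !ffunE sum_ffunE.
have [/and3P[/eqP As Bt AB]|nAB] := boolP [&& #|A|.+1 == s, #|B| == t & [disjoint A & B]]; last first.
  rewrite big1 // => i iA; rewrite !ffunE ifF ?scaler0 //.
  apply: contraNF nAB => /and3P[/eqP <- -> dA]; rewrite cardsU1 iA eqxx /=.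
  by apply: disjointWl dA; apply: subsetUr.
have := kz (A :|: B); rewrite !ffunE.
move=> /(congr1 (fun x => ssg S A B *: x)); rewrite scaler0; apply: etrans.
rewrite scaler_sumr big_mkcond [RHS]big_mkcond; apply: eq_bigr => i _ /=.
rewrite !inE negb_or; case: (boolP (i \in A)) => //= iA.
rewrite !ffunE Bt cardsU1 iA add1n As eqxx /=.
have -> : [disjoint i |: A & B] = (i \notin B).
  apply/idP/idP => [dA|iB].
    by have := disjointFr dA (setU11 i A) => ->.
  by rewrite -setI_eq0 setIUl setU_eq0 !setI_eq0 AB andbT disjoints1.
case: ifP => iB; last by rewrite scaler0.
rewrite setUA !scalerA; congr (_ *: _).
rewrite ssgU1l // sgUdisjoint //.
ring.
Qed.

(** X and Y are the contractions of the left and of the right factor. The terms with i outside C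
    make up [kos f (shuffle w)]; the two hypotheses turn them into minus the terms with i in C.
    There X at a set A without i cancels Y at A with i added: both involve the same coefficient,
    whose two index sets contain i, and e_i wedge e_i = 0. *)
Lemma kos_shuffle w : (forall A, kos f (w A) = 0) -> kos f w = 0 -> kos f (shuffle w) = 0.
Proof.
move=> kwr /ffunP kwl; apply/ffunP => C; rewrite !ffunE.
pose X i A := (ssg S A (C :\: A) * (sg i A * f i)) *: w (i |: A) (C :\: A).
pose Y i A := ((-1) ^+ #|A| * ssg S A (C :\: A) * (sg i (C :\: A) * f i)) *:
   w A (i |: (C :\: A)).
transitivity (\sum_(A : {set 'I_r} | A \subset C) \sum_(i | i \notin C) (X i A + Y i A)).
  rewrite exchange_big /=; apply: eq_bigr => i iC.
  rewrite ffunE big_subset_U1 // scalerDr !scaler_sumr big_split /=; congr (_ + _).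
    apply: eq_bigr => A sAC; have iA : i \notin A by apply: contra iC; apply: (subsetP sAC).
    have -> : (i |: C) :\: (i |: A) = C :\: A.
      apply/setP => x; rewrite !inE; case: (eqVneq x i) => //= ->.
      by rewrite (negPf iC) andbF.
    rewrite !scalerA; congr (_ *: _); rewrite ssgU1l // (sgID S i A C) (setIidPr sAC).
    rewrite -[RHS]mul1r -(sgM S i (C :\: A)); ring.
  apply: eq_bigr => A sAC; have iA : i \notin A by apply: contra iC; apply: (subsetP sAC).
  have iCA : i \notin C :\: A by rewrite inE negb_and iC orbT.
  have -> : (i |: C) :\: A = i |: (C :\: A).
    by apply/setP => x; rewrite !inE; case: (eqVneq x i) => //= ->; rewrite iA.
  rewrite !scalerA; congr (_ *: _); rewrite ssgU1r // (sgID S i A C) (setIidPr sAC).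
  rewrite -[RHS]mul1r -(sgM S i A); ring.
transitivity (- \sum_(A : {set 'I_r} | A \subset C)
   (\sum_(i in C | i \notin A) X i A + \sum_(i in A) Y i A)).
  rewrite -sumrN; apply: eq_bigr => A sAC; rewrite big_split /= opprD; congr (_ + _).
    apply/eqP; rewrite -addr_eq0 addrC; apply/eqP.
    have := kwl A => /ffunP/(_ (C :\: A)); rewrite !ffunE sum_ffunE.
    move=> /(congr1 (fun x => ssg S A (C :\: A) *: x)); rewrite scaler0; apply: etrans.
    rewrite scaler_sumr [RHS](bigID (fun i => i \in C)) /=; congr (_ + _).
      apply: eq_big => [i|i _]; first by rewrite andbC.
      by rewrite ffunE scalerA.
    apply: eq_big => [i|i _]; last by rewrite ffunE scalerA.
    by rewrite andb_idl //; apply: contra; apply: (subsetP sAC).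
  apply/eqP; rewrite -addr_eq0 addrC; apply/eqP.
  have := kwr A => /ffunP/(_ (C :\: A)); rewrite !ffunE.
  move=> /(congr1 (fun x => ((-1) ^+ #|A| * ssg S A (C :\: A)) *: x)); rewrite scaler0; apply: etrans.
  rewrite scaler_sumr [RHS](bigID (fun i => i \in A)) /=; congr (_ + _).
    apply: eq_big => [i|i _]; last by rewrite scalerA.
    by rewrite in_setD; case: (i \in A); rewrite ?andbF.
  apply: eq_big => [i|i _]; last by rewrite scalerA.
  rewrite in_setD; case: (boolP (i \in A)) => //= iA; first by rewrite (subsetP sAC).
  by rewrite andbT.
apply/eqP; rewrite oppr_eq0; apply/eqP.
rewrite big_split /= (exchange_big_dep (fun i => i \in C)) /=; last by move=> A i _ /andP[].
rewrite [X in _ + X](exchange_big_dep (fun i => i \in C)) /=; last first.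
  by move=> A i /subsetP sAC; apply: sAC.
rewrite -big_split big1 //= => i iC.
have CE : i |: (C :\ i) = C by rewrite setD1K.
have iD : i \notin C :\ i by rewrite !inE eqxx.
rewrite [X in _ + X](eq_bigl (fun A : {set 'I_r} => (A \subset i |: (C :\ i)) && (i \in A))); last first.
  by move=> A; rewrite CE.
rewrite big_subset_mem // [X in X + _](eq_bigl (fun A : {set 'I_r} => A \subset C :\ i)); last first.
  by move=> A; rewrite subsetD1 iC.
rewrite -big_split big1 //= => A AD.
have iA : i \notin A by apply: contra iD; apply: (subsetP AD).
have DE : C :\: (i |: A) = (C :\ i) :\: A by rewrite setDDl.
have iDA : i \notin (C :\ i) :\: A by rewrite inE negb_and iD orbT.
have CA : C :\: A = i |: ((C :\ i) :\: A).
  by apply/setP => x; rewrite !inE; case: (eqVneq x i) => //= ->; rewrite iA iC.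
rewrite /X /Y DE -CA -scalerDl [X in X *: _](_ : _ = 0) ?scale0r //.
rewrite {1}CA ssgU1r // ssgU1l // cardsU1 iA add1n exprS.
set u := sg i A; set v := sg i _.
have u1 : u * u = 1 by apply: sgM.
have v1 : v * v = 1 by apply: sgM.
transitivity ((-1) ^+ #|A| * ssg S A (C :\ i :\: A) * f i * (u * u - v * v)); first by ring.
by rewrite u1 v1 subrr mulr0.
Qed.

(** Each s-element subset of C contributes the coefficient once, the two shuffle signs being
    equal. *)
Lemma shuffle_comul s t z : supported (s + t) z ->
  shuffle (comul s t z) = ('C(s + t, s))%:R *: z.
Proof.
move=> sz; apply/ffunP => C; rewrite !ffunE.
have [Cst|Cst] := eqVneq #|C| (s + t)%N; last first.
  rewrite (sz C) // scaler0 big1 // => A sAC; rewrite !ffunE.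
  have -> : A :|: C :\: A = C by rewrite setDE setUIr setUCr setIT; apply/setUidPr.
  by rewrite sz // scaler0 if_same scaler0.
rewrite -Cst -cards_draws -sum1_card natr_sum scaler_suml.
rewrite [RHS](eq_bigl (fun A : {set 'I_r} => (A \subset C) && (#|A| == s))); last first.
  by move=> A; rewrite inE.
rewrite big_mkcondr /=; apply: eq_bigr => A sAC; rewrite !ffunE.
have AE : A :|: C :\: A = C by rewrite setDE setUIr setUCr setIT; apply/setUidPr.
case: eqP => [As|_] /=; last by rewrite scaler0.
have -> : #|C :\: A| = t by rewrite cardsD (setIidPr sAC) Cst As addKn.
have -> : [disjoint A & C :\: A] by rewrite disjoint_sym disjoints_subset setDE subsetIr.
by rewrite eqxx /= AE scalerA ssgM scale1r.
Qed.

End Shuffle.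

(** * Low cohomology and regularity of cycle modules *)

Section LowDegrees.
Variables (k : fieldType) (n : nat) (E : lmodType {mpoly k[n]}).

Lemma cohom0_zero (p j : int) : cohom0 (fun _ (x : E) => x = 0) p j.
Proof.
move=> a m /coch_zero -> _; exists 0%N, 0; rewrite craise0 cdiff0.
by split=> // B; rewrite ffunE; case: ifP.
Qed.

Lemma cohom0_eq (A B : int -> E -> Prop) p j : (forall e x, A e x <-> B e x) ->
  cohom0 A p j -> cohom0 B p j.
Proof.
move=> AB; have -> // : A = B.
by apply/funext => e; apply/funext => x; apply/propext.
Qed.

(** H^0 is left exact: there are no cochains in position -1, so vanishing means that cocycles become
    zero after raising, and this passes to submodules. *)
Lemma cohom0_sub (A B : int -> E -> Prop) j : (forall e x, B e x -> A e x) ->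
  cohom0 A 0 j -> cohom0 B 0 j.
Proof.
move=> BA HA a m Hm dm.
have [||l [b [/coch_out b0 Eb]]] := HA a m => //; first by apply: coch_mono Hm => x; apply: BA.
exists l, 0; split; first by move=> C; rewrite ffunE; case: eqP => //; lia.
by rewrite Eb b0.
Qed.

End LowDegrees.

Section Retract.
Variables (k : fieldType) (n r : nat).
Notation S := {mpoly k[n]}.
Variables (d : 'I_r -> nat) (f : 'I_r -> S).
Hypothesis hf : forall i, f i \is (d i).-homog.
Notation hompart := (@hom_part k n).
Notation Z s := (cycles d f hompart s).

Lemma hom_ssg (A B : {set 'I_r}) : homog_int 0 (ssg S A B).
Proof.
rewrite /ssg; elim/big_rec: _ => [|i p _ hp]; first by rewrite -mpolyC1; apply: homC.
by apply: (@homM _ _ 0 0) => //; apply: hom_sign.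
Qed.

Lemma weight_setID (A C : {set 'I_r}) : A \subset C ->
  weight d C = weight d A + weight d (C :\: A).
Proof. by move=> sAC; rewrite /weight (big_setID A) (setIidPr sAC). Qed.

Lemma cycles_comul s t j (z : {ffun {set 'I_r} -> S^o}) :
  Z (s + t) j z -> cycles d f (Z t) s j (comul s t z).
Proof.
move=> [_ kz hz]; split.
- move=> A As; apply/ffunP => B; rewrite !ffunE.
  by rewrite (negPf As).
- exact: kos_comull.
- move=> A; split.
  + by move=> B Bt; rewrite !ffunE (negPf Bt) andbF.
  + exact: kos_comulr.
  + move=> B; rewrite !ffunE; case: ifP => [/and3P[_ _ AB]|_]; last exact: hom0.
    rewrite (_ : _ - _ = 0 + (j - weight d (A :|: B))).
      by apply: homM; [apply: hom_ssg|apply: hz].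
    rewrite (weight_setID (subsetUl A B)) setDUl setDv set0U (setDidPl _) 1?disjoint_sym //.
    by rewrite add0r opprD addrA.
Qed.

Lemma cycles_shuffle s t j (w : {ffun {set 'I_r} -> {ffun {set 'I_r} -> S^o}}) :
  cycles d f (Z t) s j w -> Z (s + t) j (shuffle w).
Proof.
move=> [sw kw hw]; split.
- move=> C Cst; rewrite ffunE big1 // => A sAC.
  have [As|As] := eqVneq #|A| s; last by rewrite sw // ffunE scaler0.
  have [swA _ _] := hw A; rewrite swA ?scaler0 //.
  by apply: contra Cst => /eqP <-; rewrite cardsD (setIidPr sAC) As subnKC // -As subset_leq_card.
- by apply: kos_shuffle => // A; have [] := hw A.
- move=> C; rewrite ffunE; apply: (gsub_sum (gsub_hom_part k n)) => A sAC.
  have [_ _ hA] := hw A.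
  rewrite (_ : _ - _ = 0 + (j - weight d A - weight d (C :\: A))).
    by apply: homM; [apply: hom_ssg|apply: hA].
  by rewrite (weight_setID sAC) add0r opprD addrA.
Qed.

Lemma cohom0_cycles_retract s t p j : ('C(s + t, s)%:R : k) != 0 ->
  cohom0 (cycles d f (Z t) s) p j -> cohom0 (Z (s + t)) p j.
Proof.
move=> b0; have gZ := gsub_cycles d f (gsub_hom_part k n) (s + t).
apply: (@cohom0_retract _ _ _ _ (comul s t)
  (fun w => ((('C(s + t, s)%:R : k)^-1)%:MP : S) *: shuffle w)).
- exact: comul_linear.
- by move=> a x y; rewrite shuffle_linear scalerDr !scalerA [_ * a]mulrC.
- by move=> e x; apply: cycles_comul.
- by move=> e y /cycles_shuffle; apply: gsubC.
- move=> e x [sx _ _]; rewrite shuffle_comul // scalerA -mpolyC_nat -mpolyCM.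
  by rewrite mulVf // mpolyC1 scale1r.
Qed.

(** Z_u is the kernel of a map of free modules. Its H^0 embeds in that of K_u; its H^1 lies between
    H^0 of the image, again inside a free module, and H^1 of K_u. Free modules have cohomology only
    in position n. *)
Lemma cohom0_cycles_low u (p : nat) j : (p < 2)%N -> (p < n)%N -> cohom0 (Z u) p%:Z j.
Proof.
move=> p2 pn.
(* The ambient module holds the whole Koszul complex; all positions but u are cut down to zero. *)
pose part (A : {set 'I_r}) (e : int) (x : S^o) := if #|A| == u then hompart e x else x = 0.
have gpart A : gsub (part A).
  by rewrite /part; case: (#|A| == u); [apply: gsub_hom_part|apply: gsub_zero].
pose F := gprod part (weight d).
have gF : gsub F by apply: gsub_gprod.
have HF (q : nat) i : (q < n)%N -> cohom0 F q%:Z i.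
  move=> qn; apply: cohom0_prod => // A; rewrite /part; case: (#|A| == u).
    by apply: cohom0_hom_part; left; lia.
  exact: cohom0_zero.
have ZF e x : gker (@kos _ _ f S^o) F e x <-> Z u e x.
  split=> [[Fx kx]|[sx kx hx]]; split=> //.
  - by move=> A /negPf Au; have := Fx A; rewrite /part Au.
  - move=> A; have := Fx A; rewrite /part; case: ifP => // _ ->; exact: hom0.
  - by move=> A; rewrite /part; case: ifP => [_|/negbT /sx //]; apply: hx.
apply: (cohom0_eq ZF).
pose B (e : int) y := exists x, F e x /\ kos f x = y.
case: p p2 pn => [|[|//]] _ pn.
  by apply: (@cohom0_sub _ _ _ F) => [e x []//|]; apply: HF.
apply: (@cohom0_ker _ _ _ _ (@kos _ _ f S^o) (@kos_linear _ _ f _) F B) => //.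
- by move=> e x Fx; exists x.
- exact: HF.
- rewrite subrr; apply: (@cohom0_sub _ _ _ (free_part (weight d))).
    move=> e _ [x [Fx <-]]; apply: gprod_kos => //; first exact: gsub_hom_part.
    by move=> A; have := Fx A; rewrite /part; case: ifP => // _ ->; apply: hom0.
  by apply: cohom0_free; lia.
Qed.

(** Positions 0 and 1 come for free, which is where n >= 2 is needed, so the tensor product matters
    from position 2 on only. The bound a is left open to cover the value -oo too. *)
Lemma regular_cycles s t a : (2 <= n)%N -> ('C(s + t, s)%:R : k) != 0 ->
  torsion_acyclic d f ->
  (forall (q : nat) (j : int), q.+2%:Z + j > a ->
     cohom0 (tens (Z s) (Z t)) q.+2%:Z j) ->
  regular_at (Z (s + t)) a.
Proof.
move=> n2 b0 tors H p j pj.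
have gh := gsub_hom_part k n; have gZ := gsub_cycles d f gh.
case: p pj => [p|p] pj; last by apply: cohom0_out => //; apply: gZ.
case: p pj => [|[|p]] pj; [by apply: cohom0_cycles_low; lia..|].
apply: cohom0_cycles_retract => //; apply: cohom0_cycles_tens => //.
exact: H.
Qed.

Lemma regular_cyclesD s t a b : (2 <= n)%N -> ('C(s + t, s)%:R : k) != 0 ->
  torsion_acyclic d f -> regular_at (Z s) a -> regular_at (Z t) b ->
  regular_at (Z (s + t)) (a + b).
Proof.
move=> n2 b0 tors ra rb; apply: regular_cycles => // q j qj.
have gh := gsub_hom_part k n; have gZ := gsub_cycles d f gh.
apply: (@tens_regular k n r d f hf tors _ _ b (gZ t) rb _ (weight d) (Z s) a) => //.
- by move=> i u [].
- by move=> i; apply: splits_at_cycles.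
Qed.

Lemma regular_cycles0 s t a : (2 <= n)%N -> ('C(s + t, s)%:R : k) != 0 ->
  torsion_acyclic d f ->
  (forall j z, Z s j z -> z = 0) \/ (forall j z, Z t j z -> z = 0) ->
  regular_at (Z (s + t)) a.
Proof.
move=> n2 b0 tors z0; apply: regular_cycles => // q j _.
apply: (@cohom0_eq _ _ _ (fun _ x => x = 0)); last exact: cohom0_zero.
move=> e x; split=> [->|]; first exact: tens0.
elim=> // i u y w Zu Zy _ ->; rewrite addr0; apply/ffunP => A; rewrite !ffunE.
by case: z0 => z0; [rewrite (z0 _ _ Zu) ffunE scale0r|rewrite (z0 _ _ Zy) scaler0].
Qed.

(** Otherwise the generator 1 of Z_0 = S, of degree 0, would be a combination of the variables with
    coefficients of degree -1. *)
Lemma regular_cycles_ge0 a : regular_at (Z 0) a -> 0 <= a.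
Proof.
move=> ra; rewrite leNgt; apply/negP => a0.
have gh := gsub_hom_part k n; have gZ := gsub_cycles d f gh 0.
have Z1 : Z 0 0 (unitv k n set0).
  split.
  - by move=> A A0; rewrite ffunE; case: (A =P set0) A0 => // ->; rewrite cards0.
  - apply/ffunP => B; rewrite !ffunE big1 // => i iB; rewrite ffunE.
    case: eqP => [/setP/(_ i)|_]; last by rewrite scaler0.
    by rewrite setU11 inE.
  - move=> A; rewrite ffunE; case: eqP => [->|_]; last exact: hom0.
    by rewrite /weight big_set0 subrr /= -[1]mpolyC1; apply: homC.
have [nu [Znu E1]] := castelnuovo gZ ra a0 Z1.
have nu0 i : nu i set0 = 0.
  by have [_ _ /(_ set0)] := Znu i; rewrite /weight big_set0 => /eqP.
move/ffunP/(_ set0): E1; rewrite sum_ffunE ffunE eqxx big1 => [/eqP|i _].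
  by rewrite oner_eq0.
by rewrite ffunE nu0 scaler0.
Qed.

(** Nakayama: [castelnuovo] applies in every degree, so each element is a combination of the
    variables with coefficients one degree lower, and degrees are bounded below. *)
Lemma cycles_eq0 s : (forall a, regular_at (Z s) a) -> forall j z, Z s j z -> z = 0.
Proof.
move=> ra j z Zz.
have gh := gsub_hom_part k n; have gZ := gsub_cycles d f gh s.
have [e0 He0] := @part_bounded k n _ (weight d) (Z s) (fun i u => fun H : Z s i u =>
  let: And3 _ _ h := H in h).
suff H (b : nat) : forall j z, j < e0 + b%:Z -> Z s j z -> z = 0.
  by apply: (H `|j - e0|.+1%N j) => //; lia.
elim: b => [|b IH] i u; first by rewrite addr0; apply: He0.
move=> ib Zu; have [|nu [Znu ->]] := @castelnuovo k n _ _ (i - 1) gZ (ra _) i u _ Zu.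
  by lia.
by rewrite big1 // => l _; rewrite (IH _ _ _ (Znu l)) ?scaler0 //; lia.
Qed.

End Retract.

(** * Comparison with the Cech complex *)

Local Notation frac := Defs.frac.

Section Fractions.
Variables (R : comNzRingType) (M : lmodType R) (f : R).

Lemma fracD a : {morph (fun m : M => frac f m a) : m m' / m + m'}.
Proof.
move=> m m' /=; rewrite -[RHS]/(loc_add (frac f m a) (frac f m' a)) loc_addE.
by rewrite -scalerDr frac_lift.
Qed.

Lemma frac0 a : frac f (0 : M) a = 0.
Proof. by apply/frac_eqP; exists 0%N; rewrite !scaler0. Qed.

Lemma fracZ c m a : c *: frac f m a = frac f (c *: m : M) a.
Proof. exact: loc_scaleE. Qed.

End Fractions.

Section CechKoszul.
Variables (k : fieldType) (n : nat).
Notation S := {mpoly k[n]}.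
Variables (M : lmodType S) (gr : int -> classical_sets.set M).
Hypothesis ggr : gsub gr.
Notation cochain := {ffun {set 'I_n} -> M}.

Definition cech_of (a : nat) (m : cochain) : cech M := fun B => frac (var_prod k B) (m B) a.

Lemma cech_of_craise a l m B : cech_of (l + a) (craise l m) B = cech_of a m B.
Proof. by rewrite /cech_of ffunE frac_lift. Qed.

Lemma cech_diff_of a m C : cech_diff (cech_of a m) C = cech_of a (cdiff a m) C.
Proof.
rewrite /cech_diff /cech_of ffunE (big_morph _ (@fracD _ M _ a) (@frac0 _ M _ a)).
apply: eq_bigr => i iC; rewrite loc_mapE; last by rewrite mulrC -var_prodD1.
by rewrite fracZ scalerA.
Qed.

Lemma cech_of_inj a (m m' : cochain) : (forall B, cech_of a m B = cech_of a m' B) ->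
  exists l, craise l m = craise l m'.
Proof.
move=> E.
have /choice[l Hl] : forall B : {set 'I_n}, exists l,
    var_prod k B ^+ l *: m B = var_prod k B ^+ l *: m' B.
  by move=> B; have /frac_eqP[l El] := E B; exists (l + a)%N.
exists (\max_B l B); apply/ffunP => B; rewrite !ffunE.
have lB : (l B <= \max_C l C)%N by apply: leq_bigmax.
by rewrite -(subnK lB) !scaler_expD Hl.
Qed.

Lemma cech_part_of (p j : int) a m : coch gr p (j + a%:Z * p) m ->
  cech_part gr p j (cech_of a m).
Proof.
move=> Hm B; move: (Hm B); case: ifP => [/eqP <- g|_ mB]; last by rewrite /cech_of mB frac0.
by exists (m B), a; split=> //; rewrite PoszM.
Qed.

Lemma cech_part_numerators (p j : int) c : cech_part gr p j c ->
  exists a m, coch gr p (j + a%:Z * p) m /\ forall B, c B = cech_of a m B.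
Proof.
move=> Hc.
have /choice[a /choice[m Hm]] : forall B : {set 'I_n}, exists a m,
    (if #|B|%:Z == p then gr (j + a%:Z * p) m else m = 0) /\
    c B = frac (var_prod k B) m a.
  move=> B; move: (Hc B); case: ifP => [/eqP <- [m [a [g ->]]]|_ ->].
    by exists a, m; rewrite -PoszM.
  by exists 0%N, 0; rewrite frac0.
pose L := \max_B a B.
have aL B : (a B <= L)%N by apply: leq_bigmax.
exists L, [ffun B => var_prod k B ^+ (L - a B) *: m B]; split=> B.
  rewrite ffunE; have [+ _] := Hm B; case: ifP => [/eqP cB g|_ ->]; last by rewrite scaler0.
  have -> : j + L%:Z * p = j + (a B)%:Z * p + ((L - a B) * #|B|)%N%:Z.
    by rewrite PoszM cB -{1}(subnK (aL B)); lia.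
  exact: (gsub_hom ggr (hom_var_prod _ _ _) g).
have [_ ->] := Hm B.
by rewrite /cech_of ffunE -{2}(subnK (aL B)) frac_lift.
Qed.

(** A Cech cochain has finitely many components, hence a common denominator exponent, and an
    equality of cochains becomes one of numerators after a common raising. *)
Lemma cohom0P (i : nat) (j : int) :
  cohom0 gr i%:Z j <-> ~ local_cohomology_neq0 gr i j.
Proof.
split=> [H [c [Hc dc]]|H a m Hm dm].
  apply; have [a [m [Hm cE]]] := cech_part_numerators Hc.
  have cmE : c = cech_of a m by apply: functional_extensionality_dep.
  have [B|l El] := @cech_of_inj a (cdiff a m) 0.
    by rewrite -cech_diff_of -cmE dc /cech_of ffunE frac0.
  have [||l' [b [Hb Eb]]] := H (l + a)%N (craise l m).
  - by apply: (coch_eq (coch_craise ggr l Hm)) => //; lia.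
  - by rewrite addnC cdiff_craise El craise0.
  exists (cech_of (l + a + l') b); first exact: cech_part_of.
  move=> C; rewrite cech_diff_of -Eb addnC cech_of_craise cech_of_craise.
  by rewrite cmE.
apply: contrapT => nb; apply: H; exists (cech_of a m).
  split; first exact: cech_part_of.
  by move=> C; rewrite cech_diff_of dm /cech_of ffunE frac0.
move=> [c Hc Ec]; apply: nb.
have [a' [b [Hb cE]]] := cech_part_numerators Hc.
have cmE : c = cech_of a' b by apply: functional_extensionality_dep.
have [B|l El] := @cech_of_inj (a + a') (craise a' m) (cdiff (a + a') (craise a b)).
  rewrite -cech_diff_of {1}addnC cech_of_craise Ec cmE.
  congr (cech_diff _ B); apply: functional_extensionality_dep => D.
  by rewrite cech_of_craise.
exists (a' + l)%N, (craise l (craise a b)); split.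
  rewrite addnA; apply: (coch_eq (coch_craise ggr l (coch_craise ggr a Hb))) => //; lia.
by rewrite addnA cdiff_craise -El craise_craise.
Qed.

End CechKoszul.

(** * Regularity bounds as vanishing statements *)

Section Suprema.
Local Open Scope ereal_scope.
Notation set := classical_sets.set.

(** On a nonempty set [supremum] picks some least upper bound, so it has a meaning only once one
    exists. In the bounded case with a finite element, the largest distance above that element gives
    a maximum. *)
Lemma ereal_int_supremums (A : set (\bar int)) : (exists x, A x) ->
  exists y, supremums A y.
Proof.
move=> [x0 Ax0].
have [[y [Ay yoo]]|noub] := pselect (exists y, ubound A y /\ y != +oo); last first.
  exists +oo; split=> [x _|y Ay]; first exact: leey.
  rewrite leye_eq; apply: contrapT => yoo; apply: noub; exists y; split=> //.
  exact/negP.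
have [[a Aa]|nfin] := pselect (exists a : int, A a%:E); last first.
  exists -oo; split=> [x Ax|z Az]; last exact: leNye.
  case: x Ax => [a|/Ay|//] Ax; first by case: nfin; exists a.
  by move: Ax; rewrite leye_eq (negPf yoo).
case: y Ay yoo => [N Ay _|//|/(_ _ Aa)]; last by rewrite leeNy_eq.
have ex : exists m, `[< exists b : int, A b%:E /\ (a + m%:Z)%R = b >].
  by exists 0%N; apply/asboolP; exists a; rewrite addr0.
have ub m : `[< exists b : int, A b%:E /\ (a + m%:Z)%R = b >] -> (m <= `|N - a|)%N.
  by move=> /asboolP[b [Ab bE]]; have := Ay _ Ab; rewrite -bE lee_fin; lia.
case: (ex_maxnP ex ub) => m /asboolP[b [+ bE]] mmax; rewrite -bE => Ab.
exists (a + m%:Z)%:E; split=> [x Ax|z Az]; last exact: Az.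
case: x Ax => [c|/Ay|] Ax; [|by move: Ax; rewrite leye_eq|exact: leNye].
rewrite lee_fin; have [ca|ac] := leP c a; first by lia.
have : (`|c - a| <= m)%N.
  by apply: mmax; apply/asboolP; exists c; split=> //; lia.
by lia.
Qed.

Lemma supremum_leP (A : set (\bar int)) (y : \bar int) :
  (supremum -oo A <= y) <-> (forall x, A x -> x <= y).
Proof.
have [[x0 Ax0]|nA] := pselect (exists x, A x); last first.
  have -> : A = classical_sets.set0.
    by apply/seteqP; split=> // x Ax; case: nA; exists x.
  by rewrite supremum0; split=> // _; exact: leNye.
have [z [ubz lbz]] := ereal_int_supremums (ex_intro _ x0 Ax0).
have -> : supremum -oo A = z.
  rewrite /supremum ifF; last by apply/negP => /eqP A0; rewrite A0 in Ax0.
  by case: xgetP => [w _ Aw|/(_ z)/(_ (conj ubz lbz))//]; apply: (@is_subset1_supremums _ _ A).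
split=> [zy x /ubz xz|H]; first exact: le_trans xz zy.
exact: lbz.
Qed.

End Suprema.

Section Regularity.
Variables (k : fieldType) (n r : nat).
Notation S := {mpoly k[n]}.
Variables (d : 'I_r -> nat) (f : 'I_r -> S).
Notation Z s := (cycles d f (@hom_part k n) s).
Notation reg s := (regularity (koszul_cycles f s) (cycle_degree d f s)).

Lemma cycle_degreeP t j (z : koszul_cycles f t) :
  cycle_degree d f t j z <-> Z t j (cycle_val z).
Proof.
have /andP[/forallP zp /eqP zd] := cycle_valP z.
split=> [H|[_ _ H] A]; last exact: H.
split=> // A At; apply/eqP; exact: implyP (zp A) At.
Qed.

Lemma cycles_val t j c : Z t j c -> exists z : koszul_cycles f t,
  cycle_degree d f t j z /\ cycle_val z = c.
Proof.
move=> [sc kc hc]; have cP : c \in is_cycle f t.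
  apply/andP; split; last exact/eqP.
  by apply/forallP => A; apply/implyP => /sc ->.
by exists (KoszulCycle cP).
Qed.

Lemma cycle_val_linear t : linear (@cycle_val k n r f t).
Proof. by []. Qed.

Lemma gsub_cycle_degree t : gsub (cycle_degree d f t).
Proof.
have g := gsub_cycles d f (gsub_hom_part k n) t.
split=> [j|j x y|j c x|j i x]; rewrite !cycle_degreeP.
- exact: (gsub0 g).
- exact: (gsubD g).
- exact: (gsubC g).
- by case: g => _ _ _; apply.
Qed.

(** Negative positions carry no cochains, so p may run over all integers. An arbitrary y in
    [\bar int] covers finite bounds and -oo at once. *)
Lemma regularityP t (y : \bar int) :
  (reg t <= y)%E <-> forall p j : int, ~ ((p + j)%:E <= y)%E -> cohom0 (Z t) p j.
Proof.
have inj : injective (@cycle_val k n r f t) by apply: val_inj.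
have cP (i : nat) j : cohom0 (Z t) i%:Z j <->
    ~ local_cohomology_neq0 (cycle_degree d f t) i j.
  rewrite -(cohom0P (gsub_cycle_degree t)); symmetry.
  apply: (cohom0_inj (@cycle_val_linear t) _ _ inj).
    by move=> e x /cycle_degreeP.
  by move=> e x; apply: cycles_val.
rewrite supremum_leP; split=> [H p j npj|H _ [i _ <-]].
  case: p npj => i npj; last first.
    by apply: cohom0_out => //; apply: gsub_cycles; apply: gsub_hom_part.
  apply/cP => nz; apply: npj; apply: le_trans (H _ _); last by exists i.
  rewrite addrC EFinD; apply: leeD2r.
  have /supremum_leP/(_ j%:E) := le_refl (a_invariant (cycle_degree d f t) i).
  by apply; exists j.
have Hj j : local_cohomology_neq0 (cycle_degree d f t) i j -> ((i%:Z + j)%:E <= y)%E.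
  by move=> nz; apply: contrapT => nij; apply: (proj1 (cP i j)) nz; apply: H.
case: y Hj {H} => [c|//|] Hj; [|exact: leey|].
  suff /(leeD2r i%:Z%:E) : (a_invariant (cycle_degree d f t) i <= (c - i%:Z)%:E)%E.
    by rewrite -EFinD subrK.
  by apply/supremum_leP => _ [j /Hj + <-]; rewrite !lee_fin; lia.
suff : (a_invariant (cycle_degree d f t) i <= -oo)%E by rewrite leeNy_eq => /eqP ->.
by apply/supremum_leP => _ [j /Hj + <-]; rewrite leeNy_eq.
Qed.

Lemma regularity_finP t (a : int) : (reg t <= a%:E)%E <-> regular_at (Z t) a.
Proof.
rewrite regularityP; split=> H p j pj; apply: H.
  by rewrite lee_fin => ?; lia.
by rewrite ltNge; apply/negP => H1; apply: pj; rewrite lee_fin.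
Qed.

Lemma regularity_NyP t : (reg t <= -oo)%E <-> forall a, regular_at (Z t) a.
Proof.
rewrite regularityP; split=> [H a p j _|H p j _]; first exact: H.
by apply: (H (p + j - 1)); lia.
Qed.

End Regularity.

(** A prime above s + t does not divide (s+t)!, of which the binomial coefficient is a divisor. *)
Lemma binomial_neq0 (k : fieldType) (s t : nat) :
  [pchar k] =i pred0 \/ (exists2 p : nat, p \in [pchar k] & (s + t < p)%N) ->
  ('C(s + t, s)%:R : k) != 0.
Proof.
have C0 : 'C(s + t, s) != 0%N by rewrite -lt0n bin_gt0 leq_addr.
case=> [/pcharf0P -> //|[p pk stp]].
rewrite -(dvdn_pcharf pk); have pp := pcharf_prime pk.
suff : ~~ (p %| (s + t)`!)%N.
  by apply: contra => pC; rewrite -(bin_fact (leq_addr t s)) dvdn_mulr.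
elim: (s + t)%N stp => [|m IH] mp; first by rewrite fact0 Euclid_dvd1.
rewrite factS Euclid_dvdM // negb_or IH ?andbT; last exact: ltnW.
by apply/negP => /(dvdn_leq (ltn0Sn _)); rewrite leqNgt mp.
Qed.

(** * Consequences of the hypotheses on the ideal *)

Section Generators.
Variables (k : fieldType) (n r : nat).
Notation S := {mpoly k[n]}.
Variables (I : {pred S}) (d : 'I_r -> nat) (f : 'I_r -> S).
Hypotheses (grI : graded_ideal I) (genI : minimal_homogeneous_generators I d f).

Lemma is_ideal_mem : is_ideal (fun p => p \in I).
Proof. by case: grI => I0 ID IM _; split=> [//|p q|a p]; [apply: ID|apply: IM]. Qed.

(** A strict chain of three primes over I would give dimension at least 2, so a parameter exists.
    Being killed by the generators extends to every homogeneous h in I, by taking homogeneous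
    components of the coefficients that express h. *)
Lemma torsion_acyclic_ideal : (dim_quotient I <= 1%:Z%:E)%E -> torsion_acyclic d f.
Proof.
have [hf If _] := genI; have [_ _ _ gI] := grI.
move=> dimI E A B gA gB BA fAB q j.
have chain (P0 P1 P2 : S -> Prop) : is_prime P0 -> is_prime P1 -> is_prime P2 ->
    (forall p, p \in I -> P0 p) -> (forall p, P0 p -> P1 p) -> (forall p, P1 p -> P2 p) ->
    (forall p, P1 p -> P0 p) \/ (forall p, P2 p -> P1 p).
  move=> pP0 pP1 pP2 IP0 P01 P12; apply: contrapT => /not_orP[n10 n21].
  pose P (i : nat) : {pred S} :=
    fun p => `[< if i is i'.+1 then if i' is 0%N then P1 p else P2 p else P0 p >].
  have : (2%:Z%:E <= dim_quotient I)%E.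
    have /supremum_leP := le_refl (dim_quotient I); apply; exists 2%N => //.
    exists P; split.
    - move=> i _.
      have [Q [[iQ Q1 QM] PQ]] : exists Q, is_prime Q /\ forall p, (p \in P i) <-> Q p.
        by case: i => [|[|i]]; [exists P0|exists P1|exists P2];
          split=> // p; split=> [/asboolP|H] //; apply/asboolP.
      split; last first.
        by move=> u v /PQ /QM[] /PQ ->; rewrite ?orbT.
      split; [exact/PQ/(ideal0 iQ)|by apply/negP => /PQ|].
      by move=> a u v /PQ Qu /PQ Qv; apply/PQ/(idealD iQ _ Qv)/(ideal_mull iQ).
    - by move=> p /IP0 H; apply/asboolP.
    - move=> [|[|//]] _; split.
      + by move=> p /asboolP/P01 H; apply/asboolP.
      + by move=> H; apply: n10 => p P1p; apply/asboolP/H/asboolP.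
      + by move=> p /asboolP/P12 H; apply/asboolP.
      + by move=> H; apply: n21 => p P2p; apply/asboolP/H/asboolP.
  by move=> /le_trans/(_ dimI); rewrite lee_fin.
have gI' p e : p \in I -> pihomog mdeg e p \in I by apply: gI.
have [D [N [y [g [D0 DN hy hg Ig]]]]] := exists_parameter_eqn is_ideal_mem gI' chain.
apply: (cohom0_torsion is_ideal_mem D0 DN hy hg Ig gA gB) => // e h l x.
case: e => e; last by move=> /eqP -> _ _; rewrite scale0r; apply: gsub0.
move=> /pihomog_dE hE /If[c cE] Ax.
have -> : h = \sum_(i < r) (if (d i <= e)%N then pihomog mdeg (e - d i) (c i) * f i else 0).
  by rewrite -hE cE raddf_sum; apply: eq_bigr => i _; apply: pihomogM.
rewrite scaler_suml; apply: gsub_sum => // i _; case: ifP => de; last first.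
  by rewrite scale0r; apply: gsub0.
have -> : l + e%:Z = l + (d i)%:Z + (e - d i)%N%:Z by lia.
rewrite -scalerA; apply: gsub_hom => //; last exact: fAB.
by rewrite hom_natP; apply: pihomogP.
Qed.

(** In at most one variable a nonzero homogeneous polynomial is a scalar times a monomial, and of
    two monomials one divides the other; two generators would contradict minimality. *)
Lemma generators_le1 : (n <= 1)%N -> (r <= 1)%N.
Proof.
move=> n1; have [hf _ fmin] := genI.
have lem (u v : 'X_{1..n}) : (mdeg u <= mdeg v)%N -> (u <= v)%MM.
  have mE (w : 'X_{1..n}) i : mdeg w = w i.
    rewrite mdegE (bigD1 i) //= big1 ?addn0 // => l /negP li; case: li.
    by apply/eqP/val_inj => /=; have := ltn_ord l; have := ltn_ord i; lia.
  by move=> uv; apply/mnm_lepP => i; rewrite -!mE.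
have nz i : f i != 0.
  apply/eqP => f0; apply: (fmin i); exists (fun=> 0).
  by rewrite f0 big1 // => l _; rewrite mul0r.
have fE i : exists c (u : 'X_{1..n}), [/\ c != 0, mdeg u = d i & f i = c%:MP * 'X_[u]].
  exists (f i)@_(mlead (f i)), (mlead (f i)); rewrite mleadc_eq0 nz.
  have du : mdeg (mlead (f i)) = d i by apply: (dhomogP _ _ _ (hf i)); apply: mlead_supp.
  split=> //; apply/mpolyP => v; rewrite mcoeffCM mcoeffX.
  have [<-|uv] := eqVneq; first by rewrite mulr1.
  rewrite mulr0; apply: dhomog_nemf_coeff (hf i) _.
  apply: contra uv => /eqP dv; apply/eqP/mnmP => t; apply/eqP; rewrite eqn_leq.
  by rewrite !(mnm_lepP (lem _ _ _)) // du -dv.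
rewrite leqNgt; apply/negP => r1.
pose i0 := Ordinal (ltnW r1); pose i1 := Ordinal r1.
have div i l : i != l -> (d i <= d l)%N -> False.
  move=> il dil; have [c [u [c0 du fiE]]] := fE i; have [c' [v [c'0 dv flE]]] := fE l.
  apply: (fmin l); exists (fun t => if t == i then (c' / c)%:MP * 'X_[v - u] else 0).
  rewrite (bigD1 i) //= eqxx big1 ?addr0 => [|t /andP[_ /negPf ->]]; last by rewrite mul0r.
  have uv : (u <= v)%MM by apply: lem; rewrite du dv.
  rewrite fiE flE -{1}(submK uv) mpolyXD -{1}(divfK c0 c') mpolyCM; ring.
have i01 : i0 != i1 by [].
by case/orP: (leq_total (d i0) (d i1)) => /div; apply; rewrite // eq_sym.
Qed.

End Generators.

Theorem theorem3p4 (k : fieldType) (n : nat) (I : {pred {mpoly k[n]}})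
    (r : nat) (d : 'I_r -> nat) (f : 'I_r -> {mpoly k[n]}) (s t : nat) :
  graded_ideal I ->
  minimal_homogeneous_generators I d f ->
  (dim_quotient I <= 1%:Z%:E)%E ->
  [pchar k] =i pred0 \/ (exists2 p : nat, p \in [pchar k] & (s + t < p)%N) ->
  (regularity (koszul_cycles f (s + t)) (cycle_degree d f (s + t)) <=
   regularity (koszul_cycles f t) (cycle_degree d f t) +
   regularity (koszul_cycles f s) (cycle_degree d f s))%E.
Proof.
move=> grI genI dimI chark; have hf : forall i, f i \is (d i).-homog by case: genI.
pose reg u := regularity (koszul_cycles f u) (cycle_degree d f u).
rewrite -[leLHS]/(reg (s + t)%N) -/(reg s) -/(reg t).
have reg0 : (0 <= reg 0%N)%E.
  case E0: (reg 0%N) => [a||] //; first rewrite lee_fin;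
    have := le_refl (reg 0%N); rewrite {2}E0.
    by move/regularity_finP; apply: regular_cycles_ge0.
  by move/regularity_NyP => /(_ (-1))/regular_cycles_ge0.
(* Adding reg(Z_0) >= 0 cannot decrease the other regularity. *)
case: (posnP s) => [->|s0]; first by rewrite add0n leeDl.
case: (posnP t) => [->|t0]; first by rewrite addn0 leeDr.
(* With r <= 1 and s + t >= 2 there is no index set of s + t elements, so Z_{s+t} = 0. *)
have [n1|n2] := leqP n 1.
  have r1 := generators_le1 genI n1.
  suff : (reg (s + t)%N <= -oo)%E by rewrite leeNy_eq => /eqP ->; apply: leNye.
  apply/regularity_NyP => a p j _.
  apply: (@cohom0_eq _ _ _ (fun _ x => x = 0)); last exact: cohom0_zero.
  move=> e x; split=> [->|[sx _ _]].
    exact: (gsub0 (gsub_cycles d f (gsub_hom_part k n) (s + t)%N)).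
  apply/ffunP => A; rewrite sx ?ffunE //.
  have : (#|A| <= r)%N by rewrite -[X in (_ <= X)%N]card_ord max_card.
  by lia.
have b0 := binomial_neq0 chark.
have tors := torsion_acyclic_ideal grI genI dimI.
have zero u : reg u = -oo%E -> forall j z, cycles d f (@hom_part k n) u j z -> z = 0.
  by move=> uE; apply: cycles_eq0; apply/regularity_NyP; rewrite -/(reg u) uE.
(* In [\bar int] a sum with a summand -oo is -oo, even against +oo, so one zero factor must already
   force the regularity of Z_{s+t} to be -oo. *)
have zeroD : reg s = -oo%E \/ reg t = -oo%E -> (reg (s + t)%N <= -oo)%E.
  move=> z; apply/regularity_NyP => a; apply: regular_cycles0 => //.
  by case: z => /zero z; [left|right].
case Et: (reg t) => [b||].
- case Es: (reg s) => [a||].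
  + rewrite -EFinD addrC; apply/regularity_finP; apply: regular_cyclesD => //;
      by apply/regularity_finP; rewrite -/(reg _) ?Es ?Et.
  + exact: leey.
  + by apply: zeroD; left.
- case Es: (reg s) => [a||]; [exact: leey|exact: leey|].
  by apply: zeroD; left.
- by apply: zeroD; right.
Qed.
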